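(* Let $0<\lambda\le 1$. For every $f\in\mathcal{U}(\lambda)$, the logarithmic coefficients $\gamma_n$ of $f$ satisfy $$\sum_{n=1}^{\infty}|\gamma_{n}|^{2} \leq \frac{1}{4}\left(\frac{\pi^{2}}{6}+2\,\mathrm{Li}_{2}(\lambda)+\mathrm{Li}_{2}(\lambda^{2})\right).$$ This inequality is sharp, i.e. equality is attained for some $f\in\mathcal{U}(\lambda)$. Further, there exists a function $f\in\mathcal{U}(\lambda)$ such that $|\gamma_{n}|>\dfrac{1+\lambda^n}{2n}$ for some $n\ge 1$.
   Context: Let $\mathbb{D}=\{z\in\mathbb{C}:|z|<1\}$ and let $\mathcal{A}$ be the class of functions $f$ analytic in $\mathbb{D}$ with $f(0)=0$ and $f'(0)=1$. For $0<\lambda\le 1$, $$\mathcal{U}(\lambda)=\left\{f\in\mathcal{A}:\ \left|\left(\frac{z}{f(z)}\right)^2f'(z)-1\right|<\lambda \text{ for all } z\in\mathbb{D}\right\}.$$ Functions in $\mathcal{U}(\lambda)$ are univalent in $\mathbb{D}$, so $f(z)/z$ (with value $1$ at $0$) is non-vanishing in $\mathbb{D}$. The logarithmic coefficients $\gamma_n$ of $f$ are defined by $\frac12\log\frac{f(z)}{z}=\sum_{n=1}^\infty\gamma_n z^n$, $z\in\mathbb{D}$, where the branch of the logarithm vanishes at $z=0$. The dilogarithm is $\mathrm{Li}_2(z)=\sum_{n=1}^\infty \frac{z^n}{n^2}$ for $|z|\le 1$. *)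

(* Defs.v *)
From Stdlib Require Import Reals.
From Coquelicot Require Import Coquelicot.

Open Scope R_scope.

Definition in_disk (z : C) : Prop := Cmod z < 1.

(* Only the values of f on the open unit disk matter: differentiability at a
   point of an open set is a local property. *)
Definition analytic_on_disk (f : C -> C) : Prop :=
  forall z : C, in_disk z -> @ex_derive C_AbsRing C_NormedModule f z.

Definition class_A (f : C -> C) : Prop :=
  analytic_on_disk f /\ f (RtoC 0) = RtoC 0 /\ C_derive f (RtoC 0) = RtoC 1.

(* z / f(z) and f(z) / z, extended at the removable singularity z = 0 of a
   function of class A by their common limit 1. *)
Definition z_over_f (f : C -> C) (z : C) : C :=
  if Ceq_dec z (RtoC 0) then RtoC 1 else Cdiv z (f z).

Definition f_over_z (f : C -> C) (z : C) : C :=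
  if Ceq_dec z (RtoC 0) then RtoC 1 else Cdiv (f z) z.

(* For lam <= 1 the inequality fails at a zero z <> 0 of f (where the expression
   has a pole), as it should: there z / f z = 0 in Coquelicot, so that the left
   side equals 1. *)
Definition class_U (lam : R) (f : C -> C) : Prop :=
  class_A f /\
  forall z : C, in_disk z ->
    Cmod (Cminus (Cmult (Cpow (z_over_f f z) 2) (C_derive f z)) (RtoC 1)) < lam.

Definition Cexp (z : C) : C := (exp (Re z) * cos (Im z), exp (Re z) * sin (Im z)).

(* L is the continuous branch of log (f(z)/z) in the disk with L(0) = 0. *)
Definition is_log_f_over_z (f L : C -> C) : Prop :=
  (forall z : C, in_disk z -> @continuous C_UniformSpace C_UniformSpace L z) /\
  L (RtoC 0) = RtoC 0 /\
  (forall z : C, in_disk z -> Cexp (L z) = f_over_z f z).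

(* The coefficients are g 1, g 2, ...; the value g 0 is irrelevant. *)
Definition log_coefficients (f : C -> C) (g : nat -> C) : Prop :=
  exists L : C -> C, is_log_f_over_z f L /\
    forall z : C, in_disk z ->
      @is_series C_AbsRing C_NormedModule
        (fun n : nat => Cmult (g (S n)) (Cpow z (S n)))
        (Cdiv (L z) (RtoC 2)).

(* The dilogarithm at a real argument; the series converges for |x| <= 1. *)
Definition Li2 (x : R) : R := Series (fun n : nat => x ^ S n / INR (S n) ^ 2).

(* Main.v *)
(** Write [f(z)/z = exp (L z)] with [L z = 2 sum gamma_n z^n] and [p = z/f = exp (- L)].
    Then [(z/f)^2 f' - 1 = p - z p' - 1 = - z^2 h'(z)] where [p(z) = 1 - a z + z h(z)], so the Schwarz
    lemma gives [|h'| <= lam].  After a dilation, [h] becomes a strict contraction of the closed disk,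
    and since [1/z - a + h(z)] has no zero in the disk, Banach's fixed point theorem (with a reflection
    in the unit circle) yields [a = conj zeta + h(zeta)] with [|zeta| <= 1].  Hence
    [p(z) = (1 - conj zeta z) (1 - u(z))] with [u(z) = z (h(zeta) - h(z)) / (1 - conj zeta z)] and
    [|u(z)| <= lam |z|], and [L = - log (1 - conj zeta z) + V] with [V = - log (1 - u)].
    In [sum |2 gamma_n|^2] the square of the first term is at most [Li2 1], that of [V] is at most
    [Li2 (lam^2)] by Rogosinski's theorem on subordinate functions, and the cross term
    [Re sum zeta^n v_n / n], the integral of [V(z)/z] from [0] to [zeta], is at most [Li2 lam] because
    [|V(z)| <= - log (1 - lam |z|)].  Integral means over circles are replaced by means over roots of
    unity. *)

Require Import Defs.
From Stdlib Require Import Reals Lra Lia Arith.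
From Coquelicot Require Import Coquelicot.
Open Scope R_scope.

(** * Finite sums and series of complex numbers *)

(** The termwise bound |2 gamma_n| <= (1 + lam^n) / n fails in the class, as the third claim shows,
    so the sum has to be estimated as a whole. For z / ((1 - z) (1 - lam z)) the terms are ((1 +
    lam^n) / n)^2, and expanding the square gives the three values of Li2. The factorization of p
    imitates this function, with conj zeta for the root factor 1 and u for lam z, so that each of
    the three terms is compared with its own extremal value. The point zeta enters through its
    conjugate because |h(zeta) - h(z)| <= lam |zeta - z| <= lam |1 - conj zeta z| is what bounds u.
    The equation for zeta is therefore not analytic, and a fixed point argument takes the place of a
    root count. The dilation is there because h is controlled in the open disk only, zeta may lie on
    the circle, and lam = 1 gives no strict contraction. The point zeta depends on the dilation but
    the resulting bound does not, so only finite partial sums have to pass to the limit. *)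

Fixpoint Csum (a : nat -> C) (n : nat) : C :=
  match n with O => RtoC 0 | S m => Cplus (Csum a m) (a m) end.

Fixpoint Rsum (a : nat -> R) (n : nat) : R :=
  match n with O => 0 | S m => Rsum a m + a m end.

Lemma Csum_ext (a b : nat -> C) (n : nat) :
  (forall k, (k < n)%nat -> a k = b k) -> Csum a n = Csum b n.
Proof.
  induction n as [|n IH]; intros H; simpl; trivial.
  rewrite IH, H; auto.
Qed.

Lemma Csum_plus (a b : nat -> C) (n : nat) :
  Csum (fun k => Cplus (a k) (b k)) n = Cplus (Csum a n) (Csum b n).
Proof. induction n as [|n IH]; simpl; [|rewrite IH]; ring. Qed.

Lemma Csum_scal (c : C) (a : nat -> C) (n : nat) :
  Csum (fun k => Cmult c (a k)) n = Cmult c (Csum a n).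
Proof. induction n as [|n IH]; simpl; [|rewrite IH]; ring. Qed.

Lemma Csum_conj (a : nat -> C) (n : nat) :
  Cconj (Csum a n) = Csum (fun k => Cconj (a k)) n.
Proof.
  induction n as [|n IH]; simpl.
  - unfold Cconj, RtoC; simpl; f_equal; ring.
  - now rewrite Cplus_conj, IH.
Qed.

Lemma Csum_swap (a : nat -> nat -> C) (n m : nat) :
  Csum (fun i => Csum (a i) m) n = Csum (fun j => Csum (fun i => a i j) n) m.
Proof.
  induction n as [|n IH]; simpl.
  - induction m as [|m IHm]; simpl; [|rewrite <- IHm]; ring.
  - rewrite IH, <- Csum_plus. reflexivity.
Qed.

Lemma Csum_zero (n : nat) : Csum (fun _ => RtoC 0) n = RtoC 0.
Proof. induction n as [|n IH]; simpl; [|rewrite IH]; ring. Qed.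

Lemma Csum_delta (a : nat -> C) (n m : nat) : (m < n)%nat ->
  (forall k, (k < n)%nat -> k <> m -> a k = RtoC 0) -> Csum a n = a m.
Proof.
  induction n as [|n IH]; intros Hm H; [lia|]; simpl.
  destruct (Nat.eq_dec m n) as [->|Hn].
  - rewrite (Csum_ext a (fun _ => RtoC 0)).
    + rewrite Csum_zero; ring.
    + intros k Hk; apply H; lia.
  - rewrite IH, (H n); [ring|lia|lia|lia|]. intros; apply H; lia.
Qed.

Lemma Csum_shift (a : nat -> C) (n : nat) :
  Csum a (S n) = Cplus (a O) (Csum (fun k => a (S k)) n).
Proof.
  induction n as [|n IH]; simpl in *; [ring|]. rewrite IH; ring.
Qed.

Lemma Rsum_ext (a b : nat -> R) (n : nat) :
  (forall k, (k < n)%nat -> a k = b k) -> Rsum a n = Rsum b n.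
Proof.
  induction n as [|n IH]; intros H; simpl; trivial.
  rewrite IH, H; auto.
Qed.

Lemma Rsum_plus (a b : nat -> R) (n : nat) :
  Rsum (fun k => a k + b k) n = Rsum a n + Rsum b n.
Proof. induction n as [|n IH]; simpl; [|rewrite IH]; ring. Qed.

Lemma Rsum_scal (c : R) (a : nat -> R) (n : nat) :
  Rsum (fun k => c * a k) n = c * Rsum a n.
Proof. induction n as [|n IH]; simpl; [|rewrite IH]; ring. Qed.

Lemma Rsum_const (c : R) (n : nat) : Rsum (fun _ => c) n = INR n * c.
Proof. induction n as [|n IH]; [simpl; ring|]. rewrite S_INR; simpl. rewrite IH; ring. Qed.

Lemma Rsum_le (a b : nat -> R) (n : nat) :
  (forall k, (k < n)%nat -> a k <= b k) -> Rsum a n <= Rsum b n.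
Proof.
  induction n as [|n IH]; intros H; simpl; [lra|].
  apply Rplus_le_compat; auto.
Qed.

Lemma Rsum_pos (a : nat -> R) (n : nat) :
  (forall k, (k < n)%nat -> 0 <= a k) -> 0 <= Rsum a n.
Proof.
  intros H. apply Rle_trans with (Rsum (fun _ => 0) n).
  - rewrite Rsum_const; lra.
  - now apply Rsum_le.
Qed.

Lemma Rsum_shift (a : nat -> R) (n : nat) :
  Rsum a (S n) = a O + Rsum (fun k => a (S k)) n.
Proof.
  induction n as [|n IH]; simpl in *; [ring|]. rewrite IH; ring.
Qed.

Lemma Rsum_sum_n (a : nat -> R) (n : nat) : sum_n a n = Rsum a (S n).
Proof.
  induction n as [|n IH].
  - rewrite sum_O; simpl; ring.
  - rewrite sum_Sn, IH; simpl. reflexivity.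
Qed.

Lemma Csum_RtoC (a : nat -> R) (n : nat) :
  Csum (fun k => RtoC (a k)) n = RtoC (Rsum a n).
Proof. induction n as [|n IH]; simpl; [|rewrite IH, RtoC_plus]; reflexivity. Qed.

Lemma Re_Csum (a : nat -> C) (n : nat) : Re (Csum a n) = Rsum (fun k => Re (a k)) n.
Proof. induction n as [|n IH]; simpl; [|rewrite <- IH, <- re_plus]; reflexivity. Qed.

Lemma Im_Csum (a : nat -> C) (n : nat) : Im (Csum a n) = Rsum (fun k => Im (a k)) n.
Proof. induction n as [|n IH]; simpl; [|rewrite <- IH, <- im_plus]; reflexivity. Qed.

Lemma Cmod_Csum (a : nat -> C) (n : nat) :
  Cmod (Csum a n) <= Rsum (fun k => Cmod (a k)) n.
Proof.
  induction n as [|n IH]; simpl; [rewrite Cmod_0; lra|].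
  eapply Rle_trans; [apply Cmod_triangle|lra].
Qed.

Lemma is_series_Rsum (a : nat -> R) (l : R) :
  is_series a l <-> is_lim_seq (Rsum a) l.
Proof.
  rewrite (is_lim_seq_incr_1 (Rsum a)).
  unfold is_series, is_lim_seq; simpl.
  split; intros H; (eapply filterlim_ext; [|exact H]); intros n;
    [|symmetry]; apply Rsum_sum_n.
Qed.

Lemma Rsum_le_series (a : nat -> R) (l : R) (n : nat) :
  (forall k, 0 <= a k) -> is_series a l -> Rsum a n <= l.
Proof.
  intros Ha Hl; apply is_series_Rsum in Hl.
  apply (is_lim_seq_incr_compare _ _ Hl).
  intros m; simpl. specialize (Ha m); lra.
Qed.

Lemma series_le_bound (a : nat -> R) (l M : R) :
  is_series a l -> (forall n, Rsum a n <= M) -> l <= M.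
Proof.
  intros Hl H. apply is_series_Rsum in Hl.
  apply (is_lim_seq_le (Rsum a) (fun _ => M) l M); auto using is_lim_seq_const.
Qed.

Lemma ex_series_bounded (a : nat -> R) (M : R) :
  (forall k, 0 <= a k) -> (forall n, Rsum a n <= M) -> ex_series a.
Proof.
  intros Ha HM.
  destruct (ex_finite_lim_seq_incr (Rsum a) M) as [l Hl]; auto.
  - intros n; simpl. specialize (Ha n); lra.
  - exists l. now apply is_series_Rsum.
Qed.

(** Coordinatewise, so that the theory of real series applies directly; [is_series_Cseries] shows
    the agreement with convergence in the normed module. *)
Definition Cseries (a : nat -> C) (l : C) : Prop :=
  is_series (fun n => Re (a n)) (Re l) /\ is_series (fun n => Im (a n)) (Im l).

Lemma sum_n_Csum (a : nat -> C_NormedModule) (n : nat) : sum_n a n = Csum a (S n).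
Proof.
  induction n as [|n IH].
  - rewrite sum_O; simpl. symmetry; apply Cplus_0_l.
  - rewrite sum_Sn, IH; simpl. reflexivity.
Qed.

Lemma is_series_Cseries (a : nat -> C) (l : C) :
  @is_series C_AbsRing C_NormedModule a l <-> Cseries a l.
Proof.
  unfold Cseries, is_series.
  assert (HR : forall n, sum_n (fun n => Re (a n)) n = Re (sum_n (a : nat -> C_NormedModule) n)).
  { intros n. rewrite sum_n_Csum, Re_Csum, Rsum_sum_n. reflexivity. }
  assert (HI : forall n, sum_n (fun n => Im (a n)) n = Im (sum_n (a : nat -> C_NormedModule) n)).
  { intros n. rewrite sum_n_Csum, Im_Csum, Rsum_sum_n. reflexivity. }
  split.
  - intros H. split; apply filterlim_locally; intros eps;
      generalize (proj1 (filterlim_locally _ _) H eps);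
      apply filter_imp; intros n [H1 H2].
    + rewrite HR; exact H1.
    + rewrite HI; exact H2.
  - intros [H1 H2]. apply filterlim_locally; intros eps.
    generalize (filter_and _ _ (proj1 (filterlim_locally _ _) H1 eps)
                  (proj1 (filterlim_locally _ _) H2 eps)).
    apply filter_imp; intros n [K1 K2]. rewrite HR in K1; rewrite HI in K2.
    split; assumption.
Qed.

Lemma C_ext (a b : C) : Re a = Re b -> Im a = Im b -> a = b.
Proof. destruct a, b; simpl; congruence. Qed.

Lemma Cseries_ext (a b : nat -> C) (l : C) :
  (forall n, a n = b n) -> Cseries a l -> Cseries b l.
Proof.
  intros H [H1 H2]; split; (eapply is_series_ext; [|eassumption]);
    intros n; simpl; now rewrite H.
Qed.

Lemma Cseries_unique (a : nat -> C) (l m : C) : Cseries a l -> Cseries a m -> l = m.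
Proof.
  intros [H1 H2] [K1 K2]; apply C_ext.
  - rewrite <- (is_series_unique _ _ H1); now apply is_series_unique.
  - rewrite <- (is_series_unique _ _ H2); now apply is_series_unique.
Qed.

Lemma Cseries_plus (a b : nat -> C) (l m : C) :
  Cseries a l -> Cseries b m -> Cseries (fun n => Cplus (a n) (b n)) (Cplus l m).
Proof.
  intros [H1 H2] [K1 K2]; split.
  - exact (is_series_plus _ _ _ _ H1 K1).
  - exact (is_series_plus _ _ _ _ H2 K2).
Qed.

Lemma Cseries_scal (c : C) (a : nat -> C) (l : C) :
  Cseries a l -> Cseries (fun n => Cmult c (a n)) (Cmult c l).
Proof.
  intros [H1 H2]; split.
  - rewrite re_mult.
    eapply is_series_ext; [|exact (is_series_minus _ _ _ _
      (is_series_scal (Re c) _ _ H1) (is_series_scal (Im c) _ _ H2))].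
    intros n; cbv beta. rewrite re_mult. reflexivity.
  - rewrite im_mult.
    eapply is_series_ext; [|exact (is_series_plus _ _ _ _
      (is_series_scal (Re c) _ _ H2) (is_series_scal (Im c) _ _ H1))].
    intros n; cbv beta. rewrite im_mult. reflexivity.
Qed.

Lemma Cseries_decr (a : nat -> C) (l : C) :
  Cseries (fun n => a (S n)) l -> Cseries a (Cplus l (a O)).
Proof.
  intros [H1 H2]; split; apply is_series_decr_1.
  - rewrite re_plus.
    replace (plus _ _) with (Re l); [exact H1|unfold plus, opp; simpl; ring].
  - rewrite im_plus.
    replace (plus _ _) with (Im l); [exact H2|unfold plus, opp; simpl; ring].
Qed.

Lemma Cseries_incr (a : nat -> C) (l : C) :
  Cseries a (Cplus l (a O)) -> Cseries (fun n => a (S n)) l.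
Proof.
  intros [H1 H2]; split; [apply (is_series_incr_1 (fun n => Re (a n)))
                         |apply (is_series_incr_1 (fun n => Im (a n)))].
  - rewrite re_plus in H1. exact H1.
  - rewrite im_plus in H2. exact H2.
Qed.

Lemma im_le_Cmod (c : C) : Rabs (Im c) <= Cmod c.
Proof.
  eapply Rle_trans; [apply Rmax_r|apply (Rmax_Cmod c)].
Qed.

Lemma Cmod_le_Re_Im (c : C) : Cmod c <= Rabs (Re c) + Rabs (Im c).
Proof.
  replace c with (Cplus (RtoC (Re c)) (Cmult Ci (RtoC (Im c)))) at 1.
  - eapply Rle_trans; [apply Cmod_triangle|].
    rewrite Cmod_mult, Cmod_Ci, !Cmod_R; lra.
  - apply C_ext; destruct c; simpl; ring.
Qed.

Lemma Cseries_ex (a : nat -> C) : ex_series (fun n => Cmod (a n)) -> exists l, Cseries a l.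
Proof.
  intros H.
  destruct (ex_series_le (V := R_CompleteNormedModule) (fun n => Re (a n)) (fun n => Cmod (a n)))
    as [x Hx]; auto.
  { intros n; apply re_le_Cmod. }
  destruct (ex_series_le (V := R_CompleteNormedModule) (fun n => Im (a n)) (fun n => Cmod (a n)))
    as [y Hy]; auto.
  { intros n; apply im_le_Cmod. }
  exists (x, y); split; assumption.
Qed.

Lemma is_lim_seq_abs_minus (u : nat -> R) (l : R) :
  is_lim_seq u l -> is_lim_seq (fun n => Rabs (u n - l)) 0.
Proof.
  intros H. apply -> is_lim_seq_abs_0. replace 0 with (l - l) by ring.
  apply is_lim_seq_minus'; auto using is_lim_seq_const.
Qed.

Lemma Cseries_lim (a : nat -> C) (l : C) : Cseries a l ->
  is_lim_seq (fun n => Cmod (Cminus (Csum a n) l)) 0.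
Proof.
  intros [H1 H2]; apply is_series_Rsum in H1; apply is_series_Rsum in H2.
  assert (K1 : is_lim_seq (fun n => Rabs (Rsum (fun k => Re (a k)) n - Re l)) 0).
  { now apply is_lim_seq_abs_minus. }
  assert (K2 : is_lim_seq (fun n => Rabs (Rsum (fun k => Im (a k)) n - Im l)) 0).
  { now apply is_lim_seq_abs_minus. }
  apply (is_lim_seq_le_le (fun _ => 0) _ (fun n => Rabs (Rsum (fun k => Re (a k)) n - Re l)
     + Rabs (Rsum (fun k => Im (a k)) n - Im l))).
  - intros n; split; [apply Cmod_ge_0|].
    eapply Rle_trans; [apply Cmod_le_Re_Im|].
    unfold Cminus. rewrite re_plus, im_plus, re_opp, im_opp, Re_Csum, Im_Csum.
    apply Rle_refl.
  - apply is_lim_seq_const.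
  - replace (Finite 0) with (Finite (0 + 0)) by (f_equal; ring).
    apply is_lim_seq_plus'; assumption.
Qed.

Lemma Cmod_minus_sym (x y : C) : Cmod (Cminus x y) = Cmod (Cminus y x).
Proof. rewrite <- Cmod_opp. f_equal; ring. Qed.

Lemma Cmod_triangle_minus (x y z : C) :
  Cmod (Cminus x z) <= Cmod (Cminus x y) + Cmod (Cminus y z).
Proof.
  replace (Cminus x z) with (Cplus (Cminus x y) (Cminus y z)) by ring.
  apply Cmod_triangle.
Qed.

Lemma Cmod_triangle_sub (x y : C) : Cmod x - Cmod y <= Cmod (Cminus x y).
Proof.
  replace x with (Cplus (Cminus x y) y) at 1 by ring.
  pose proof (Cmod_triangle (Cminus x y) y); lra.
Qed.

Lemma Cseries_tail_le (a : nat -> C) (b : nat -> R) (l : C) (m : R) (N : nat) :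
  Cseries a l -> is_series b m -> (forall n, Cmod (a n) <= b n) ->
  Cmod (Cminus l (Csum a N)) <= m - Rsum b N.
Proof.
  intros Ha Hb H.
  assert (Hab : forall n, (N <= n)%nat ->
     Cmod (Cminus (Csum a n) (Csum a N)) <= Rsum b n - Rsum b N).
  { intros n Hn; induction Hn as [|n Hn IH]; simpl.
    - replace (Cminus _ _) with (RtoC 0) by ring. rewrite Cmod_0; lra.
    - replace (Cminus _ _) with (Cplus (Cminus (Csum a n) (Csum a N)) (a n)) by ring.
      pose proof (Cmod_triangle (Cminus (Csum a n) (Csum a N)) (a n)).
      specialize (H n); lra. }
  apply Cseries_lim in Ha. apply is_series_Rsum in Hb.
  assert (K : is_lim_seq (fun n => Rsum b n - Rsum b N + Cmod (Cminus (Csum a n) l))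
                (m - Rsum b N + 0)).
  { apply is_lim_seq_plus'; [|exact Ha].
    apply is_lim_seq_minus'; [exact Hb|apply is_lim_seq_const]. }
  rewrite Rplus_0_r in K.
  refine (is_lim_seq_le_loc (fun _ => Cmod (Cminus l (Csum a N))) _ (Finite _) (Finite _) _ (is_lim_seq_const _) K).
  exists N; intros n Hn.
  pose proof (Cmod_triangle_minus l (Csum a n) (Csum a N)).
  rewrite (Cmod_minus_sym l (Csum a n)) in H0. specialize (Hab n Hn); lra.
Qed.

Lemma Cseries_le (a : nat -> C) (b : nat -> R) (l : C) (m : R) :
  Cseries a l -> is_series b m -> (forall n, Cmod (a n) <= b n) -> Cmod l <= m.
Proof.
  intros Ha Hb H. pose proof (Cseries_tail_le a b l m 0 Ha Hb H) as K; simpl in K.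
  replace (Cminus l (RtoC 0)) with l in K by ring. lra.
Qed.

Definition Cconv (a b : nat -> C) (n : nat) : C :=
  Csum (fun k => Cmult (a k) (b (n - k)%nat)) (S n).

Lemma ex_series_Rabs_le (a : nat -> R) (b : nat -> C) :
  (forall n, Rabs (a n) <= Cmod (b n)) -> ex_series (fun n => Cmod (b n)) ->
  ex_series (fun n => Rabs (a n)).
Proof.
  intros H Hb. apply (ex_series_le (V := R_CompleteNormedModule) _ (fun n => Cmod (b n))); auto.
  intros n. unfold norm; simpl. unfold abs; simpl. rewrite Rabs_Rabsolu. apply H.
Qed.

Lemma Cseries_mult (a b : nat -> C) (l m : C) :
  Cseries a l -> Cseries b m ->
  ex_series (fun n => Cmod (a n)) -> ex_series (fun n => Cmod (b n)) ->
  Cseries (Cconv a b) (Cmult l m).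
Proof.
  intros [H1 H2] [K1 K2] Ha Hb.
  assert (A1 := ex_series_Rabs_le _ _ (fun n => re_le_Cmod (a n)) Ha).
  assert (A2 := ex_series_Rabs_le _ _ (fun n => im_le_Cmod (a n)) Ha).
  assert (B1 := ex_series_Rabs_le _ _ (fun n => re_le_Cmod (b n)) Hb).
  assert (B2 := ex_series_Rabs_le _ _ (fun n => im_le_Cmod (b n)) Hb).
  assert (HS : forall f n, sum_f_R0 f n = Rsum f (S n)).
  { intros f n; rewrite <- sum_n_Reals; apply Rsum_sum_n. }
  split.
  - rewrite re_mult.
    eapply is_series_ext; [|exact (is_series_minus _ _ _ _
      (is_series_mult _ _ _ _ H1 K1 A1 B1) (is_series_mult _ _ _ _ H2 K2 A2 B2))].
    intros n; unfold Cconv. rewrite Re_Csum, !HS. unfold plus, opp; simpl plus; simpl opp.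
    rewrite (Rsum_ext (fun k => Re _) (fun k => Re (a k) * Re (b (n-k)%nat) +
       (-1) * (Im (a k) * Im (b (n-k)%nat)))).
    + rewrite Rsum_plus, Rsum_scal. simpl; ring.
    + intros k _; rewrite re_mult; ring.
  - rewrite im_mult.
    eapply is_series_ext; [|exact (is_series_plus _ _ _ _
      (is_series_mult _ _ _ _ H1 K2 A1 B2) (is_series_mult _ _ _ _ H2 K1 A2 B1))].
    intros n; unfold Cconv. rewrite Im_Csum, !HS. unfold plus; simpl plus.
    rewrite (Rsum_ext (fun k => Im _) (fun k => Re (a k) * Im (b (n-k)%nat) +
       (Im (a k) * Re (b (n-k)%nat)))).
    + rewrite Rsum_plus. simpl; ring.
    + intros k _; rewrite im_mult; ring.
Qed.

(** * Complex derivatives *)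

(** No quotient occurs, so w = z needs no exclusion and the chain rule is a composition of
    estimates. *)
Definition cderiv (F : C -> C) (z l : C) : Prop :=
  forall eps, 0 < eps -> exists delta, 0 < delta /\
    forall w, Cmod (Cminus w z) < delta ->
      Cmod (Cminus (Cminus (F w) (F z)) (Cmult l (Cminus w z))) <= eps * Cmod (Cminus w z).

Lemma cderiv_is_derive (F : C -> C) (z l : C) :
  cderiv F z l -> @is_derive C_AbsRing C_NormedModule F z l.
Proof.
  intros H. split; [apply is_linear_scal_l|].
  intros x Hx. apply (is_filter_lim_locally_unique (V := AbsRing_NormedModule C_AbsRing)) in Hx. subst x.
  intros eps. destruct (H eps (cond_pos eps)) as [d [Hd K]].
  exists (mkposreal d Hd). intros w Hw.
  specialize (K w Hw).
  replace (norm _) with (Cmod (Cminus (Cminus (F w) (F z)) (Cmult l (Cminus w z)))).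
  { exact K. }
  change (Cmod (Cminus (Cminus (F w) (F z)) (Cmult l (Cminus w z))) =
          Cmod (Cminus (Cminus (F w) (F z)) (Cmult (Cminus w z) l))).
  f_equal. ring.
Qed.

Lemma cderiv_ext_disk (F G : C -> C) (z l : C) :
  (forall w, Cmod w < 1 -> F w = G w) -> Cmod z < 1 -> cderiv F z l -> cderiv G z l.
Proof.
  intros H Hz K eps Heps. destruct (K eps Heps) as [d [Hd L]].
  exists (Rmin d (1 - Cmod z)). split; [apply Rmin_pos; lra|].
  intros w Hw. rewrite <- !H; trivial.
  - apply L. eapply Rlt_le_trans; [exact Hw|apply Rmin_l].
  - pose proof (Rmin_r d (1 - Cmod z)).
    pose proof (Cmod_triangle_sub w z); lra.
Qed.

Lemma cderiv_const (c z : C) : cderiv (fun _ => c) z (RtoC 0).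
Proof.
  intros eps He; exists 1; split; [lra|]; intros w _.
  replace (Cminus _ _) with (RtoC 0) by ring. rewrite Cmod_0.
  apply Rmult_le_pos; [lra|apply Cmod_ge_0].
Qed.

Lemma cderiv_id (z : C) : cderiv (fun z => z) z (RtoC 1).
Proof.
  intros eps He; exists 1; split; [lra|]; intros w _.
  replace (Cminus _ _) with (RtoC 0) by ring. rewrite Cmod_0.
  apply Rmult_le_pos; [lra|apply Cmod_ge_0].
Qed.

Lemma cderiv_plus (F G : C -> C) (z l m : C) :
  cderiv F z l -> cderiv G z m -> cderiv (fun z => Cplus (F z) (G z)) z (Cplus l m).
Proof.
  intros H K eps He.
  destruct (H (eps / 2)) as [d1 [Hd1 H1]]; [lra|].
  destruct (K (eps / 2)) as [d2 [Hd2 H2]]; [lra|].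
  exists (Rmin d1 d2); split; [now apply Rmin_pos|]. intros w Hw.
  specialize (H1 w (Rlt_le_trans _ _ _ Hw (Rmin_l _ _))).
  specialize (H2 w (Rlt_le_trans _ _ _ Hw (Rmin_r _ _))).
  replace (Cminus _ _) with
    (Cplus (Cminus (Cminus (F w) (F z)) (Cmult l (Cminus w z)))
           (Cminus (Cminus (G w) (G z)) (Cmult m (Cminus w z)))) by ring.
  eapply Rle_trans; [apply Cmod_triangle|]. lra.
Qed.

Lemma cderiv_comp (F G : C -> C) (z l m : C) :
  cderiv G z m -> cderiv F (G z) l -> cderiv (fun z => F (G z)) z (Cmult l m).
Proof.
  intros K H eps He.
  pose proof (Cmod_ge_0 m) as Pm. pose proof (Cmod_ge_0 l) as Pl.
  destruct (K (Rmin 1 (eps / 2 / (Cmod l + 1)))) as [d2 [Hd2 H2]].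
  { apply Rmin_pos; [lra|]. apply Rdiv_lt_0_compat; lra. }
  destruct (H (eps / 2 / (Cmod m + 1))) as [d1 [Hd1 H1]].
  { apply Rdiv_lt_0_compat; lra. }
  exists (Rmin d2 (d1 / (Cmod m + 1))); split.
  { apply Rmin_pos; [lra|]. apply Rdiv_lt_0_compat; lra. }
  intros w Hw.
  specialize (H2 w (Rlt_le_trans _ _ _ Hw (Rmin_l _ _))).
  assert (Hw' := Rlt_le_trans _ _ _ Hw (Rmin_r _ _)).
  set (t := Cmod (Cminus w z)) in *.
  assert (Pt : 0 <= t) by apply Cmod_ge_0.
  assert (HG : Cmod (Cminus (G w) (G z)) <= (Cmod m + 1) * t).
  { replace (Cminus (G w) (G z)) with
      (Cplus (Cminus (Cminus (G w) (G z)) (Cmult m (Cminus w z))) (Cmult m (Cminus w z))) by ring.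
    eapply Rle_trans; [apply Cmod_triangle|]. rewrite Cmod_mult. fold t.
    assert (Rmin 1 (eps / 2 / (Cmod l + 1)) * t <= 1 * t)
      by (apply Rmult_le_compat_r; [lra|apply Rmin_l]).
    lra. }
  assert (HG' : Cmod (Cminus (G w) (G z)) < d1).
  { eapply Rle_lt_trans; [exact HG|].
    apply Rlt_le_trans with ((Cmod m + 1) * (d1 / (Cmod m + 1))).
    - apply Rmult_lt_compat_l; lra.
    - right; field; lra. }
  specialize (H1 _ HG').
  replace (Cminus _ _) with
    (Cplus (Cminus (Cminus (F (G w)) (F (G z))) (Cmult l (Cminus (G w) (G z))))
       (Cmult l (Cminus (Cminus (G w) (G z)) (Cmult m (Cminus w z))))) by ring.
  eapply Rle_trans; [apply Cmod_triangle|]. rewrite Cmod_mult.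
  assert (A1 : eps / 2 / (Cmod m + 1) * Cmod (Cminus (G w) (G z)) <= eps / 2 * t).
  { apply Rle_trans with (eps / 2 / (Cmod m + 1) * ((Cmod m + 1) * t)).
    - apply Rmult_le_compat_l; [|exact HG]. left; apply Rdiv_lt_0_compat; lra.
    - right; field; lra. }
  assert (A2 : Cmod l * Cmod (Cminus (Cminus (G w) (G z)) (Cmult m (Cminus w z)))
               <= eps / 2 * t).
  { apply Rle_trans with ((Cmod l + 1) * (eps / 2 / (Cmod l + 1) * t)).
    - apply Rmult_le_compat; try apply Cmod_ge_0; [lra|].
      eapply Rle_trans; [exact H2|].
      apply Rmult_le_compat_r; [lra|apply Rmin_r].
    - right; field; lra. }
  lra.
Qed.

Lemma cderiv_sqr (z : C) : cderiv (fun z => Cmult z z) z (Cmult (RtoC 2) z).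
Proof.
  intros eps He; exists eps; split; [lra|]; intros w Hw.
  replace (Cminus _ _) with (Cmult (Cminus w z) (Cminus w z)) by ring.
  rewrite Cmod_mult. apply Rmult_le_compat_r; [apply Cmod_ge_0|lra].
Qed.

Lemma cderiv_scal (c : C) (F : C -> C) (z l : C) :
  cderiv F z l -> cderiv (fun z => Cmult c (F z)) z (Cmult c l).
Proof.
  intros H. apply (cderiv_comp (fun z => Cmult c z)); trivial.
  intros eps He; exists 1; split; [lra|]; intros w _.
  replace (Cminus _ _) with (RtoC 0) by ring. rewrite Cmod_0.
  apply Rmult_le_pos; [lra|apply Cmod_ge_0].
Qed.

Lemma cderiv_eq (F : C -> C) (z l m : C) : cderiv F z l -> l = m -> cderiv F z m.
Proof. now intros H <-. Qed.

Lemma cderiv_ext (F G : C -> C) (z l : C) :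
  (forall w, F w = G w) -> cderiv F z l -> cderiv G z l.
Proof.
  intros H K eps He. destruct (K eps He) as [d [Hd L]]. exists d; split; trivial.
  intros w Hw. rewrite <- !H. auto.
Qed.

(* Polarization: the product rule follows from the chain rule applied to the square. *)
Lemma cderiv_mult (F G : C -> C) (z l m : C) :
  cderiv F z l -> cderiv G z m ->
  cderiv (fun z => Cmult (F z) (G z)) z (Cplus (Cmult l (G z)) (Cmult (F z) m)).
Proof.
  intros H K.
  assert (A := cderiv_comp _ _ _ _ _ (cderiv_plus _ _ _ _ _ H K) (cderiv_sqr _)).
  assert (B := cderiv_comp _ _ _ _ _
    (cderiv_plus _ _ _ _ _ H (cderiv_scal (RtoC (-1)) _ _ _ K)) (cderiv_sqr _)).
  assert (D := cderiv_scal (Cinv (RtoC 4)) _ _ _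
    (cderiv_plus _ _ _ _ _ A (cderiv_scal (RtoC (-1)) _ _ _ B))).
  refine (cderiv_eq _ _ _ _ (cderiv_ext _ _ _ _ _ D) _).
  - intros w. field.
  - field.
Qed.

(** * The complex exponential and its derivative *)

Lemma Cexp_plus (a b : C) : Cexp (Cplus a b) = Cmult (Cexp a) (Cexp b).
Proof.
  unfold Cexp. rewrite re_plus, im_plus, exp_plus, cos_plus, sin_plus.
  apply C_ext; simpl; ring.
Qed.

Lemma Cexp_0 : Cexp (RtoC 0) = RtoC 1.
Proof. unfold Cexp; simpl. rewrite exp_0, cos_0, sin_0. apply C_ext; simpl; ring. Qed.

Lemma Cexp_neq_0 (z : C) : Cexp z <> RtoC 0.
Proof.
  intros H. apply C1_nz. rewrite <- Cexp_0.
  replace (RtoC 0) with (Cplus z (Copp z)) at 1 by ring. rewrite Cexp_plus, H. ring.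
Qed.

Lemma Cexp_opp (z : C) : Cexp (Copp z) = Cinv (Cexp z).
Proof.
  assert (H : Cmult (Cexp z) (Cexp (Copp z)) = RtoC 1).
  { rewrite <- Cexp_plus, <- Cexp_0. f_equal; ring. }
  pose proof (Cexp_neq_0 z) as N.
  transitivity (Cmult (Cinv (Cexp z)) (Cmult (Cexp z) (Cexp (Copp z)))).
  - now field.
  - rewrite H; ring.
Qed.

Lemma derivable_pt_lim_0 (f : R -> R) (l eps : R) : derivable_pt_lim f 0 l -> 0 < eps ->
  exists d, 0 < d /\ forall x, Rabs x < d -> Rabs (f x - f 0 - l * x) <= eps * Rabs x.
Proof.
  intros H He. destruct (H eps He) as [d K]. exists d; split; [apply cond_pos|].
  intros x Hx. destruct (Req_dec x 0) as [->|N].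
  - replace (f 0 - f 0 - l * 0) with 0 by ring. rewrite Rabs_R0; lra.
  - specialize (K x N Hx). rewrite Rplus_0_l in K.
    replace (f x - f 0 - l * x) with (((f x - f 0) / x - l) * x) by (field; trivial).
    rewrite Rabs_mult. apply Rmult_le_compat_r; [apply Rabs_pos|lra].
Qed.

Lemma cderiv_Cexp_0 : cderiv Cexp (RtoC 0) (RtoC 1).
Proof.
  (* Nine counts the multiples of [eps * t] collected at the end: 1 + 3 from the real part and 1 + 1
     + 3 from the imaginary part. The cap 1 on [eps] yields |1 + x + E| <= 3. *)
  intros eps0 He0. set (eps := Rmin 1 (eps0 / 9)).
  assert (He : 0 < eps) by (apply Rmin_pos; lra).
  assert (He1 : eps <= 1) by apply Rmin_l.
  assert (He2 : 9 * eps <= eps0).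
  { assert (eps <= eps0 / 9) by apply Rmin_r. lra. }
  destruct (derivable_pt_lim_0 exp 1 eps) as [d1 [Hd1 H1]]; trivial.
  { rewrite <- exp_0. apply derivable_pt_lim_exp. }
  destruct (derivable_pt_lim_0 cos 0 eps) as [d2 [Hd2 H2]]; trivial.
  { pose proof (derivable_pt_lim_cos 0) as K. now rewrite sin_0, Ropp_0 in K. }
  destruct (derivable_pt_lim_0 sin 1 eps) as [d3 [Hd3 H3]]; trivial.
  { rewrite <- cos_0. apply derivable_pt_lim_sin. }
  (* With [eps] in the radius, |w| < eps turns the quadratic term x y into a multiple of
     [eps * t]. *)
  exists (Rmin (Rmin d1 d2) (Rmin d3 eps)). split; [repeat apply Rmin_pos; lra|].
  intros w Hw.
  replace (Cminus w (RtoC 0)) with w in * by ring. rewrite Cexp_0, Cmult_1_l.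
  pose proof (Rmin_l (Rmin d1 d2) (Rmin d3 eps)). pose proof (Rmin_r (Rmin d1 d2) (Rmin d3 eps)).
  pose proof (Rmin_l d1 d2). pose proof (Rmin_r d1 d2).
  pose proof (Rmin_l d3 eps). pose proof (Rmin_r d3 eps).
  pose proof (re_le_Cmod w) as Pr. pose proof (im_le_Cmod w) as Pi.
  assert (Hd : Cmod w < eps) by lra.
  specialize (H1 (Re w) ltac:(lra)). specialize (H2 (Im w) ltac:(lra)).
  specialize (H3 (Im w) ltac:(lra)).
  rewrite exp_0 in H1; rewrite cos_0 in H2; rewrite sin_0 in H3.
  eapply Rle_trans; [apply Cmod_le_Re_Im|].
  unfold Cminus. rewrite !re_plus, !im_plus, !re_opp, !im_opp.
  unfold Cexp. rewrite re_RtoC, im_RtoC.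
  set (x := Re w) in *. set (y := Im w) in *. set (t := Cmod w) in *.
  set (E := exp x - 1 - 1 * x) in *. set (c := cos y - 1 - 0 * y) in *.
  set (s := sin y - 0 - 1 * y) in *.
  assert (Pt : 0 <= t) by apply Cmod_ge_0.
  change (Re (exp x * cos y, exp x * sin y)) with (exp x * cos y).
  change (Im (exp x * cos y, exp x * sin y)) with (exp x * sin y).
  replace (exp x * cos y + - (1) + - x) with (E + (1 + x + E) * c) by (unfold E, c; ring).
  replace (exp x * sin y + - 0 + - y) with (x * y + E * y + (1 + x + E) * s)
    by (unfold E, s; ring).
  assert (BE : Rabs E <= eps * t)
    by (eapply Rle_trans; [exact H1|apply Rmult_le_compat_l; lra]).
  assert (BC : Rabs c <= eps * t)
    by (eapply Rle_trans; [exact H2|apply Rmult_le_compat_l; lra]).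
  assert (BS : Rabs s <= eps * t)
    by (eapply Rle_trans; [exact H3|apply Rmult_le_compat_l; lra]).
  assert (Bet : eps * t <= 1) by nra.
  assert (B1 : Rabs (1 + x + E) <= 3).
  { eapply Rle_trans; [apply Rabs_triang|].
    eapply Rle_trans; [apply Rplus_le_compat_r; apply Rabs_triang|].
    rewrite Rabs_R1. lra. }
  assert (M1 : Rabs ((1 + x + E) * c) <= 3 * (eps * t)).
  { rewrite Rabs_mult. apply Rmult_le_compat; try apply Rabs_pos; lra. }
  assert (M2 : Rabs ((1 + x + E) * s) <= 3 * (eps * t)).
  { rewrite Rabs_mult. apply Rmult_le_compat; try apply Rabs_pos; lra. }
  assert (M3 : Rabs (x * y) <= eps * t).
  { rewrite Rabs_mult. apply Rmult_le_compat; try apply Rabs_pos; lra. }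
  assert (M4 : Rabs (E * y) <= eps * t).
  { rewrite Rabs_mult. rewrite <- (Rmult_1_r (eps * t)).
    apply Rmult_le_compat; try apply Rabs_pos; lra. }
  pose proof (Rabs_triang E ((1 + x + E) * c)).
  pose proof (Rabs_triang (x * y + E * y) ((1 + x + E) * s)).
  pose proof (Rabs_triang (x * y) (E * y)).
  assert (9 * eps * t <= eps0 * t) by (apply Rmult_le_compat_r; lra).
  lra.
Qed.

Lemma cderiv_Cexp (z : C) : cderiv Cexp z (Cexp z).
Proof.
  assert (A : cderiv (fun w => Cplus w (Copp z)) z (Cplus (RtoC 1) (RtoC 0))).
  { apply cderiv_plus; [apply cderiv_id|apply cderiv_const]. }
  assert (B := cderiv_Cexp_0). replace (RtoC 0) with (Cplus z (Copp z)) in B by ring.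
  assert (D := cderiv_scal (Cexp z) _ _ _ (cderiv_comp _ _ _ _ _ A B)).
  eapply cderiv_eq; [eapply cderiv_ext; [|exact D]|ring].
  intros w. cbv beta. rewrite <- Cexp_plus. f_equal; ring.
Qed.

(** Reduces the derivative along a segment to a real function of one variable, for which a mean
    value theorem holds; [e] selects the direction in the target. *)
Lemma cderiv_line (F : C -> C) (z d e l : C) (t : R) :
  cderiv F (Cplus z (Cmult (RtoC t) d)) l ->
  derivable_pt_lim (fun t => Re (Cmult e (F (Cplus z (Cmult (RtoC t) d))))) t
    (Re (Cmult e (Cmult l d))).
Proof.
  intros H eps He.
  pose proof (Cmod_ge_0 e) as Pe. pose proof (Cmod_ge_0 d) as Pd.
  destruct (H (eps / 2 / ((Cmod e + 1) * (Cmod d + 1)))) as [r [Hr K]].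
  { apply Rdiv_lt_0_compat; [lra|]. apply Rmult_lt_0_compat; lra. }
  assert (Hr' : 0 < r / (Cmod d + 1)) by (apply Rdiv_lt_0_compat; lra).
  exists (mkposreal _ Hr'). intros h Hh0 Hh; simpl in Hh.
  set (a := Cplus z (Cmult (RtoC t) d)) in *.
  assert (Ea : Cplus z (Cmult (RtoC (t + h)) d) = Cplus a (Cmult (RtoC h) d))
    by (unfold a; rewrite RtoC_plus; ring).
  rewrite Ea. specialize (K (Cplus a (Cmult (RtoC h) d))).
  replace (Cminus (Cplus a (Cmult (RtoC h) d)) a) with (Cmult (RtoC h) d) in K by ring.
  rewrite Cmod_mult, Cmod_R in K.
  pose proof (Rabs_pos_lt h Hh0) as Ph.
  assert (K1 : Rabs h * Cmod d < r).
  { apply Rle_lt_trans with (Rabs h * (Cmod d + 1)); [apply Rmult_le_compat_l; lra|].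
    apply Rlt_le_trans with (r / (Cmod d + 1) * (Cmod d + 1)).
    - apply Rmult_lt_compat_r; lra.
    - right; field; lra. }
  specialize (K K1).
  set (X := F (Cplus a (Cmult (RtoC h) d))) in *.
  replace ((Re (Cmult e X) - Re (Cmult e (F a))) / h - Re (Cmult e (Cmult l d))) with
    (Re (Cmult e (Cminus (Cminus X (F a)) (Cmult l (Cmult (RtoC h) d)))) / h).
  2:{ replace (Cmult e (Cminus (Cminus X (F a)) (Cmult l (Cmult (RtoC h) d)))) with
        (Cplus (Cplus (Cmult e X) (Copp (Cmult e (F a))))
               (Copp (Cmult (RtoC h) (Cmult e (Cmult l d))))) by ring.
      rewrite !re_plus, !re_opp, re_scal_l. field; trivial. }
  unfold Rdiv. rewrite Rabs_mult, Rabs_inv.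
  apply Rle_lt_trans with (eps / 2); [|lra].
  apply Rmult_le_reg_r with (Rabs h); [lra|].
  rewrite Rmult_assoc, Rinv_l, Rmult_1_r by lra.
  eapply Rle_trans; [apply re_le_Cmod|]. rewrite Cmod_mult.
  apply Rle_trans with ((Cmod e + 1) *
    (eps / 2 / ((Cmod e + 1) * (Cmod d + 1)) * (Rabs h * (Cmod d + 1)))).
  - apply Rmult_le_compat; try apply Cmod_ge_0; [lra|].
    eapply Rle_trans; [exact K|]. apply Rmult_le_compat_l.
    + left. apply Rdiv_lt_0_compat; [lra|]. apply Rmult_lt_0_compat; lra.
    + apply Rmult_le_compat_l; lra.
  - right; field; lra.
Qed.

(** The mean value theorem fails for complex values. Projection by e = conj (F w - F z) repairs
    this: Re (e (F w - F z)) is |F w - F z|^2, and one factor |F w - F z| cancels. *)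
Lemma cderiv_lipschitz (F D : C -> C) (z w : C) (M : R) :
  (forall t, 0 <= t <= 1 -> let x := Cplus z (Cmult (RtoC t) (Cminus w z)) in
     cderiv F x (D x) /\ Cmod (D x) <= M) ->
  Cmod (Cminus (F w) (F z)) <= M * Cmod (Cminus w z).
Proof.
  intros H. set (d := Cminus w z) in *. set (e := Cconj (Cminus (F w) (F z))).
  destruct (MVT_cor2 (fun t => Re (Cmult e (F (Cplus z (Cmult (RtoC t) d)))))
    (fun t => Re (Cmult e (Cmult (D (Cplus z (Cmult (RtoC t) d))) d))) 0 1) as [c [Hc1 Hc2]].
  { lra. }
  { intros t Ht. apply cderiv_line. apply (H t Ht). }
  replace (Cplus z (Cmult (RtoC 1) d)) with w in Hc1 by (unfold d; ring).
  replace (Cplus z (Cmult (RtoC 0) d)) with z in Hc1 by ring.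
  destruct (H c ltac:(lra)) as [_ HM]. cbv zeta in HM.
  set (X := D (Cplus z (Cmult (RtoC c) d))) in *.
  assert (E1 : Re (Cmult e (F w)) - Re (Cmult e (F z)) = Cmod (Cminus (F w) (F z)) ^ 2).
  { rewrite Cmod2_alt. unfold e, Cminus. rewrite !re_mult, re_conj, im_conj, !re_plus, !im_plus,
      !re_opp, !im_opp. ring. }
  rewrite E1 in Hc1.
  set (Y := Cmod (Cminus (F w) (F z))) in *.
  assert (PY : 0 <= Y) by apply Cmod_ge_0.
  pose proof (re_le_Cmod (Cmult e (Cmult X d))) as B.
  rewrite !Cmod_mult in B. unfold e in B at 2. rewrite Cmod_conj in B. fold Y in B.
  pose proof (Rle_abs (Re (Cmult e (Cmult X d)))).
  assert (Cmod X * Cmod d <= M * Cmod d) by (apply Rmult_le_compat_r; [apply Cmod_ge_0|lra]).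
  destruct (Req_dec Y 0) as [Z|NZ].
  - rewrite Z. apply Rmult_le_pos; [|apply Cmod_ge_0]. pose proof (Cmod_ge_0 X); lra.
  - apply Rmult_le_reg_l with Y; [lra|]. nra.
Qed.

Lemma cderiv_zero_const_disk (F : C -> C) :
  (forall z, Cmod z < 1 -> cderiv F z (RtoC 0)) ->
  forall z, Cmod z < 1 -> F z = F (RtoC 0).
Proof.
  intros H z Hz. apply Ceq_minus. apply Cmod_eq_0. apply Rle_antisym; [|apply Cmod_ge_0].
  apply Rle_trans with (0 * Cmod (Cminus z (RtoC 0))); [|lra].
  apply (cderiv_lipschitz F (fun _ => RtoC 0)). intros t Ht x. split.
  - apply H. unfold x.
    replace (Cplus _ _) with (Cmult (RtoC t) z) by ring.
    rewrite Cmod_mult, Cmod_R, Rabs_pos_eq by lra.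
    pose proof (Cmod_ge_0 z); nra.
  - rewrite Cmod_0; lra.
Qed.

Lemma cderiv_continuous (F : C -> C) (z l : C) : cderiv F z l ->
  @continuous C_UniformSpace C_UniformSpace F z.
Proof.
  intros H. apply filterlim_locally. intros eps.
  destruct (H 1) as [d [Hd K]]; [lra|].
  assert (Pl := Cmod_ge_0 l).
  (* Balls of [C_UniformSpace] are coordinatewise; half the radius controls |Re| + |Im| and hence
     the modulus. *)
  assert (Pd : 0 < Rmin d (eps / (Cmod l + 1)) / 2).
  { apply Rdiv_lt_0_compat; [|lra]. apply Rmin_pos; trivial.
    apply Rdiv_lt_0_compat; [apply cond_pos|lra]. }
  exists (mkposreal _ Pd). intros w [W1 W2].
  assert (W : Cmod (Cminus w z) < Rmin d (eps / (Cmod l + 1))).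
  { eapply Rle_lt_trans; [apply Cmod_le_Re_Im|].
    unfold Cminus; rewrite re_plus, im_plus, re_opp, im_opp.
    change (Rabs (Re w - Re z) < Rmin d (eps / (Cmod l + 1)) / 2) in W1.
    change (Rabs (Im w - Im z) < Rmin d (eps / (Cmod l + 1)) / 2) in W2.
    unfold Rminus in *. lra. }
  specialize (K w (Rlt_le_trans _ _ _ W (Rmin_l _ _))).
  assert (B : Cmod (Cminus (F w) (F z)) < eps).
  { replace (Cminus (F w) (F z)) with (Cplus (Cminus (Cminus (F w) (F z)) (Cmult l (Cminus w z)))
      (Cmult l (Cminus w z))) by ring.
    eapply Rle_lt_trans; [apply Cmod_triangle|]. rewrite Cmod_mult.
    apply Rle_lt_trans with ((Cmod l + 1) * Cmod (Cminus w z)); [lra|].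
    apply Rlt_le_trans with ((Cmod l + 1) * (eps / (Cmod l + 1))).
    - apply Rmult_lt_compat_l; [lra|]. eapply Rlt_le_trans; [exact W|apply Rmin_r].
    - right; field; lra. }
  split.
  - eapply Rle_lt_trans; [|exact B]. eapply Rle_trans; [|apply re_le_Cmod]. apply Rle_refl.
  - eapply Rle_lt_trans; [|exact B]. eapply Rle_trans; [|apply im_le_Cmod]. apply Rle_refl.
Qed.

(** * Power series in the unit disk *)

Definition disk_series (c : nat -> C) (F : C -> C) : Prop :=
  forall z, Cmod z < 1 -> Cseries (fun n => Cmult (c n) (Cpow z n)) (F z).

(** The radius of convergence is at least 1. Bounded terms propagate through recursions more easily
    than summability, which [disk_bounded_summable] recovers from a larger radius. *)
Definition disk_bounded (c : nat -> C) : Prop :=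
  forall r, 0 <= r < 1 -> exists M, forall n, Cmod (c n) * r ^ n <= M.

Lemma Cseries_terms_bounded (a : nat -> C) (l : C) :
  Cseries a l -> exists M, forall n, Cmod (a n) <= M.
Proof.
  intros H. apply Cseries_lim in H.
  destruct (maj_by_pos (fun n => Cmod (Cminus (Csum a n) l))) as [M [_ HM]].
  { exists 0. now apply is_lim_seq_Reals. }
  exists (2 * M). intros n.
  pose proof (HM n) as H1. pose proof (HM (S n)) as H2.
  rewrite Rabs_pos_eq in H1, H2 by apply Cmod_ge_0.
  pose proof (Cmod_triangle_minus (Csum a (S n)) l (Csum a n)) as H3.
  rewrite (Cmod_minus_sym l) in H3.
  replace (Cminus (Csum a (S n)) (Csum a n)) with (a n) in H3 by (simpl; ring). lra.
Qed.

Lemma disk_series_bounded (c : nat -> C) (F : C -> C) : disk_series c F -> disk_bounded c.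
Proof.
  intros H r Hr.
  assert (Er : Cmod (RtoC r) = r) by (rewrite Cmod_R, Rabs_pos_eq; lra).
  destruct (Cseries_terms_bounded _ _ (H (RtoC r) ltac:(lra))) as [M HM].
  exists M. intros n. specialize (HM n).
  now rewrite Cmod_mult, Cmod_pow, Er in HM.
Qed.

Lemma pow_div (a b : R) (n : nat) : b <> 0 -> (a / b) ^ n * b ^ n = a ^ n.
Proof. intros Hb. rewrite <- Rpow_mult_distr. f_equal. now field. Qed.

Lemma disk_bounded_summable (c : nat -> C) (r : R) :
  disk_bounded c -> 0 <= r < 1 -> ex_series (fun n => Cmod (c n) * r ^ n).
Proof.
  (* As r < rho < 1, the bound M at rho leaves the geometric majorant M (r / rho)^n at r. *)
  intros H Hr. set (rho := (1 + r) / 2).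
  destruct (H rho) as [M HM]; [unfold rho; lra|].
  assert (Hq : 0 <= r / rho < 1).
  { split; [apply Rdiv_le_0_compat; unfold rho; lra|].
    apply Rmult_lt_reg_r with rho; [unfold rho; lra|].
    unfold Rdiv; rewrite Rmult_assoc, Rinv_l; unfold rho; lra. }
  apply (ex_series_le (V := R_CompleteNormedModule) _ (fun n => M * (r / rho) ^ n)).
  - intros n. unfold norm; simpl; unfold abs; simpl.
    rewrite Rabs_pos_eq by (apply Rmult_le_pos; [apply Cmod_ge_0|apply pow_le; lra]).
    rewrite <- (pow_div r rho n) by (unfold rho; lra).
    specialize (HM n).
    replace (Cmod (c n) * ((r / rho) ^ n * rho ^ n)) with (Cmod (c n) * rho ^ n * (r / rho) ^ n) by ring.
    apply Rmult_le_compat_r; [apply pow_le; lra|exact HM].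
  - apply (ex_series_scal (V := R_NormedModule) M (fun n => (r / rho) ^ n)). exists (/ (1 - r / rho)). apply is_series_geom.
    rewrite Rabs_pos_eq; lra.
Qed.

Lemma disk_series_ext (c d : nat -> C) (F G : C -> C) :
  (forall n, c n = d n) -> (forall z, Cmod z < 1 -> F z = G z) ->
  disk_series c F -> disk_series d G.
Proof.
  intros H K L z Hz. rewrite <- (K z Hz).
  apply (Cseries_ext (fun n => Cmult (c n) (Cpow z n))); [|now apply L].
  intros n; now rewrite H.
Qed.

Lemma ex_series_Cmod_pow (c : nat -> C) (z : C) : disk_bounded c -> Cmod z < 1 ->
  ex_series (fun n => Cmod (Cmult (c n) (Cpow z n))).
Proof.
  intros H Hz. eapply ex_series_ext; [|apply (disk_bounded_summable c (Cmod z) H)].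
  - intros n; simpl. now rewrite Cmod_mult, Cmod_pow.
  - split; [apply Cmod_ge_0|trivial].
Qed.

Lemma disk_series_ex (c : nat -> C) : disk_bounded c -> exists F, disk_series c F.
Proof.
  intros H.
  exists (fun z => (Series (fun n => Re (Cmult (c n) (Cpow z n))),
                    Series (fun n => Im (Cmult (c n) (Cpow z n))))).
  intros z Hz. destruct (Cseries_ex _ (ex_series_Cmod_pow c z H Hz)) as [l [Hl1 Hl2]].
  split.
  - change (is_series (fun n => Re (Cmult (c n) (Cpow z n)))
      (Series (fun n => Re (Cmult (c n) (Cpow z n))))).
    rewrite (is_series_unique _ _ Hl1); exact Hl1.
  - change (is_series (fun n => Im (Cmult (c n) (Cpow z n)))
      (Series (fun n => Im (Cmult (c n) (Cpow z n))))).
    rewrite (is_series_unique _ _ Hl2); exact Hl2.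
Qed.

Lemma disk_series_plus (c d : nat -> C) (F G : C -> C) : disk_series c F -> disk_series d G ->
  disk_series (fun n => Cplus (c n) (d n)) (fun z => Cplus (F z) (G z)).
Proof.
  intros H K z Hz.
  eapply Cseries_ext; [|exact (Cseries_plus _ _ _ _ (H z Hz) (K z Hz))].
  intros n; simpl; ring.
Qed.

Lemma disk_series_scal (a : C) (c : nat -> C) (F : C -> C) : disk_series c F ->
  disk_series (fun n => Cmult a (c n)) (fun z => Cmult a (F z)).
Proof.
  intros H z Hz. eapply Cseries_ext; [|exact (Cseries_scal a _ _ (H z Hz))].
  intros n; simpl; ring.
Qed.

Lemma disk_series_minus (c d : nat -> C) (F G : C -> C) : disk_series c F -> disk_series d G ->
  disk_series (fun n => Cminus (c n) (d n)) (fun z => Cminus (F z) (G z)).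
Proof.
  intros H K.
  refine (disk_series_ext _ _ _ _ _ _
    (disk_series_plus _ _ _ _ H (disk_series_scal (RtoC (-1)) _ _ K))); intros; ring.
Qed.

Definition constc (a : C) (n : nat) : C := match n with O => a | _ => RtoC 0 end.

Definition shiftc (c : nat -> C) (n : nat) : C :=
  match n with O => RtoC 0 | S m => c m end.

Lemma is_series_0 : is_series (fun _ : nat => 0) 0.
Proof.
  apply is_series_Rsum. apply (is_lim_seq_ext (fun _ => 0)); [|apply is_lim_seq_const].
  intros n. rewrite Rsum_const; ring.
Qed.

Lemma Cseries_0 : Cseries (fun _ => RtoC 0) (RtoC 0).
Proof. split; exact is_series_0. Qed.

Lemma disk_series_const (a : C) : disk_series (constc a) (fun _ => a).
Proof.
  intros z Hz.
  assert (H := Cseries_decr (fun n => Cmult (constc a n) (Cpow z n)) (RtoC 0)).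
  simpl in H. replace (Cplus (RtoC 0) (Cmult a (RtoC 1))) with a in H by ring.
  apply H. apply (Cseries_ext (fun _ => RtoC 0)); [intros; ring|exact Cseries_0].
Qed.

Lemma disk_series_shift (c : nat -> C) (F : C -> C) : disk_series c F ->
  disk_series (shiftc c) (fun z => Cmult z (F z)).
Proof.
  intros H z Hz.
  assert (K := Cseries_decr (fun n => Cmult (shiftc c n) (Cpow z n)) (Cmult z (F z))).
  simpl in K. replace (Cplus _ _) with (Cmult z (F z)) in K by ring.
  apply K. eapply Cseries_ext; [|exact (Cseries_scal z _ _ (H z Hz))].
  intros n; simpl; ring.
Qed.

Lemma disk_bounded_tail (c : nat -> C) : disk_bounded c -> disk_bounded (fun n => c (S n)).
Proof.
  (* The midpoint is positive even for r = 0, so it can be divided by. *)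
  intros H r Hr. set (rho := (1 + r) / 2).
  destruct (H rho) as [M HM]; [unfold rho; lra|]. exists (M / rho). intros n.
  assert (HR : 0 < rho) by (unfold rho; lra).
  apply Rmult_le_reg_r with rho; trivial.
  replace (M / rho * rho) with M by (field; lra).
  eapply Rle_trans; [|apply (HM (S n))]. simpl.
  rewrite Rmult_assoc, (Rmult_comm rho). apply Rmult_le_compat_l; [apply Cmod_ge_0|].
  apply Rmult_le_compat_r; [lra|]. apply pow_incr. unfold rho; lra.
Qed.

Lemma disk_series_tail (c : nat -> C) (F : C -> C) : disk_series c F ->
  exists G, disk_series (fun n => c (S n)) G /\
    forall z, Cmod z < 1 -> F z = Cplus (c O) (Cmult z (G z)).
Proof.
  intros H. destruct (disk_series_ex _ (disk_bounded_tail _ (disk_series_bounded _ _ H))) as [G HG].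
  exists G; split; trivial. intros z Hz. apply (Cseries_unique _ _ _ (H z Hz)).
  assert (K := Cseries_decr (fun n => Cmult (c n) (Cpow z n)) (Cmult z (G z))).
  simpl in K. replace (Cplus _ _) with (Cplus (c O) (Cmult z (G z))) in K by ring.
  apply K. eapply Cseries_ext; [|exact (Cseries_scal z _ _ (HG z Hz))].
  intros n; simpl; ring.
Qed.

Lemma disk_series_mult (c d : nat -> C) (F G : C -> C) : disk_series c F -> disk_series d G ->
  disk_series (Cconv c d) (fun z => Cmult (F z) (G z)).
Proof.
  intros H K z Hz.
  eapply Cseries_ext; [|apply (Cseries_mult _ _ _ _ (H z Hz) (K z Hz));
    apply ex_series_Cmod_pow; eauto using disk_series_bounded].
  intros n. unfold Cconv. rewrite Cmult_comm, <- Csum_scal. apply Csum_ext. intros k Hk.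
  replace (Cpow z n) with (Cmult (Cpow z k) (Cpow z (n - k))); [ring|].
  rewrite <- Cpow_add_r. f_equal; lia.
Qed.

Lemma disk_series_pow (c : nat -> C) (F : C -> C) (k : nat) : disk_series c F ->
  exists d, disk_series d (fun z => Cpow (F z) k).
Proof.
  intros H. induction k as [|k [d IH]].
  - exists (constc (RtoC 1)). apply disk_series_const.
  - exists (Cconv c d). exact (disk_series_mult _ _ _ _ H IH).
Qed.

Lemma disk_series_dilate (c : nat -> C) (F : C -> C) (a : C) : Cmod a <= 1 -> disk_series c F ->
  disk_series (fun n => Cmult (c n) (Cpow a n)) (fun z => F (Cmult a z)).
Proof.
  intros Ha H z Hz.
  assert (Haz : Cmod (Cmult a z) < 1).
  { rewrite Cmod_mult. pose proof (Cmod_ge_0 z). pose proof (Cmod_ge_0 a). nra. }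
  eapply Cseries_ext; [|exact (H _ Haz)].
  intros n; simpl. rewrite Cpow_mult_l; ring.
Qed.

Lemma disk_series_at_0 (c : nat -> C) (F : C -> C) : disk_series c F -> F (RtoC 0) = c O.
Proof.
  intros H. destruct (disk_series_tail c F H) as [G [_ HG]].
  rewrite HG; [ring|rewrite Cmod_0; lra].
Qed.

(** Dropping the constant term multiplies the coefficients by a, so the sum satisfies F = 1 + a z F,
    which determines it. *)
Lemma disk_series_geom (a : C) : Cmod a <= 1 ->
  disk_series (fun n => Cpow a n) (fun z => Cinv (Cminus (RtoC 1) (Cmult a z))).
Proof.
  intros Ha.
  assert (B : disk_bounded (fun n => Cpow a n)).
  { intros r Hr. exists 1. intros n. rewrite Cmod_pow.
    rewrite <- (Rmult_1_r 1). pose proof (Cmod_ge_0 a).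
    apply Rmult_le_compat; try (apply pow_le; lra);
      (rewrite <- (pow1 n); apply pow_incr; lra). }
  destruct (disk_series_ex _ B) as [F HF].
  destruct (disk_series_tail _ _ HF) as [G [HG E]].
  refine (disk_series_ext _ _ _ _ (fun n => eq_refl) _ HF). intros z Hz.
  assert (EG : G z = Cmult a (F z)).
  { apply (Cseries_unique _ _ _ (HG z Hz)).
    eapply Cseries_ext; [|exact (Cseries_scal a _ _ (HF z Hz))]. intros n; simpl; ring. }
  assert (E1 := E z Hz). rewrite EG in E1. simpl in E1.
  assert (N : Cminus (RtoC 1) (Cmult a z) <> RtoC 0).
  { intros N. assert (Cmult a z = RtoC 1) as N1.
    { replace (Cmult a z) with (Cminus (RtoC 1) (Cminus (RtoC 1) (Cmult a z))) by ring.
      rewrite N; ring. }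
    assert (Cmod (Cmult a z) = 1) as N2 by (rewrite N1; apply Cmod_1).
    rewrite Cmod_mult in N2. pose proof (Cmod_ge_0 z). pose proof (Cmod_ge_0 a). nra. }
  assert (E2 : Cmult (Cminus (RtoC 1) (Cmult a z)) (F z) = RtoC 1).
  { replace (Cmult (Cminus (RtoC 1) (Cmult a z)) (F z)) with
      (Cminus (F z) (Cmult z (Cmult a (F z)))) by ring.
    rewrite E1 at 1. ring. }
  replace (F z) with (Cmult (Cinv (Cminus (RtoC 1) (Cmult a z)))
     (Cmult (Cminus (RtoC 1) (Cmult a z)) (F z))) by (field; trivial).
  rewrite E2; ring.
Qed.

(** Each of the n terms of 1 + q + ... + q^(n-1) is at least q^n. Hence n q^n is bounded for q < 1,
    and the factor n of a derivative does not shrink the disk of convergence. *)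
Lemma n_pow_le (q : R) (n : nat) : 0 <= q <= 1 -> INR n * q ^ n * (1 - q) <= 1 - q ^ n.
Proof.
  intros Hq. induction n as [|n IH]; [simpl; lra|].
  rewrite S_INR. simpl.
  assert (P : 0 <= q ^ n <= 1).
  { split; [apply pow_le; lra|]. rewrite <- (pow1 n). apply pow_incr; lra. }
  assert (q * (INR n * q ^ n * (1 - q)) <= q * (1 - q ^ n)) by (apply Rmult_le_compat_l; lra).
  assert (0 <= (1 - q) * (1 - q * q ^ n)) by (apply Rmult_le_pos; nra).
  nra.
Qed.

Lemma disk_bounded_INR (c : nat -> C) : disk_bounded c ->
  disk_bounded (fun n => Cmult (RtoC (INR n)) (c n)).
Proof.
  intros H r Hr. set (rho := (1 + r) / 2).
  destruct (H rho) as [M HM]; [unfold rho; lra|].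
  assert (HR : 0 < rho) by (unfold rho; lra).
  assert (Hq : 0 <= r / rho < 1).
  { split; [apply Rdiv_le_0_compat; unfold rho; lra|].
    apply Rmult_lt_reg_r with rho; [unfold rho; lra|].
    unfold Rdiv; rewrite Rmult_assoc, Rinv_l; unfold rho; lra. }
  exists (M / (1 - r / rho)). intros n.
  apply Rmult_le_reg_r with (1 - r / rho); [lra|].
  replace (M / (1 - r / rho) * (1 - r / rho)) with M by (field; split; unfold rho; lra).
  rewrite Cmod_mult, Cmod_R, (Rabs_pos_eq (INR n)) by apply pos_INR.
  rewrite <- (pow_div r rho n) by lra.
  replace (INR n * Cmod (c n) * ((r / rho) ^ n * rho ^ n) * (1 - r / rho)) with
    (Cmod (c n) * rho ^ n * (INR n * (r / rho) ^ n * (1 - r / rho))) by ring.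
  assert (P0 : 0 <= Cmod (c n) * rho ^ n)
    by (apply Rmult_le_pos; [apply Cmod_ge_0|apply pow_le; lra]).
  apply Rle_trans with (Cmod (c n) * rho ^ n * 1); [|specialize (HM n); lra].
  apply Rmult_le_compat_l; trivial.
  pose proof (n_pow_le (r / rho) n ltac:(lra)). pose proof (pow_le (r / rho) n ltac:(lra)). lra.
Qed.

Definition derivc (c : nat -> C) (n : nat) : C := Cmult (RtoC (INR (S n))) (c (S n)).

Lemma disk_bounded_derivc (c : nat -> C) : disk_bounded c -> disk_bounded (derivc c).
Proof. intros H. exact (disk_bounded_tail _ (disk_bounded_INR _ H)). Qed.

(** Second-order Taylor remainder of z^(n+1). Both sides carry an extra factor r so that no exponent
    n - 1 occurs. *)
Lemma taylor_pow_bound (z w : C) (r : R) (n : nat) : Cmod z <= r -> Cmod w <= r ->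
  Cmod (Cminus (Cminus (Cpow w (S n)) (Cpow z (S n)))
    (Cmult (Cmult (RtoC (INR (S n))) (Cpow z n)) (Cminus w z))) * r
  <= INR (S n) * INR n * r ^ n * Cmod (Cminus w z) ^ 2.
Proof.
  intros Hz Hw. assert (Hr : 0 <= r) by (pose proof (Cmod_ge_0 z); lra).
  set (t := Cmod (Cminus w z)). assert (Pt : 0 <= t) by apply Cmod_ge_0.
  induction n as [|n IH].
  - simpl. replace (Cminus _ _) with (RtoC 0) by ring. rewrite Cmod_0; lra.
  - set (T := Cminus (Cminus (Cpow w (S n)) (Cpow z (S n)))
      (Cmult (Cmult (RtoC (INR (S n))) (Cpow z n)) (Cminus w z))) in *.
    replace (Cminus _ _) with
      (Cplus (Cmult w T) (Cmult (Cmult (RtoC (INR (S n))) (Cpow z n))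
         (Cmult (Cminus w z) (Cminus w z)))).
    2:{ unfold T. rewrite (S_INR (S n)), (RtoC_plus (INR (S n))). simpl Cpow. ring. }
    apply Rle_trans with ((r * Cmod T + INR (S n) * r ^ n * t ^ 2) * r).
    + apply Rmult_le_compat_r; trivial. eapply Rle_trans; [apply Cmod_triangle|].
      rewrite !Cmod_mult, Cmod_R, Cmod_pow, (Rabs_pos_eq (INR (S n))) by apply pos_INR.
      fold t. apply Rplus_le_compat.
      * apply Rmult_le_compat_r; [apply Cmod_ge_0|trivial].
      * replace (t * t) with (t ^ 2) by ring. apply Rmult_le_compat_r; [apply pow2_ge_0|].
        apply Rmult_le_compat_l; [apply pos_INR|]. apply pow_incr; split; [apply Cmod_ge_0|trivial].
    + assert (A : r * (Cmod T * r) <= r * (INR (S n) * INR n * r ^ n * t ^ 2))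
        by (apply Rmult_le_compat_l; trivial).
      rewrite (S_INR (S n)). rewrite S_INR in *. simpl pow at 1.
      pose proof (pos_INR n) as Pn. set (x := INR n) in *.
      assert (Q : 0 <= r * r ^ n * t ^ 2).
      { apply Rmult_le_pos; [|apply pow2_ge_0].
        apply Rmult_le_pos; [trivial|now apply pow_le]. }
      replace ((r * Cmod T + (x + 1) * r ^ n * t ^ 2) * r) with
        (r * (Cmod T * r) + (x + 1) * (r * r ^ n * t ^ 2)) by ring.
      replace ((x + 1 + 1) * (x + 1) * r ^ S n * t ^ 2) with
        ((x + 1 + 1) * (x + 1) * (r * r ^ n * t ^ 2)) by (simpl; ring).
      replace (r * ((x + 1) * x * r ^ n * t ^ 2)) with ((x + 1) * x * (r * r ^ n * t ^ 2)) in A by ring.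
      nra.
Qed.

(** Summing the Taylor remainders of the powers gives a remainder of at most |w - z|^2 B / r, where
    B is the sum of n (n + 1) |c (n + 1)| r^n. *)
Lemma disk_series_cderiv (c : nat -> C) (F D : C -> C) (z : C) :
  disk_series c F -> disk_series (derivc c) D -> Cmod z < 1 -> cderiv F z (D z).
Proof.
  intros HF HD Hz. set (r := (1 + Cmod z) / 2).
  assert (Hr : 0 < r < 1) by (unfold r; pose proof (Cmod_ge_0 z); lra).
  assert (HB := disk_bounded_summable _ r
    (disk_bounded_INR _ (disk_bounded_derivc _ (disk_series_bounded _ _ HF))) ltac:(lra)).
  destruct HB as [B HB].
  assert (PB : 0 <= B).
  { eapply Rle_trans; [|refine (Rsum_le_series _ B 0 _ HB)]; [simpl; lra|].
    intros k. apply Rmult_le_pos; [apply Cmod_ge_0|apply pow_le; lra]. }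
  intros eps He.
  (* The first bound keeps w within radius r; the second makes t B / r at most eps, with B + 1 for B
     to exclude a zero denominator. *)
  exists (Rmin ((1 - Cmod z) / 2) (eps * r / (B + 1))). split.
  { apply Rmin_pos; [lra|]. apply Rdiv_lt_0_compat; [|lra]. apply Rmult_lt_0_compat; lra. }
  intros w Hw.
  assert (Hw1 := Rlt_le_trans _ _ _ Hw (Rmin_l _ _)).
  assert (Hw2 := Rlt_le_trans _ _ _ Hw (Rmin_r _ _)).
  set (t := Cmod (Cminus w z)) in *. assert (Pt : 0 <= t) by apply Cmod_ge_0.
  assert (Hwr : Cmod w <= r) by (pose proof (Cmod_triangle_sub w z); unfold r, t in *; lra).
  assert (Hzr : Cmod z <= r) by (unfold r in *; lra).
  assert (S1 := Cseries_scal (RtoC (-1)) _ _ (HF z Hz)).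
  assert (S2 := Cseries_plus _ _ _ _ (HF w ltac:(lra)) S1).
  set (X := Cminus (F w) (F z)).
  assert (S3 : Cseries (fun n => Cminus (Cmult (c (S n)) (Cpow w (S n)))
     (Cmult (c (S n)) (Cpow z (S n)))) X).
  { apply (Cseries_incr (fun n => Cminus (Cmult (c n) (Cpow w n)) (Cmult (c n) (Cpow z n)))).
    replace (Cplus X _) with (Cplus (F w) (Cmult (RtoC (-1)) (F z))) by (unfold X; simpl; ring).
    eapply Cseries_ext; [|exact S2]. intros n; cbv beta; ring. }
  assert (S4 := Cseries_plus _ _ _ _ S3 (Cseries_scal (Copp (Cminus w z)) _ _ (HD z Hz))).
  replace (Cplus X (Cmult (Copp (Cminus w z)) (D z))) with
    (Cminus X (Cmult (D z) (Cminus w z))) in S4 by ring.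
  apply Rle_trans with (t ^ 2 / r * B).
  - apply (Cseries_le _ _ _ _ S4 (is_series_scal (t ^ 2 / r) _ _ HB)).
    intros n. unfold scal; simpl; unfold mult; simpl.
    apply Rmult_le_reg_r with r; [lra|].
    unfold derivc.
    replace (Cplus _ _) with (Cmult (c (S n)) (Cminus (Cminus (Cpow w (S n)) (Cpow z (S n)))
      (Cmult (Cmult (RtoC (INR (S n))) (Cpow z n)) (Cminus w z)))) by (simpl; ring).
    rewrite !Cmod_mult, !Cmod_R, !Rabs_pos_eq by apply pos_INR.
    change (match n with O => 1 | S _ => INR n + 1 end) with (INR (S n)).
    pose proof (taylor_pow_bound z w r n Hzr Hwr) as T. fold t in T.
    rewrite Rmult_assoc.
    eapply Rle_trans; [apply Rmult_le_compat_l; [apply Cmod_ge_0|exact T]|].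
    right; field; lra.
  - assert (t * B <= eps * r).
    { apply Rle_trans with (t * (B + 1)); [apply Rmult_le_compat_l; lra|].
      apply Rle_trans with (eps * r / (B + 1) * (B + 1)); [apply Rmult_le_compat_r; lra|].
      right; field; lra. }
    apply Rmult_le_reg_r with r; [lra|].
    replace (t ^ 2 / r * B * r) with (t * (t * B)) by (field; lra).
    replace (eps * t * r) with (t * (eps * r)) by ring. apply Rmult_le_compat_l; trivial.
Qed.

Lemma disk_series_derive (c : nat -> C) (F : C -> C) : disk_series c F ->
  exists D, disk_series (derivc c) D /\ forall z, Cmod z < 1 -> cderiv F z (D z).
Proof.
  intros H. destruct (disk_series_ex _ (disk_bounded_derivc _ (disk_series_bounded _ _ H))) as [D HD].
  exists D; split; trivial. intros z Hz. exact (disk_series_cderiv c F D z H HD Hz).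
Qed.

(* Coefficients of the solution of [E' = F' E], [E 0 = 1], computed with course-of-values
   recursion: [exp_table c n k] is the [k]-th coefficient for every [n >= k]. *)
Fixpoint exp_table (c : nat -> C) (n : nat) : nat -> C :=
  match n with
  | O => fun _ => RtoC 1
  | S m => fun k => if Nat.leb k m then exp_table c m k else
      Cmult (RtoC (/ INR (S m))) (Csum (fun i => Cmult (derivc c i) (exp_table c m (m - i))) (S m))
  end.

Definition expc (c : nat -> C) (n : nat) : C := exp_table c n n.

Lemma exp_table_S (c : nat -> C) (m k : nat) : exp_table c (S m) k =
  if Nat.leb k m then exp_table c m k else
  Cmult (RtoC (/ INR (S m))) (Csum (fun i => Cmult (derivc c i) (exp_table c m (m - i))) (S m)).
Proof. reflexivity. Qed.

Lemma exp_table_stable (c : nat -> C) (n k : nat) : (k <= n)%nat -> exp_table c n k = expc c k.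
Proof.
  induction n as [|n IH]; intros Hk.
  - now replace k with O by lia.
  - destruct (Nat.eq_dec k (S n)) as [->|N]; [reflexivity|].
    rewrite exp_table_S, (proj2 (Nat.leb_le k n)) by lia. apply IH; lia.
Qed.

(** The equation E' = F' E, read coefficientwise. *)
Lemma expc_S (c : nat -> C) (n : nat) :
  derivc (expc c) n = Cconv (derivc c) (expc c) n.
Proof.
  unfold derivc at 1. unfold expc at 1. 
  rewrite exp_table_S, (proj2 (Nat.leb_gt (S n) n)) by lia.
  rewrite Cmult_assoc, <- RtoC_mult.
  replace (INR (S n) * / INR (S n)) with 1 by (field; apply not_0_INR; lia).
  rewrite Cmult_1_l. apply Csum_ext. intros k Hk. f_equal. apply exp_table_stable; lia.
Qed.

Lemma bounded_prefix (a : nat -> R) (N : nat) : exists M, forall n, (n <= N)%nat -> a n <= M.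
Proof.
  induction N as [|N [M H]].
  - exists (a O). intros n Hn. replace n with O by lia. lra.
  - exists (Rmax M (a (S N))). intros n Hn. destruct (Nat.eq_dec n (S N)) as [->|E].
    + apply Rmax_r.
    + eapply Rle_trans; [apply H; lia|apply Rmax_l].
Qed.

(** The recursion bounds (m + 1) |e (m + 1)| r^(m+1) by B r times the maximum of the earlier |e k|
    r^k, where B is the sum of the moduli of the terms of F' at radius r. Once m + 1 exceeds B r
    that maximum cannot grow, so a bound on a finite prefix holds for all terms. *)
Lemma expc_bounded (c : nat -> C) : disk_bounded c -> disk_bounded (expc c).
Proof.
  intros H r Hr.
  destruct (disk_bounded_summable _ r (disk_bounded_derivc _ H) Hr) as [B HB].
  assert (PB : forall n, 0 <= Cmod (derivc c n) * r ^ n).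
  { intros n; apply Rmult_le_pos; [apply Cmod_ge_0|apply pow_le; lra]. }
  assert (P0 : 0 <= B) by exact (Rsum_le_series _ B 0 PB HB).
  destruct (nfloor_ex (B * r)) as [N [_ HN]]; [apply Rmult_le_pos; lra|].
  destruct (bounded_prefix (fun n => Cmod (expc c n) * r ^ n) N) as [M HM].
  exists M.
  assert (K : forall m n, (n <= m)%nat -> Cmod (expc c n) * r ^ n <= M).
  2:{ intros n; now apply (K n). }
  assert (PM : 0 <= M).
  { eapply Rle_trans; [|apply (HM O); lia]. apply Rmult_le_pos; [apply Cmod_ge_0|apply pow_le; lra]. }
  induction m as [|m IH]; intros n Hn; [apply HM; lia|].
  destruct (le_lt_dec n N) as [L|L]; [now apply HM|].
  destruct (Nat.eq_dec n (S m)) as [->|E]; [|apply IH; lia].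
  assert (Hm : 0 < INR (S m)) by (apply lt_0_INR; lia).
  assert (E := f_equal Cmod (expc_S c m)). unfold derivc at 1 in E.
  rewrite Cmod_mult, Cmod_R, Rabs_pos_eq in E by lra.
  apply Rmult_le_reg_l with (INR (S m)); trivial.
  rewrite <- Rmult_assoc, E.
  apply Rle_trans with (B * r * M).
  - unfold Cconv. simpl pow.
    rewrite (Rmult_comm r), <- Rmult_assoc.
    replace (B * r * M) with (M * B * r) by ring.
    apply Rmult_le_compat_r; [lra|].
    apply Rle_trans with (Rsum (fun k => M * (Cmod (derivc c k) * r ^ k)) (S m)).
    + eapply Rle_trans; [apply Rmult_le_compat_r; [apply pow_le; lra|apply Cmod_Csum]|].
      rewrite Rmult_comm, <- Rsum_scal. apply Rsum_le. intros k Hk.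
      rewrite Cmod_mult.
      replace (r ^ m) with (r ^ k * r ^ (m - k)) by (rewrite <- pow_add; f_equal; lia).
      assert (A := IH (m - k)%nat ltac:(lia)).
      replace (r ^ k * r ^ (m - k) * (Cmod (derivc c k) * Cmod (expc c (m - k)))) with
        (Cmod (derivc c k) * r ^ k * (Cmod (expc c (m - k)) * r ^ (m - k))) by ring.
      rewrite (Rmult_comm M). apply Rmult_le_compat_l; [apply PB|exact A].
    + rewrite Rsum_scal. apply Rmult_le_compat_l; trivial. now apply Rsum_le_series.
  - apply Rmult_le_compat_r; trivial. apply Rle_trans with (INR N + 1); [lra|].
    rewrite <- S_INR. apply le_INR; lia.
Qed.

(** Uniqueness for E' = F' E: the product E exp (- F) has derivative zero and is 1 at the origin. *)
Lemma disk_series_exp (c : nat -> C) (F : C -> C) : disk_series c F -> c O = RtoC 0 ->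
  disk_series (expc c) (fun z => Cexp (F z)).
Proof.
  intros H H0.
  destruct (disk_series_ex _ (expc_bounded _ (disk_series_bounded _ _ H))) as [E HE].
  destruct (disk_series_derive _ _ H) as [D [HD HD']].
  destruct (disk_series_derive _ _ HE) as [D2 [HD2 HD2']].
  assert (EQ : forall z, Cmod z < 1 -> D2 z = Cmult (D z) (E z)).
  { intros z Hz. apply (Cseries_unique _ _ _ (HD2 z Hz)).
    eapply Cseries_ext; [|exact (disk_series_mult _ _ _ _ HD HE z Hz)].
    intros n; simpl. now rewrite expc_S. }
  assert (K : forall z, Cmod z < 1 ->
    Cmult (E z) (Cexp (Cmult (RtoC (-1)) (F z))) =
    Cmult (E (RtoC 0)) (Cexp (Cmult (RtoC (-1)) (F (RtoC 0))))).
  { intros z Hz. apply (cderiv_zero_const_disk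
      (fun z => Cmult (E z) (Cexp (Cmult (RtoC (-1)) (F z))))); trivial.
    intros w Hw. eapply cderiv_eq.
    - apply cderiv_mult; [apply HD2'; trivial|].
      apply (cderiv_comp Cexp); [apply cderiv_scal, HD'; trivial|apply cderiv_Cexp].
    - cbv beta. rewrite EQ by trivial. ring. }
  refine (disk_series_ext _ _ _ _ (fun n => eq_refl) _ HE). intros z Hz.
  specialize (K z Hz).
  rewrite (disk_series_at_0 _ _ H), H0, (disk_series_at_0 _ _ HE) in K.
  replace (Cmult (RtoC (-1)) (RtoC 0)) with (RtoC 0) in K by ring.
  rewrite Cexp_0 in K. unfold expc in K; simpl in K.
  replace (E z) with (Cmult (Cmult (E z) (Cexp (Cmult (RtoC (-1)) (F z)))) (Cexp (F z))).
  - rewrite K; ring.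
  - rewrite <- Cmult_assoc, <- Cexp_plus.
    replace (Cplus (Cmult (RtoC (-1)) (F z)) (F z)) with (RtoC 0) by ring.
    rewrite Cexp_0; ring.
Qed.

(** * Parseval's formula *)

Definition cis (t : R) : C := (cos t, sin t).

Lemma cis_plus (a b : R) : cis (a + b) = Cmult (cis a) (cis b).
Proof. unfold cis. rewrite cos_plus, sin_plus. apply C_ext; simpl; ring. Qed.

Lemma cis_0 : cis 0 = RtoC 1.
Proof. unfold cis. now rewrite cos_0, sin_0. Qed.

Lemma cis_pow (a : R) (n : nat) : Cpow (cis a) n = cis (INR n * a).
Proof.
  induction n as [|n IH].
  - simpl. now rewrite Rmult_0_l, cis_0.
  - rewrite S_INR, Cpow_S, IH, <- cis_plus. f_equal; ring.
Qed.

Lemma cis_conj (a : R) : Cconj (cis a) = cis (- a).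
Proof. unfold cis, Cconj. simpl. now rewrite cos_neg, sin_neg. Qed.

Lemma Cmod_cis (a : R) : Cmod (cis a) = 1.
Proof.
  unfold Cmod, cis; simpl. rewrite !Rmult_1_r.
  pose proof (sin2_cos2 a) as H. unfold Rsqr in H.
  replace (_ + _) with 1 by lra. apply sqrt_1.
Qed.

Lemma cis_eq_1 (x : R) : cis (2 * x) = RtoC 1 -> sin x = 0.
Proof.
  intros H. apply (f_equal Re) in H. unfold cis in H. simpl Re in H.
  change (cos (2 * x) = 1) in H. rewrite cos_2a_sin in H.
  assert (sin x * sin x = 0) by lra. now apply Rmult_integral in H0 as [|].
Qed.

Lemma Csum_geom (q : C) (n : nat) :
  Cmult (Cminus q (RtoC 1)) (Csum (fun j => Cpow q j) n) = Cminus (Cpow q n) (RtoC 1).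
Proof. induction n as [|n IH]; simpl; [ring|]. rewrite Cmult_plus_distr_l, IH. ring. Qed.

(** A geometric sum whose ratio q satisfies q^N = 1 but differs from 1. *)
Lemma cis_orthogonality (N n m : nat) : (n < N)%nat -> (m < N)%nat -> n <> m ->
  Csum (fun j => Cpow (cis ((INR n - INR m) * (2 * PI / INR N))) j) N = RtoC 0.
Proof.
  intros Hn Hm H. set (x := (INR n - INR m) * (PI / INR N)).
  assert (PN : 0 < INR N) by (apply lt_0_INR; lia).
  replace ((INR n - INR m) * (2 * PI / INR N)) with (2 * x) by (unfold x; field; lra).
  set (q := cis (2 * x)).
  assert (E1 : Cpow q N = RtoC 1).
  { unfold q. rewrite cis_pow.
    replace (INR N * (2 * x)) with (2 * INR n * PI + - (2 * INR m * PI))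
      by (unfold x; field; lra).
    rewrite cis_plus, <- cis_conj.
    assert (T : forall k, cis (2 * INR k * PI) = RtoC 1).
    { intros k. replace (2 * INR k * PI) with (INR k * (2 * PI)) by ring.
      rewrite <- cis_pow. unfold cis. rewrite cos_2PI, sin_2PI. apply Cpow_1_l. }
    rewrite !T. apply C_ext; simpl; ring. }
  (* q = 1 would give sin x = 0, whereas 0 < |x| < PI because n and m are distinct and below N. *)
  assert (N1 : q <> RtoC 1).
  { intros E. apply cis_eq_1 in E.
    pose proof PI_RGT_0 as PP.
    assert (G : 0 < PI / INR N) by (apply Rdiv_lt_0_compat; lra).
    assert (B : forall a b, (a < N)%nat -> (b < a)%nat ->
      0 < sin ((INR a - INR b) * (PI / INR N))).
    { intros a b Ha Hb. apply lt_INR in Ha. apply lt_INR in Hb. pose proof (pos_INR b).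
      apply sin_gt_0; [apply Rmult_lt_0_compat; lra|].
      apply Rlt_le_trans with (INR N * (PI / INR N)); [|right; field; lra].
      apply Rmult_lt_compat_r; lra. }
    destruct (lt_dec m n) as [L|L].
    - specialize (B n m Hn L). unfold x in E. lra.
    - specialize (B m n Hm ltac:(lia)).
      replace ((INR m - INR n) * (PI / INR N)) with (- x) in B by (unfold x; ring).
      rewrite sin_neg in B; lra. }
  assert (K := Csum_geom q N). rewrite E1 in K.
  replace (Csum _ N) with (Cmult (Cinv (Cminus q (RtoC 1)))
    (Cmult (Cminus q (RtoC 1)) (Csum (fun j => Cpow q j) N))).
  - rewrite K. ring.
  - field. now apply Cminus_eq_contra.
Qed.

Definition circle_point (r : R) (N j : nat) : C :=
  Cmult (RtoC r) (cis (INR j * (2 * PI / INR N))).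

Lemma Cmod_circle_point (r : R) (N j : nat) : 0 <= r -> Cmod (circle_point r N j) = r.
Proof.
  intros Hr. unfold circle_point. rewrite Cmod_mult, Cmod_cis, Cmod_R, Rabs_pos_eq; lra.
Qed.

Definition circle_mean (G : C -> R) (r : R) (N : nat) : R :=
  Rsum (fun j => G (circle_point r N j)) N / INR N.

(** With N sample points the mean is exact for degrees below N: distinct exponents stay distinct
    modulo N, so all mixed products cancel. *)
Lemma parseval_poly (c : nat -> C) (r : R) (N : nat) : (0 < N)%nat ->
  circle_mean (fun z => Cmod (Csum (fun n => Cmult (c n) (Cpow z n)) N) ^ 2) r N =
  Rsum (fun n => Cmod (c n) ^ 2 * (r ^ 2) ^ n) N.
Proof.
  intros HN. assert (PN : 0 < INR N) by (apply lt_0_INR; lia).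
  unfold circle_mean. apply Rmult_eq_reg_r with (INR N); [|lra].
  unfold Rdiv. rewrite Rmult_assoc, Rinv_l, Rmult_1_r by lra.
  apply RtoC_inj. rewrite <- Csum_RtoC, Rmult_comm, <- Rsum_scal, <- Csum_RtoC.
  set (q := fun n m => cis ((INR n - INR m) * (2 * PI / INR N))).
  transitivity (Csum (fun j => Csum (fun n => Csum (fun m =>
    Cmult (Cmult (Cmult (c n) (Cconj (c m))) (RtoC (r ^ (n + m)))) (Cpow (q n m) j)) N) N) N).
  - apply Csum_ext. intros j _. rewrite RtoC_pow, <- RtoC_pow, Cmod2_conj, Csum_conj.
    rewrite Cmult_comm, <- Csum_scal. apply Csum_ext. intros n _.
    rewrite Cmult_comm, <- Csum_scal. apply Csum_ext. intros m _.
    rewrite Cmult_conj. rewrite Cpow_conj. unfold circle_point, q.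
    rewrite Cmult_conj, cis_conj, !Cpow_mult_l, !cis_pow.
    replace (Cconj (RtoC r)) with (RtoC r) by (apply C_ext; simpl; ring).
    rewrite pow_add, RtoC_mult, !RtoC_pow.
    replace (INR j * ((INR n - INR m) * (2 * PI / INR N))) with
      (INR n * (INR j * (2 * PI / INR N)) + INR m * - (INR j * (2 * PI / INR N))) by ring.
    rewrite cis_plus. ring.
  - rewrite Csum_swap. apply Csum_ext. intros n Hn. rewrite Csum_swap.
    rewrite (Csum_delta _ N n Hn).
    + unfold q. replace ((INR n - INR n) * (2 * PI / INR N)) with 0 by ring.
      rewrite cis_0.
      rewrite (Csum_ext _ (fun j => Cmult (Cmult (Cmult (c n) (Cconj (c n)))
        (RtoC (r ^ (n + n)))) (RtoC 1))).
      2:{ intros j _. now rewrite Cpow_1_l. }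
      rewrite Csum_scal, Csum_RtoC, Rsum_const, Rmult_1_r, <- Cmod2_conj.
      rewrite !RtoC_mult. rewrite <- pow_mult.
      replace (n + n)%nat with (2 * n)%nat by lia. rewrite !RtoC_pow. ring.
    + intros m Hm Hmn. rewrite Csum_scal.
      unfold q. rewrite cis_orthogonality by lia. ring.
Qed.

Lemma circle_mean_le (G H : C -> R) (r e : R) (N : nat) : (0 < N)%nat -> 0 <= r ->
  (forall z, Cmod z = r -> G z <= H z + e) -> circle_mean G r N <= circle_mean H r N + e.
Proof.
  intros HN Hr K. assert (PN : 0 < INR N) by (apply lt_0_INR; lia).
  unfold circle_mean. apply Rmult_le_reg_r with (INR N); trivial.
  unfold Rdiv. rewrite Rmult_plus_distr_r, !Rmult_assoc, Rinv_l, !Rmult_1_r by lra.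
  rewrite (Rmult_comm e), <- Rsum_const, <- Rsum_plus. apply Rsum_le.
  intros j _. apply K. now apply Cmod_circle_point.
Qed.

Lemma circle_mean_scal (G : C -> R) (m r : R) (N : nat) :
  circle_mean (fun z => m * G z) r N = m * circle_mean G r N.
Proof. unfold circle_mean. rewrite Rsum_scal. unfold Rdiv; ring. Qed.

Lemma ex_series_sqr (c : nat -> C) (r : R) : disk_bounded c -> 0 <= r < 1 ->
  ex_series (fun n => Cmod (c n) ^ 2 * (r ^ 2) ^ n).
Proof.
  intros H Hr. destruct (H r Hr) as [M HM].
  apply (ex_series_le (V := R_CompleteNormedModule) _ (fun n => M * (Cmod (c n) * r ^ n))).
  - intros n. unfold norm; simpl; unfold abs; simpl.
    set (x := Cmod (c n)) in *.
    assert (P : 0 <= x * r ^ n) by (apply Rmult_le_pos; [apply Cmod_ge_0|apply pow_le; lra]).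
    replace (x * (x * 1) * (r * (r * 1)) ^ n) with ((x * r ^ n) * (x * r ^ n)).
    + rewrite Rabs_pos_eq by nra. specialize (HM n). fold x in HM. nra.
    + replace (r * (r * 1)) with (r * r) by ring. rewrite Rpow_mult_distr. ring.
  - apply (ex_series_scal (V := R_NormedModule) M (fun n => Cmod (c n) * r ^ n)).
    now apply disk_bounded_summable.
Qed.

(** F is compared on the circle with its Taylor polynomial of as many terms as there are sample
    points. Both have modulus at most B there, so the squares differ by at most 2 B times the tail
    of the majorant, uniformly in the point. *)
Lemma parseval (c : nat -> C) (F : C -> C) (r A : R) : disk_series c F -> 0 <= r < 1 ->
  is_series (fun n => Cmod (c n) ^ 2 * (r ^ 2) ^ n) A ->
  is_lim_seq (fun N => circle_mean (fun z => Cmod (F z) ^ 2) r (S N)) A.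
Proof.
  intros HF Hr HA.
  destruct (disk_bounded_summable c r (disk_series_bounded _ _ HF) Hr) as [B HB].
  apply is_series_Rsum in HA. apply is_lim_seq_incr_1 in HA.
  assert (HB' := proj1 (is_series_Rsum _ _) HB). apply is_lim_seq_incr_1 in HB'.
  set (e := fun N => 2 * B * (B - Rsum (fun n => Cmod (c n) * r ^ n) (S N))).
  assert (Le : is_lim_seq e 0).
  { unfold e. replace (Finite 0) with (Rbar_mult (2 * B) (B - B)) by (simpl; f_equal; ring).
    apply is_lim_seq_scal_l. apply is_lim_seq_minus'; [apply is_lim_seq_const|exact HB']. }
  assert (PB : forall n, 0 <= Cmod (c n) * r ^ n)
    by (intros n; apply Rmult_le_pos; [apply Cmod_ge_0|apply pow_le; lra]).
  assert (K : forall N z, Cmod z = r ->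
    Rabs (Cmod (F z) ^ 2 - Cmod (Csum (fun n => Cmult (c n) (Cpow z n)) (S N)) ^ 2) <= e N).
  { intros N z Hz.
    set (P := Csum (fun n => Cmult (c n) (Cpow z n)) (S N)).
    assert (T : forall n, Cmod (Cmult (c n) (Cpow z n)) <= Cmod (c n) * r ^ n).
    { intros n. rewrite Cmod_mult, Cmod_pow, Hz. lra. }
    assert (BF : Cmod (F z) <= B) by (apply (Cseries_le _ _ _ _ (HF z ltac:(lra)) HB T)).
    assert (BP : Cmod P <= B).
    { eapply Rle_trans; [apply Cmod_Csum|].
      eapply Rle_trans; [apply Rsum_le; intros k _; apply T|]. now apply Rsum_le_series. }
    assert (D := Cseries_tail_le _ _ _ _ (S N) (HF z ltac:(lra)) HB T). fold P in D.
    replace (Cmod (F z) ^ 2 - Cmod P ^ 2) with ((Cmod (F z) + Cmod P) * (Cmod (F z) - Cmod P)) by ring.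
    rewrite Rabs_mult. pose proof (Cmod_ge_0 (F z)). pose proof (Cmod_ge_0 P).
    unfold e. apply Rmult_le_compat; try apply Rabs_pos.
    - rewrite Rabs_pos_eq; lra.
    - apply Rabs_le. pose proof (Cmod_triangle_sub (F z) P).
      pose proof (Cmod_triangle_sub P (F z)) as D2. rewrite Cmod_minus_sym in D2. lra. }
  apply (is_lim_seq_le_le (fun N => Rsum (fun n => Cmod (c n) ^ 2 * (r ^ 2) ^ n) (S N) - e N) _
    (fun N => Rsum (fun n => Cmod (c n) ^ 2 * (r ^ 2) ^ n) (S N) + e N)).
  - intros N. rewrite <- (parseval_poly c r (S N)) by lia. split.
    + assert (H := circle_mean_le (fun z => Cmod (Csum (fun n => Cmult (c n) (Cpow z n)) (S N)) ^ 2)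
        (fun z => Cmod (F z) ^ 2) r (e N) (S N) ltac:(lia) ltac:(lra)).
      apply Rle_minus_l. apply H. intros z Hz. specialize (K N z Hz).
      apply Rabs_le_between in K. lra.
    + apply circle_mean_le; [lia|lra|]. intros z Hz. specialize (K N z Hz).
      apply Rabs_le_between in K. lra.
  - replace (Finite A) with (Finite (A - 0)) by (f_equal; ring).
    now apply is_lim_seq_minus'.
  - replace (Finite A) with (Finite (A + 0)) by (f_equal; ring).
    now apply is_lim_seq_plus'.
Qed.

(** The factor [m] and the error [e] cover three uses: multiplication by a bounded function,
    approximation by a polynomial, and, with G = 0, a constant bound. *)
Lemma parseval_le (c d : nat -> C) (F G : C -> C) (r m e A B : R) :
  disk_series c F -> disk_series d G -> 0 <= r < 1 ->
  (forall z, Cmod z = r -> Cmod (F z) ^ 2 <= m * Cmod (G z) ^ 2 + e) ->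
  is_series (fun n => Cmod (c n) ^ 2 * (r ^ 2) ^ n) A ->
  is_series (fun n => Cmod (d n) ^ 2 * (r ^ 2) ^ n) B ->
  A <= m * B + e.
Proof.
  intros HF HG Hr H HA HB.
  assert (LA := parseval _ _ _ _ HF Hr HA). assert (LB := parseval _ _ _ _ HG Hr HB).
  apply (is_lim_seq_le (fun N => circle_mean (fun z => Cmod (F z) ^ 2) r (S N))
    (fun N => m * circle_mean (fun z => Cmod (G z) ^ 2) r (S N) + e) (Finite A) (Finite (m * B + e))).
  - intros N. rewrite <- circle_mean_scal. apply circle_mean_le; [lia|lra|exact H].
  - exact LA.
  - apply is_lim_seq_plus'; [|apply is_lim_seq_const].
    apply (is_lim_seq_scal_l _ m _ LB).
Qed.

(** Comparison with G = 0 bounds the whole sum of |c k|^2 r^(2k) by M^2, hence each of its terms. *)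
Lemma cauchy_estimate (c : nat -> C) (F : C -> C) (r M : R) (n : nat) :
  disk_series c F -> 0 <= r < 1 -> 0 <= M -> (forall z, Cmod z = r -> Cmod (F z) <= M) ->
  Cmod (c n) * r ^ n <= M.
Proof.
  intros HF Hr HM H.
  destruct (ex_series_sqr c r (disk_series_bounded _ _ HF) Hr) as [A HA].
  assert (HB : is_series (fun n => Cmod (constc (RtoC 0) n) ^ 2 * (r ^ 2) ^ n) 0).
  { eapply is_series_ext; [|exact is_series_0]. intros [|k]; simpl; rewrite Cmod_0; ring. }
  assert (K : A <= 1 * 0 + M ^ 2).
  { apply (parseval_le c (constc (RtoC 0)) F (fun _ => RtoC 0) r); trivial.
    - apply disk_series_const.
    - intros z Hz. rewrite Cmod_0. specialize (H z Hz). pose proof (Cmod_ge_0 (F z)).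
      simpl. nra. }
  assert (P : forall k, 0 <= Cmod (c k) ^ 2 * (r ^ 2) ^ k).
  { intros k; apply Rmult_le_pos; [apply pow2_ge_0|apply pow_le, pow2_ge_0]. }
  assert (K2 := Rsum_le_series _ _ (S n) P HA). cbn [Rsum] in K2.
  assert (K3 := Rsum_pos (fun k => Cmod (c k) ^ 2 * (r ^ 2) ^ k) n (fun k _ => P k)).
  cbv beta in K3, K2.
  apply Rsqr_incr_0_var; trivial. rewrite !Rsqr_pow2.
  rewrite Rpow_mult_distr, <- pow_mult, Nat.mul_comm, pow_mult. lra.
Qed.

(** * Logarithms and Rogosinski's theorem *)

Lemma cderiv_unique (F : C -> C) (z l m : C) : cderiv F z l -> cderiv F z m -> l = m.
Proof.
  intros H K. apply cderiv_is_derive, is_C_derive_unique in H.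
  apply cderiv_is_derive, is_C_derive_unique in K. congruence.
Qed.

(** Replaces the choice of a branch of the logarithm: differentiating exp X = 1 gives X' = 0. *)
Lemma Cexp_eq_1_disk (X D : C -> C) :
  (forall z, Cmod z < 1 -> cderiv X z (D z)) ->
  (forall z, Cmod z < 1 -> Cexp (X z) = RtoC 1) -> X (RtoC 0) = RtoC 0 ->
  forall z, Cmod z < 1 -> X z = RtoC 0.
Proof.
  intros HD HX H0 z Hz. rewrite <- H0.
  apply cderiv_zero_const_disk; trivial. intros w Hw.
  apply (cderiv_eq _ _ (D w)); [now apply HD|].
  assert (A : cderiv (fun z => Cexp (X z)) w (Cmult (Cexp (X w)) (D w))).
  { apply cderiv_comp; [now apply HD|apply cderiv_Cexp]. }
  assert (B : cderiv (fun z => Cexp (X z)) w (RtoC 0)).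
  { apply (cderiv_ext_disk (fun _ => RtoC 1)); trivial.
    - intros y Hy. now rewrite HX.
    - apply cderiv_const. }
  rewrite <- (cderiv_unique _ _ _ _ A B), HX by trivial. ring.
Qed.

Lemma one_minus_neq_0 (a z : C) : Cmod a <= 1 -> Cmod z < 1 ->
  Cminus (RtoC 1) (Cmult a z) <> RtoC 0.
Proof.
  intros Ha Hz N.
  assert (Cmod (Cmult a z) = 1) as N2.
  { rewrite <- Cmod_1. f_equal.
    replace (Cmult a z) with (Cminus (RtoC 1) (Cminus (RtoC 1) (Cmult a z))) by ring.
    rewrite N; ring. }
  rewrite Cmod_mult in N2. pose proof (Cmod_ge_0 z). pose proof (Cmod_ge_0 a). nra.
Qed.

(* Taylor coefficients of [- log (1 - a z)]. *)
Definition neglogc (a : C) (n : nat) : C :=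
  match n with O => RtoC 0 | S _ => Cmult (Cpow a n) (RtoC (/ INR n)) end.

Lemma Rinv_INR_le_1 (n : nat) : 0 < / INR (S n) <= 1.
Proof.
  assert (H : 1 <= INR (S n)) by (rewrite S_INR; pose proof (pos_INR n); lra).
  split; [apply Rinv_0_lt_compat; lra|]. rewrite <- Rinv_1. apply Rinv_le_contravar; lra.
Qed.

Lemma Cmod_neglogc_le (a : C) (n : nat) : Cmod a <= 1 -> Cmod (neglogc a n) <= 1.
Proof.
  intros Ha. destruct n as [|n]; [simpl; rewrite Cmod_0; lra|].
  unfold neglogc. pose proof (Rinv_INR_le_1 n). pose proof (Cmod_ge_0 a).
  rewrite Cmod_mult, Cmod_pow, Cmod_R, Rabs_pos_eq, <- (Rmult_1_r 1) by lra.
  apply Rmult_le_compat; try lra; [now apply pow_le|].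
  rewrite <- (pow1 (S n)). apply pow_incr; lra.
Qed.

Lemma disk_bounded_le_1 (c : nat -> C) : (forall n, Cmod (c n) <= 1) -> disk_bounded c.
Proof.
  intros H r Hr. exists 1. intros n. rewrite <- (Rmult_1_r 1).
  apply Rmult_le_compat; auto; [apply Cmod_ge_0|apply pow_le; lra|].
  rewrite <- (pow1 n). apply pow_incr; lra.
Qed.

(** The series is the branch of - log (1 - a z) that vanishes at 0, since (1 - a z) exp F has
    derivative zero and value 1 at 0. *)
Lemma neglog_ex (a : C) : Cmod a <= 1 -> exists F, disk_series (neglogc a) F /\
  forall z, Cmod z < 1 -> cderiv F z (Cmult a (Cinv (Cminus (RtoC 1) (Cmult a z)))) /\
    Cexp (F z) = Cinv (Cminus (RtoC 1) (Cmult a z)).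
Proof.
  intros Ha.
  destruct (disk_series_ex (neglogc a)) as [F HF].
  { apply disk_bounded_le_1. intros n. now apply Cmod_neglogc_le. }
  assert (HD : disk_series (derivc (neglogc a))
    (fun z => Cmult a (Cinv (Cminus (RtoC 1) (Cmult a z))))).
  { eapply disk_series_ext; [| |exact (disk_series_scal a _ _ (disk_series_geom a Ha))];
      [|reflexivity].
    intros n. unfold derivc, neglogc. rewrite Cpow_S.
    replace (Cmult (RtoC (INR (S n))) _) with
      (Cmult (Cmult a (Cpow a n)) (Cmult (RtoC (INR (S n))) (RtoC (/ INR (S n))))) by ring.
    rewrite <- RtoC_mult, Rinv_r by (apply not_0_INR; lia). ring. }
  assert (HD' := fun z => disk_series_cderiv _ _ _ z HF HD).
  exists F. split; trivial. intros z Hz. split; [now apply HD'|].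
  assert (K : forall z, Cmod z < 1 ->
    Cmult (Cplus (RtoC 1) (Cmult (Copp a) z)) (Cexp (F z)) = RtoC 1).
  { intros y Hy.
    rewrite (cderiv_zero_const_disk
      (fun z => Cmult (Cplus (RtoC 1) (Cmult (Copp a) z)) (Cexp (F z)))); trivial.
    - rewrite (disk_series_at_0 _ _ HF). simpl neglogc. rewrite Cexp_0. ring.
    - intros w Hw. eapply cderiv_eq.
      + apply cderiv_mult.
        * apply cderiv_plus; [apply cderiv_const|apply cderiv_scal, cderiv_id].
        * apply cderiv_comp; [now apply HD'|apply cderiv_Cexp].
      + cbv beta. pose proof (one_minus_neq_0 a w Ha Hw). field. trivial. }
  specialize (K z Hz). pose proof (one_minus_neq_0 a z Ha Hz) as N.
  transitivity (Cmult (Cinv (Cminus (RtoC 1) (Cmult a z)))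
    (Cmult (Cplus (RtoC 1) (Cmult (Copp a) z)) (Cexp (F z)))); [field; trivial|].
  rewrite K; ring.
Qed.

(** Induction along Horner's scheme P(u) = b 0 + u Q(u). As u vanishes at 0, u Q(u) has no constant
    term, so the square sums of b 0 and of u Q(u) add up; the bound |u| <= k on the circle turns the
    factor u into k^2. *)
Lemma rogosinski_poly (c : nat -> C) (u : C -> C) (k : R) : disk_series c u -> 0 <= k ->
  (forall z, Cmod z < 1 -> Cmod (u z) <= k * Cmod z) ->
  forall (N : nat) (b : nat -> C),
  exists d, disk_series d (fun z => Csum (fun n => Cmult (b n) (Cpow (u z) n)) N) /\
    forall r A, 0 <= r < 1 -> is_series (fun n => Cmod (d n) ^ 2 * (r ^ 2) ^ n) A ->
      A <= Rsum (fun n => Cmod (b n) ^ 2 * (k ^ 2) ^ n) N.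
Proof.
  intros Hu Hk Hb N. induction N as [|N IH]; intros b.
  - exists (constc (RtoC 0)). split; [exact (disk_series_const (RtoC 0))|].
    intros r A Hr HA. right. simpl.
    rewrite <- (is_series_unique _ _ HA). apply is_series_unique.
    eapply is_series_ext; [|exact is_series_0]. intros [|n]; simpl; rewrite Cmod_0; ring.
  - destruct (IH (fun n => b (S n))) as [d [Hd HA]].
    set (e := Cconv c d).
    assert (He := disk_series_mult _ _ _ _ Hu Hd). fold e in He.
    assert (U0 : u (RtoC 0) = RtoC 0).
    { apply Cmod_eq_0. apply Rle_antisym; [|apply Cmod_ge_0].
      eapply Rle_trans; [apply Hb|]; rewrite Cmod_0; lra. }
    assert (E0 : e O = RtoC 0).
    { rewrite <- (disk_series_at_0 _ _ He), U0. ring. }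
    exists (fun n => Cplus (constc (b O) n) (e n)). split.
    { eapply disk_series_ext; [| |exact (disk_series_plus _ _ _ _ (disk_series_const (b O)) He)];
        [reflexivity|].
      intros z Hz. cbv beta. rewrite Csum_shift, <- Csum_scal. simpl Cpow at 1.
      f_equal; [ring|]. apply Csum_ext. intros n _. simpl. ring. }
    intros r A Hr HS.
    destruct (ex_series_sqr d r (disk_series_bounded _ _ Hd) Hr) as [B HB].
    destruct (ex_series_sqr e r (disk_series_bounded _ _ He) Hr) as [E HE].
    assert (EB : E <= k ^ 2 * B + 0).
    { apply (parseval_le e d _ _ r (k ^ 2) 0 E B He Hd Hr); trivial. intros z Hz.
      rewrite Cmod_mult, Rpow_mult_distr, Rplus_0_r.
      apply Rmult_le_compat_r; [apply pow2_ge_0|]. apply pow_incr.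
      split; [apply Cmod_ge_0|]. eapply Rle_trans; [apply Hb; lra|]. rewrite Hz. nra. }
    assert (AE : A <= Cmod (b O) ^ 2 + E).
    { apply (series_le_bound _ _ _ HS). intros [|M].
      - cbn [Rsum]. pose proof (pow2_ge_0 (Cmod (b O))).
        assert (P := Rsum_le_series _ _ O (fun n => Rmult_le_pos _ _ (pow2_ge_0 (Cmod (e n)))
          (pow_le _ n (pow2_ge_0 r))) HE). cbn [Rsum] in P. lra.
      - rewrite Rsum_shift. cbn [constc]. rewrite E0.
        replace (Cplus (b O) (RtoC 0)) with (b O) by ring.
        rewrite pow_O, Rmult_1_r. apply Rplus_le_compat_l.
        assert (P := Rsum_le_series _ _ (S M) (fun n => Rmult_le_pos _ _ (pow2_ge_0 (Cmod (e n)))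
          (pow_le _ n (pow2_ge_0 r))) HE).
        rewrite Rsum_shift, E0, Cmod_0 in P.
        eapply Rle_trans; [|exact P]. right.
        rewrite <- (Rplus_0_l (Rsum _ M)). f_equal; [ring|].
        apply Rsum_ext. intros n _. cbn [constc]. now rewrite Cplus_0_l. }
    specialize (HA r B Hr HB).
    rewrite Rsum_shift, pow_O, Rmult_1_r.
    rewrite (Rsum_ext _ (fun n => k ^ 2 * (Cmod (b (S n)) ^ 2 * (k ^ 2) ^ n))).
    + rewrite Rsum_scal. pose proof (Rmult_le_compat_l (k ^ 2) _ _ (pow2_ge_0 k) HA). lra.
    + intros n _. cbn [pow]. ring.
Qed.

Lemma bernoulli_le (r : R) (n : nat) : 0 <= r <= 1 -> 1 - INR n * (1 - r) <= r ^ n.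
Proof.
  intros Hr. induction n as [|n IH]; [simpl; lra|]. rewrite S_INR. simpl.
  pose proof (pos_INR n).
  assert (r * (1 - INR n * (1 - r)) <= r * r ^ n) by (apply Rmult_le_compat_l; lra).
  assert (0 <= INR n * ((1 - r) * (1 - r))) by (apply Rmult_le_pos; [lra|nra]). nra.
Qed.

(** Lets bounds be proved for dilated functions. Over finitely many terms r^n >= 1 - N (1 - r),
    which tends to 1 along r = 1 - 1 / (j + 2), so no limits are interchanged. *)
Lemma Rsum_le_of_dilates (a : nat -> R) (N : nat) (B : R) : (forall n, 0 <= a n) ->
  (forall r, 0 < r < 1 -> Rsum (fun n => a n * r ^ n) N <= B) -> Rsum a N <= B.
Proof.
  intros Ha H. set (X := Rsum a N).
  assert (PX : 0 <= X) by (apply Rsum_pos; auto).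
  assert (K : forall r, 0 < r < 1 -> X * (1 - INR N * (1 - r)) <= B).
  { intros r Hr. eapply Rle_trans; [|apply (H r Hr)].
    rewrite Rmult_comm. unfold X. rewrite <- Rsum_scal. apply Rsum_le. intros n Hn.
    rewrite Rmult_comm. apply Rmult_le_compat_l; auto.
    eapply Rle_trans; [|apply bernoulli_le; lra].
    assert (INR n <= INR N) by (apply le_INR; lia). nra. }
  assert (L : is_lim_seq (fun j => X * (1 - INR N * (/ INR (S (S j))))) (X * (1 - INR N * 0))).
  { apply is_lim_seq_mult'; [apply is_lim_seq_const|].
    apply is_lim_seq_minus'; [apply is_lim_seq_const|].
    apply is_lim_seq_mult'; [apply is_lim_seq_const|].
    apply (is_lim_seq_incr_1 (fun j => / INR (S j))). apply (is_lim_seq_incr_1 (fun j => / INR j)).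
    apply (is_lim_seq_inv _ p_infty); [apply is_lim_seq_INR|discriminate]. }
  replace X with (X * (1 - INR N * 0)) by ring.
  refine (is_lim_seq_le _ (fun _ => B) (Finite _) (Finite B) _ L (is_lim_seq_const B)). intros j.
  assert (Q : 0 < / INR (S (S j)) < 1).
  { assert (1 < INR (S (S j))) by (rewrite !S_INR; pose proof (pos_INR j); lra).
    split; [apply Rinv_0_lt_compat; lra|]. rewrite <- Rinv_1. apply Rinv_lt_contravar; lra. }
  specialize (K (1 - / INR (S (S j))) ltac:(lra)).
  replace (1 - (1 - / INR (S (S j)))) with (/ INR (S (S j))) in K by ring. exact K.
Qed.

(** V is approximated by polynomials in u. On |z| = r the terms are dominated by |b n| r^n, so the
    error is uniform and vanishes as the number of terms grows. *)
Lemma rogosinski (c v b : nat -> C) (u V : C -> C) (k B : R) :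
  disk_series c u -> 0 <= k <= 1 -> (forall z, Cmod z < 1 -> Cmod (u z) <= k * Cmod z) ->
  (forall n, Cmod (b n) <= 1) -> disk_series v V ->
  (forall z, Cmod z < 1 -> Cseries (fun n => Cmult (b n) (Cpow (u z) n)) (V z)) ->
  is_series (fun n => Cmod (b n) ^ 2 * (k ^ 2) ^ n) B ->
  forall N, Rsum (fun n => Cmod (v n) ^ 2) N <= B.
Proof.
  intros Hu Hk Huk Hb Hv HV HB N.
  apply Rsum_le_of_dilates; [intros n; apply pow2_ge_0|]. intros r2 Hr2.
  set (r := sqrt r2). assert (Er : r2 = r ^ 2) by (unfold r; rewrite pow2_sqrt; lra).
  assert (Hr : 0 <= r < 1).
  { split; [apply sqrt_pos|]. rewrite <- sqrt_1. apply sqrt_lt_1; lra. }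
  rewrite Er.
  destruct (ex_series_sqr v r (disk_series_bounded _ _ Hv) Hr) as [A HA].
  assert (PA : forall n, 0 <= Cmod (v n) ^ 2 * (r ^ 2) ^ n)
    by (intros n; apply Rmult_le_pos; [apply pow2_ge_0|apply pow_le, pow2_ge_0]).
  eapply Rle_trans; [apply (Rsum_le_series _ _ N PA HA)|]. clear N.
  destruct (disk_bounded_summable b r (disk_bounded_le_1 b Hb) Hr) as [X HX].
  set (t := fun K => X - Rsum (fun n => Cmod (b n) * r ^ n) K).
  assert (K : forall K, A <= B + 2 * X * t K).
  { intros K. destruct (rogosinski_poly c u k Hu (proj1 Hk) Huk K b) as [d [Hd HdA]].
    destruct (ex_series_sqr d r (disk_series_bounded _ _ Hd) Hr) as [E HE].
    apply Rle_trans with (1 * E + 2 * X * t K).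
    2:{ specialize (HdA r E Hr HE).
        assert (PB : forall n, 0 <= Cmod (b n) ^ 2 * (k ^ 2) ^ n)
          by (intros n; apply Rmult_le_pos; [apply pow2_ge_0|apply pow_le, pow2_ge_0]).
        pose proof (Rsum_le_series _ _ K PB HB). lra. }
    apply (parseval_le v d V _ r 1 (2 * X * t K) A E Hv Hd Hr); trivial.
    intros z Hz. cbv beta. set (Q := Csum _ K).
    assert (T : forall n, Cmod (Cmult (b n) (Cpow (u z) n)) <= Cmod (b n) * r ^ n).
    { intros n. rewrite Cmod_mult, Cmod_pow. apply Rmult_le_compat_l; [apply Cmod_ge_0|].
      apply pow_incr. split; [apply Cmod_ge_0|].
      eapply Rle_trans; [apply Huk; lra|]. rewrite Hz. nra. }
    assert (BV : Cmod (V z) <= X) by (apply (Cseries_le _ _ _ _ (HV z ltac:(lra)) HX T)).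
    assert (BQ : Cmod Q <= X).
    { eapply Rle_trans; [apply Cmod_Csum|].
      eapply Rle_trans; [apply Rsum_le; intros n _; apply T|].
      apply Rsum_le_series; [|exact HX].
      intros n. apply Rmult_le_pos; [apply Cmod_ge_0|apply pow_le; lra]. }
    assert (D := Cseries_tail_le _ _ _ _ K (HV z ltac:(lra)) HX T).
    fold Q in D. fold (t K) in D.
    pose proof (Cmod_triangle_sub (V z) Q).
    pose proof (Cmod_ge_0 (V z)). pose proof (Cmod_ge_0 Q).
    assert (Cmod (V z) ^ 2 - Cmod Q ^ 2 <= 2 * X * t K); [|lra].
    replace (Cmod (V z) ^ 2 - Cmod Q ^ 2) with
      ((Cmod (V z) + Cmod Q) * (Cmod (V z) - Cmod Q)) by ring.
    pose proof (Cmod_ge_0 (Cminus (V z) Q)).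
    apply Rle_trans with ((Cmod (V z) + Cmod Q) * t K);
      [apply Rmult_le_compat_l|apply Rmult_le_compat_r]; lra. }
  assert (L : is_lim_seq (fun K => B + 2 * X * t K) (B + 2 * X * (X - X))).
  { apply is_lim_seq_plus'; [apply is_lim_seq_const|].
    apply is_lim_seq_mult'; [apply is_lim_seq_const|].
    apply is_lim_seq_minus'; [apply is_lim_seq_const|now apply is_series_Rsum]. }
  replace B with (B + 2 * X * (X - X)) by ring.
  exact (is_lim_seq_le (fun _ => A) _ (Finite _) (Finite _) K (is_lim_seq_const A) L).
Qed.

(** Inverts z d/dz: if V vanishes at 0, these are the coefficients of the integral of V(z) / z from
    0. *)
Definition divc (c : nat -> C) (n : nat) : C :=
  match n with O => RtoC 0 | S _ => Cmult (RtoC (/ INR n)) (c n) end.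

Lemma disk_bounded_divc (c : nat -> C) : disk_bounded c -> disk_bounded (divc c).
Proof.
  intros H r Hr. destruct (H r Hr) as [M HM]. exists M. intros [|n].
  - simpl. rewrite Cmod_0. specialize (HM O). simpl in HM. pose proof (Cmod_ge_0 (c O)). lra.
  - unfold divc. pose proof (Rinv_INR_le_1 n).
    rewrite Cmod_mult, Cmod_R, Rabs_pos_eq by lra.
    specialize (HM (S n)).
    assert (0 <= Cmod (c (S n)) * r ^ S n)
      by (apply Rmult_le_pos; [apply Cmod_ge_0|apply pow_le; lra]).
    rewrite Rmult_assoc. nra.
Qed.

Lemma derivc_divc (c : nat -> C) (n : nat) : derivc (divc c) n = c (S n).
Proof.
  unfold derivc, divc. rewrite Cmult_assoc, <- RtoC_mult, Rinv_r by (apply not_0_INR; lia). ring.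
Qed.

(* Integrating the pointwise majorant of [V] along the ray from [0] to [zeta]: the function
   [W] below satisfies [z W'(z) = V(z)]. *)
Lemma ray_integral_le (v : nat -> C) (V W G : C -> C) (k : R) (zeta : C) :
  disk_series v V -> v O = RtoC 0 -> 0 <= k <= 1 -> Cmod zeta <= 1 ->
  (forall z t b, Cmod z <= t -> t < 1 ->
     is_series (fun n => Cmod (neglogc (RtoC k) n) * t ^ n) b -> Cmod (V z) <= b) ->
  disk_series (divc v) W -> disk_series (divc (neglogc (RtoC k))) G ->
  forall r, 0 < r < 1 -> Re (W (Cmult (RtoC r) zeta)) <= Re (G (RtoC r)).
Proof.
  intros Hv V0 Hk Hz HV HW HG r Hr.
  assert (Bk : Cmod (RtoC k) <= 1) by (rewrite Cmod_R, Rabs_pos_eq; lra).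
  destruct (disk_series_derive _ _ HW) as [DW [HDW HDW']].
  destruct (disk_series_derive _ _ HG) as [DG [HDG HDG']].
  assert (EW : forall z, Cmod z < 1 -> Cmult z (DW z) = V z).
  { intros z Hz1. assert (S1 := disk_series_shift _ _ HDW z Hz1).
    apply (Cseries_unique _ _ _ S1). eapply Cseries_ext; [|exact (Hv z Hz1)].
    intros [|n]; [simpl; rewrite V0; ring|]. cbn [shiftc]. now rewrite derivc_divc. }
  (* For real t the terms of t G'(t) are nonnegative and coincide with those of the majorant, whose
     sum is - log (1 - k t). *)
  assert (EG : forall t, 0 < t < 1 -> is_series
     (fun n => Cmod (neglogc (RtoC k) n) * t ^ n) (t * Re (DG (RtoC t)))).
  { intros t Ht.
    assert (Bt : Cmod (RtoC t) < 1) by (rewrite Cmod_R, Rabs_pos_eq; lra).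
    destruct (disk_series_shift _ _ HDG (RtoC t) Bt) as [S1 _].
    rewrite re_scal_l in S1. eapply is_series_ext; [|exact S1]. intros [|n].
    - simpl. rewrite Cmod_0. ring.
    - cbn [shiftc]. rewrite derivc_divc. unfold neglogc. rewrite <- !RtoC_pow, <- !RtoC_mult, re_RtoC.
      rewrite Cmod_R, Rabs_pos_eq; trivial. pose proof (Rinv_INR_le_1 n).
      apply Rmult_le_pos; [apply pow_le; lra|lra]. }
  assert (P : forall t, 0 < t < 1 -> Re (Cmult (DW (Cmult (RtoC t) zeta)) zeta) <= Re (DG (RtoC t))).
  { intros t Ht. set (z := Cmult (RtoC t) zeta).
    assert (Mz : Cmod z = t * Cmod zeta) by (unfold z; rewrite Cmod_mult, Cmod_R, Rabs_pos_eq; lra).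
    pose proof (Cmod_ge_0 zeta) as Pz.
    assert (Hz1 : Cmod z < 1) by nra.
    eapply Rle_trans; [apply Rle_abs|]. eapply Rle_trans; [apply re_le_Cmod|].
    apply Rmult_le_reg_l with t; [lra|].
    replace (t * Cmod (Cmult (DW z) zeta)) with (Cmod (V z)).
    2:{ rewrite <- EW by trivial. rewrite !Cmod_mult, Mz. ring. }
    apply (HV z t); [nra|lra|now apply EG]. }
  (* Mean value theorem for Re W(t zeta) - Re G(t), which vanishes at 0 and has derivative at most 0
     in the interior; the factors 1 and summands 0 fit the shape of [cderiv_line]. *)
  destruct (MVT_cor2 (fun t => Re (Cmult (RtoC 1) (W (Cplus (RtoC 0) (Cmult (RtoC t) zeta))))
      - Re (Cmult (RtoC 1) (G (Cplus (RtoC 0) (Cmult (RtoC t) (RtoC 1))))))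
    (fun t => Re (Cmult (RtoC 1) (Cmult (DW (Cmult (RtoC t) zeta)) zeta))
      - Re (Cmult (RtoC 1) (Cmult (DG (RtoC t)) (RtoC 1)))) 0 r) as [t [Ht1 Ht2]]; [lra| |].
  { intros t Ht.
    apply (derivable_pt_lim_minus
      (fun t => Re (Cmult (RtoC 1) (W (Cplus (RtoC 0) (Cmult (RtoC t) zeta)))))
      (fun t => Re (Cmult (RtoC 1) (G (Cplus (RtoC 0) (Cmult (RtoC t) (RtoC 1))))))).
    - apply cderiv_line. rewrite Cplus_0_l. apply HDW'.
      rewrite Cmod_mult, Cmod_R, Rabs_pos_eq by lra. pose proof (Cmod_ge_0 zeta). nra.
    - apply cderiv_line. rewrite Cplus_0_l, Cmult_1_r. apply HDG'.
      rewrite Cmod_R, Rabs_pos_eq; lra. }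
  rewrite !Cplus_0_l, !Cmult_1_l, !Cmult_1_r, Cmult_0_l in Ht1.
  rewrite (disk_series_at_0 _ _ HW), (disk_series_at_0 _ _ HG) in Ht1. cbn [divc] in Ht1.
  specialize (P t ltac:(lra)).
  assert ((Re (Cmult (DW (Cmult (RtoC t) zeta)) zeta) - Re (DG (RtoC t))) * (r - 0) <= 0) by nra.
  lra.
Qed.

(** * Schwarz lemma and the fixed point argument *)

Lemma le_of_pow_le (a M B : R) : 0 <= a -> 0 <= M ->
  (forall k, a ^ k <= M ^ k * B) -> a <= M.
Proof.
  intros Ha HM H. destruct (Rle_lt_dec a M) as [|L]; trivial. exfalso.
  assert (Q : 0 <= M / a < 1).
  { split; [apply Rdiv_le_0_compat; lra|].
    apply Rmult_lt_reg_r with a; [lra|]. unfold Rdiv; rewrite Rmult_assoc, Rinv_l; lra. }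
  assert (LL : is_lim_seq (fun k => (M / a) ^ k * B) (0 * B)).
  { apply is_lim_seq_mult'; [|apply is_lim_seq_const]. apply is_lim_seq_geom.
    rewrite Rabs_pos_eq; lra. }
  assert (K : 1 <= 0 * B); [|lra].
  refine (is_lim_seq_le (fun _ => 1) _ (Finite 1) (Finite _) _ (is_lim_seq_const 1) LL).
  intros k. assert (Pa : 0 < a ^ k) by (apply pow_lt; lra).
  apply Rmult_le_reg_r with (a ^ k); trivial.
  replace ((M / a) ^ k * B * a ^ k) with ((M / a) ^ k * a ^ k * B) by ring.
  rewrite pow_div by lra. specialize (H k). lra.
Qed.

(* Cauchy's estimate for [F ^ k] bounds [|F z| ^ k] by [M ^ k] times a constant independent of [k]. *)
Lemma maximum_modulus (c : nat -> C) (F : C -> C) (r M : R) :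
  disk_series c F -> 0 < r < 1 -> 0 <= M -> (forall z, Cmod z = r -> Cmod (F z) <= M) ->
  forall z, Cmod z < r -> Cmod (F z) <= M.
Proof.
  intros HF Hr HM H z Hz. pose proof (Cmod_ge_0 z) as Pz.
  assert (Q : 0 <= Cmod z / r < 1).
  { split; [apply Rdiv_le_0_compat; lra|].
    apply Rmult_lt_reg_r with r; [lra|]. unfold Rdiv; rewrite Rmult_assoc, Rinv_l; lra. }
  apply le_of_pow_le with (/ (1 - Cmod z / r)); trivial; [apply Cmod_ge_0|]. intros k.
  destruct (disk_series_pow c F k HF) as [d Hd].
  assert (CE : forall n, Cmod (d n) * r ^ n <= M ^ k).
  { intros n. apply (cauchy_estimate d _ r (M ^ k) n Hd); [lra|now apply pow_le|].
    intros w Hw. rewrite Cmod_pow. apply pow_incr. split; [apply Cmod_ge_0|auto]. }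
  rewrite <- Cmod_pow.
  assert (G : is_series (fun n => M ^ k * (Cmod z / r) ^ n) (M ^ k * / (1 - Cmod z / r))).
  { apply (is_series_scal (V := R_NormedModule) (M ^ k) (fun n => (Cmod z / r) ^ n)).
    apply is_series_geom. rewrite Rabs_pos_eq; lra. }
  apply (Cseries_le _ _ _ _ (Hd z ltac:(lra)) G). intros n.
  rewrite Cmod_mult, Cmod_pow. rewrite <- (pow_div (Cmod z) r n) by lra.
  replace (Cmod (d n) * ((Cmod z / r) ^ n * r ^ n)) with
    (Cmod (d n) * r ^ n * (Cmod z / r) ^ n) by ring.
  apply Rmult_le_compat_r; [apply pow_le; lra|apply CE].
Qed.

(** The maximum principle on |z| = r gives |F| <= M / r^2 inside. Instead of a limit r -> 1, one r
    is found that contradicts |F z| > M. *)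
Lemma schwarz_order_2 (c : nat -> C) (F : C -> C) (M : R) : disk_series c F -> 0 <= M ->
  (forall z, Cmod z < 1 -> Cmod (Cmult (Cmult z z) (F z)) <= M) ->
  forall z, Cmod z < 1 -> Cmod (F z) <= M.
Proof.
  intros HF HM H z Hz. set (X := Cmod (F z)).
  destruct (Rle_lt_dec X M) as [|L]; trivial. exfalso.
  assert (HX : 0 <= M / X < 1).
  { split; [apply Rdiv_le_0_compat; lra|].
    apply Rmult_lt_reg_r with X; [lra|]. unfold Rdiv; rewrite Rmult_assoc, Rinv_l; lra. }
  (* With r^2 strictly above both |z| and M / X, the point z lies inside the circle and X r^2 >
     M. *)
  set (m := Rmax (Cmod z) (M / X)).
  assert (Hm : m < 1) by (apply Rmax_lub_lt; lra).
  assert (H1 : Cmod z <= m) by apply Rmax_l. assert (H2 : M / X <= m) by apply Rmax_r.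
  set (r2 := (1 + m) / 2). set (r := sqrt r2).
  pose proof (Cmod_ge_0 z).
  assert (R2 : 0 < r2 < 1) by (unfold r2; lra).
  assert (E2 : r * r = r2) by (apply sqrt_sqrt; lra).
  assert (Pr : 0 < r) by (apply sqrt_lt_R0; lra).
  assert (Hr : r < 1) by nra.
  assert (Lr : r2 < r) by nra.
  assert (K : X <= M / r2).
  { apply (maximum_modulus c F r (M / r2) HF); [lra|apply Rdiv_le_0_compat; lra| |unfold r2 in *; lra].
    intros w Hw. specialize (H w ltac:(lra)). rewrite !Cmod_mult, Hw, E2 in H.
    apply Rmult_le_reg_l with r2; [lra|].
    replace (r2 * (M / r2)) with M by (field; lra). exact H. }
  assert (K2 : X * r2 <= M).
  { apply Rmult_le_compat_r with (r := r2) in K; [|lra].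
    replace (M / r2 * r2) with M in K by (field; lra). exact K. }
  assert (K3 : M < X * r2).
  { apply Rle_lt_trans with (X * (M / X)); [right; field; lra|].
    apply Rmult_lt_compat_l; unfold r2; lra. }
  lra.
Qed.

(** Completeness enters through absolutely convergent series: the increments of the iteration are
    dominated by a geometric series, and their partial sums are the iterates, which start at 0. *)
Lemma contraction_fixpoint (T : C -> C) (k : R) : 0 <= k < 1 ->
  (forall x y, Cmod (Cminus (T x) (T y)) <= k * Cmod (Cminus x y)) -> exists x, T x = x.
Proof.
  intros Hk HT.
  set (x := fun n => Nat.iter n T (RtoC 0)).
  set (a := fun n => Cminus (x (S n)) (x n)).
  assert (Ba : forall n, Cmod (a n) <= Cmod (a O) * k ^ n).
  { induction n as [|n IH]; [simpl; lra|].
    eapply Rle_trans; [apply (HT (x (S n)) (x n))|]. fold (a n). simpl pow. nra. }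
  destruct (Cseries_ex a) as [l Hl].
  { apply (ex_series_le (V := R_CompleteNormedModule) _ (fun n => Cmod (a O) * k ^ n)).
    - intros n. unfold norm; simpl; unfold abs; simpl. rewrite Rabs_pos_eq by apply Cmod_ge_0.
      apply Ba.
    - apply (ex_series_scal (V := R_NormedModule) (Cmod (a O)) (fun n => k ^ n)).
      exists (/ (1 - k)). apply is_series_geom. rewrite Rabs_pos_eq; lra. }
  exists l. apply Ceq_minus, Cmod_eq_0, Rle_antisym; [|apply Cmod_ge_0].
  apply Cseries_lim in Hl.
  assert (Ex : forall n, Csum a n = x n).
  { induction n as [|n IH]; [reflexivity|]. simpl Csum. rewrite IH. unfold a. ring. }
  assert (L : is_lim_seq (fun n => k * Cmod (Cminus (Csum a n) l)
     + Cmod (Cminus (Csum a (S n)) l)) (k * 0 + 0)).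
  { apply is_lim_seq_plus'.
    - now apply is_lim_seq_mult'; [apply is_lim_seq_const|].
    - now apply (is_lim_seq_incr_1 (fun n => Cmod (Cminus (Csum a n) l))) in Hl. }
  replace 0 with (k * 0 + 0) by ring.
  refine (is_lim_seq_le (fun _ => Cmod (Cminus (T l) l)) _ (Finite _) (Finite _) _
    (is_lim_seq_const _) L).
  intros n. rewrite !Ex.
  pose proof (Cmod_triangle_minus (T l) (x (S n)) l) as A.
  pose proof (HT l (x n)) as B. change (T (x n)) with (x (S n)) in B.
  rewrite (Cmod_minus_sym l) in B. lra.
Qed.

(** The sign of the right side compares |x - y| with |1 - conj x y|: one way for two points of the
    closed disk, the other way for points on opposite sides of the circle. *)
Lemma Cmod_blaschke (x y : C) :
  Cmod (Cminus (RtoC 1) (Cmult (Cconj x) y)) ^ 2 - Cmod (Cminus x y) ^ 2 =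
  (1 - Cmod x ^ 2) * (1 - Cmod y ^ 2).
Proof. rewrite !Cmod2_alt. destruct x, y; simpl; ring. Qed.

Lemma Cmod_minus_le_blaschke (x y : C) : Cmod x <= 1 -> Cmod y <= 1 ->
  Cmod (Cminus x y) <= Cmod (Cminus (RtoC 1) (Cmult (Cconj x) y)).
Proof.
  intros Hx Hy. apply Rsqr_incr_0_var; [|apply Cmod_ge_0]. rewrite !Rsqr_pow2.
  pose proof (Cmod_blaschke x y). pose proof (Cmod_ge_0 x). pose proof (Cmod_ge_0 y).
  assert (0 <= (1 - Cmod x ^ 2) * (1 - Cmod y ^ 2)) by (apply Rmult_le_pos; nra). lra.
Qed.

(** A retraction onto the closed disk that increases no distance, so it extends a contraction of the
    disk to the plane. Inversion is chosen over radial projection because it turns an exterior fixed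
    point into a zero inside the disk. *)
Definition reflect_disk (x : C) : C := if Rle_dec (Cmod x) 1 then x else Cinv (Cconj x).

Lemma Cmod_reflect_disk (x : C) : Cmod (reflect_disk x) <= 1.
Proof.
  unfold reflect_disk. destruct (Rle_dec (Cmod x) 1) as [|N]; trivial.
  assert (N0 : Cconj x <> RtoC 0).
  { intros E. apply N. rewrite <- Cmod_conj, E, Cmod_0. lra. }
  rewrite Cmod_inv, Cmod_conj by trivial.
  rewrite <- Rinv_1. apply Rinv_le_contravar; lra.
Qed.

(** x - 1 / conj y equals (conj y x - 1) / conj y. The Blaschke identity bounds the numerator by |x
    - y|, and the denominator exceeds 1 in modulus. *)
Lemma reflect_disk_contracting_mixed (x y : C) : Cmod x <= 1 -> 1 < Cmod y ->
  Cmod (Cminus x (Cinv (Cconj y))) <= Cmod (Cminus x y).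
Proof.
  intros Hx Hy.
  assert (N0 : Cconj y <> RtoC 0).
  { intros E. rewrite <- Cmod_conj, E, Cmod_0 in Hy. lra. }
  replace (Cminus x (Cinv (Cconj y))) with
    (Cmult (Copp (Cminus (RtoC 1) (Cmult (Cconj y) x))) (Cinv (Cconj y))) by (field; trivial).
  rewrite Cmod_mult, Cmod_opp, Cmod_inv, Cmod_conj by trivial.
  assert (A : Cmod (Cminus (RtoC 1) (Cmult (Cconj y) x)) <= Cmod (Cminus x y)).
  { apply Rsqr_incr_0_var; [|apply Cmod_ge_0]. rewrite !Rsqr_pow2.
    pose proof (Cmod_blaschke y x) as B. rewrite (Cmod_minus_sym y x) in B.
    pose proof (Cmod_ge_0 x).
    assert (0 <= (Cmod y ^ 2 - 1) * (1 - Cmod x ^ 2)) by (apply Rmult_le_pos; nra). lra. }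
  apply Rle_trans with (Cmod (Cminus x y) * 1); [|lra].
  apply Rmult_le_compat; trivial; try apply Cmod_ge_0.
  - left. apply Rinv_0_lt_compat; lra.
  - rewrite <- Rinv_1. apply Rinv_le_contravar; lra.
Qed.

Lemma reflect_disk_contracting (x y : C) :
  Cmod (Cminus (reflect_disk x) (reflect_disk y)) <= Cmod (Cminus x y).
Proof.
  unfold reflect_disk.
  destruct (Rle_dec (Cmod x) 1) as [Hx|Hx], (Rle_dec (Cmod y) 1) as [Hy|Hy].
  - lra.
  - apply reflect_disk_contracting_mixed; lra.
  - rewrite Cmod_minus_sym, (Cmod_minus_sym x). apply reflect_disk_contracting_mixed; lra.
  - apply Rnot_le_lt in Hx, Hy.
    assert (Nx : Cconj x <> RtoC 0).
    { intros E. rewrite <- Cmod_conj, E, Cmod_0 in Hx. lra. }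
    assert (Ny : Cconj y <> RtoC 0).
    { intros E. rewrite <- Cmod_conj, E, Cmod_0 in Hy. lra. }
    replace (Cminus (Cinv (Cconj x)) (Cinv (Cconj y))) with
      (Cmult (Cconj (Cminus y x)) (Cinv (Cmult (Cconj x) (Cconj y))))
      by (rewrite Cminus_conj; field; auto).
    rewrite Cmod_mult, Cmod_inv, Cmod_mult, !Cmod_conj by (now apply Cmult_neq_0).
    rewrite (Cmod_minus_sym y x).
    apply Rle_trans with (Cmod (Cminus x y) * 1); [|lra].
    apply Rmult_le_compat_l; [apply Cmod_ge_0|].
    rewrite <- Rinv_1. apply Rinv_le_contravar; nra.
Qed.

(* The map [zeta |-> conj zeta + k (reflect_disk zeta)] is a bijection of the plane that agrees
   with [1 / z + k z] at the reflection [z] of any [zeta] outside the disk. *)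
Lemma reflected_equation (k : C -> C) (kap : R) (a : C) : 0 <= kap < 1 ->
  (forall x y, Cmod x <= 1 -> Cmod y <= 1 ->
     Cmod (Cminus (k x) (k y)) <= kap * Cmod (Cminus x y)) ->
  (forall z, Cmod z < 1 -> Cplus (Cminus (RtoC 1) (Cmult a z)) (Cmult z (k z)) <> RtoC 0) ->
  exists zeta, Cmod zeta <= 1 /\ a = Cplus (Cconj zeta) (k zeta).
Proof.
  intros Hk HL HN.
  (* A fixed point solves a = conj zeta + k (reflect_disk zeta); conjugation preserves distances, so
     this map contracts like [k]. *)
  destruct (contraction_fixpoint (fun x => Cconj (Cminus a (k (reflect_disk x)))) kap Hk)
    as [zeta Hz].
  { intros x y. rewrite <- Cminus_conj, Cmod_conj.
    replace (Cminus (Cminus a (k (reflect_disk x))) (Cminus a (k (reflect_disk y)))) with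
      (Cminus (k (reflect_disk y)) (k (reflect_disk x))) by ring.
    eapply Rle_trans; [apply HL; apply Cmod_reflect_disk|].
    apply Rmult_le_compat_l; [lra|]. rewrite (Cmod_minus_sym x). apply reflect_disk_contracting. }
  apply (f_equal Cconj) in Hz. rewrite Cconj_conj in Hz.
  assert (Ea : a = Cplus (Cconj zeta) (k (reflect_disk zeta))) by (rewrite <- Hz; ring).
  clear Hz. unfold reflect_disk in Ea.
  destruct (Rle_dec (Cmod zeta) 1) as [H|H]; [now exists zeta|exfalso].
  apply Rnot_le_lt in H.
  assert (N0 : Cconj zeta <> RtoC 0).
  { intros E. rewrite <- Cmod_conj, E, Cmod_0 in H. lra. }
  (* For |zeta| > 1 the equation becomes a = 1 / w + k w at the interior point w, which is an
     excluded zero. *)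
  set (w := Cinv (Cconj zeta)) in *.
  apply (HN w).
  - unfold w. rewrite Cmod_inv, Cmod_conj by trivial.
    rewrite <- Rinv_1. apply Rinv_lt_contravar; lra.
  - rewrite Ea.
    replace (Cplus _ _) with (Cminus (RtoC 1) (Cmult (Cconj zeta) w)) by ring.
    unfold w. field. trivial.
Qed.

(** * Bound for a factored function *)

Lemma Rsum_inv_sqr_le (n : nat) : Rsum (fun k => / INR (S k) ^ 2) (S n) <= 2 - / INR (S n).
Proof.
  induction n as [|n IH]; [simpl; lra|].
  cbn [Rsum] in *.
  (* Telescoping: 1 / (x + 1)^2 <= 1 / (x (x + 1)). *)
  assert (H : / INR (S (S n)) ^ 2 <= / INR (S n) - / INR (S (S n))); [|lra].
  rewrite (S_INR (S n)). set (x := INR (S n)).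
  assert (Px : 0 < x) by (apply lt_0_INR; lia).
  replace (/ x - / (x + 1)) with (/ (x * (x + 1))) by (field; lra).
  apply Rinv_le_contravar; nra.
Qed.

Lemma ex_series_inv_sqr : ex_series (fun n => / INR (S n) ^ 2).
Proof.
  apply ex_series_bounded with 2.
  - intros n. left. apply Rinv_0_lt_compat, pow_lt, lt_0_INR. lia.
  - intros [|n]; [simpl; lra|]. pose proof (Rsum_inv_sqr_le n). pose proof (Rinv_INR_le_1 n). lra.
Qed.

Lemma Li2_term_bounds (x : R) (n : nat) : 0 <= x <= 1 ->
  0 <= x ^ S n / INR (S n) ^ 2 <= / INR (S n) ^ 2.
Proof.
  intros Hx. assert (P : 0 < / INR (S n) ^ 2) by (apply Rinv_0_lt_compat, pow_lt, lt_0_INR; lia).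
  assert (Q : 0 <= x ^ S n <= 1).
  { split; [apply pow_le; lra|]. rewrite <- (pow1 (S n)). apply pow_incr; lra. }
  unfold Rdiv. nra.
Qed.

Lemma Li2_is_series (x : R) : 0 <= x <= 1 -> is_series (fun n => x ^ S n / INR (S n) ^ 2) (Li2 x).
Proof.
  intros Hx. apply Series_correct.
  apply (ex_series_le (V := R_CompleteNormedModule) _ (fun n => / INR (S n) ^ 2));
    [|exact ex_series_inv_sqr].
  intros n. pose proof (Li2_term_bounds x n Hx) as H.
  change (norm (x ^ S n / INR (S n) ^ 2)) with (Rabs (x ^ S n / INR (S n) ^ 2)).
  rewrite Rabs_pos_eq; lra.
Qed.

Lemma Li2_le (x y : R) : 0 <= x <= y -> y <= 1 -> Li2 x <= Li2 y.
Proof.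
  intros Hx Hy. apply Series_le.
  - intros n. split; [apply Li2_term_bounds; lra|].
    apply Rmult_le_compat_r; [|apply pow_incr; lra].
    left. apply Rinv_0_lt_compat, pow_lt, lt_0_INR. lia.
  - eexists. apply Li2_is_series. lra.
Qed.

Lemma is_series_decr_0 (a : nat -> R) (l : R) :
  a O = 0 -> is_series (fun n => a (S n)) l -> is_series a l.
Proof.
  intros H0 H. apply is_series_decr_1.
  change (is_series (fun k => a (S k)) (l + - a O)).
  now rewrite H0, Ropp_0, Rplus_0_r.
Qed.

Lemma Cmod_neglogc_S (a : C) (n : nat) : Cmod (neglogc a (S n)) = Cmod a ^ S n / INR (S n).
Proof.
  unfold neglogc. pose proof (Rinv_INR_le_1 n).
  rewrite Cmod_mult, Cmod_pow, Cmod_R, Rabs_pos_eq by lra. reflexivity.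
Qed.

Lemma Cmod_divc_S (c : nat -> C) (n : nat) : Cmod (divc c (S n)) = / INR (S n) * Cmod (c (S n)).
Proof.
  unfold divc. pose proof (Rinv_INR_le_1 n).
  rewrite Cmod_mult, Cmod_R, Rabs_pos_eq by lra. reflexivity.
Qed.

Lemma is_series_ext_R (a b : nat -> R) (l : R) :
  is_series a l -> (forall n, a n = b n) -> is_series b l.
Proof. intros H E. exact (is_series_ext _ _ _ E H). Qed.

Lemma neglogc_sqr_series (k : R) : 0 <= k <= 1 ->
  is_series (fun n => Cmod (neglogc (RtoC 1) n) ^ 2 * (k ^ 2) ^ n) (Li2 (k ^ 2)).
Proof.
  intros Hk. apply is_series_decr_0; [simpl; rewrite Cmod_0; ring|].
  apply (is_series_ext_R _ _ _ (Li2_is_series (k ^ 2) ltac:(nra))).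
  intros n. rewrite Cmod_neglogc_S, Cmod_1, pow1. cbv beta. field. apply not_0_INR; lia.
Qed.

Lemma Cmod_plus_sqr (a v : C) :
  Cmod (Cplus a v) ^ 2 = Cmod a ^ 2 + 2 * Re (Cmult (Cconj a) v) + Cmod v ^ 2.
Proof. rewrite !Cmod2_alt. destruct a, v; simpl; ring. Qed.

Lemma factored_log_bound (l c : nat -> C) (L u : C -> C) (k : R) (zeta : C) :
  disk_series l L -> l O = RtoC 0 -> disk_series c u -> 0 <= k <= 1 -> Cmod zeta <= 1 ->
  (forall z, Cmod z < 1 -> Cmod (u z) <= k * Cmod z) ->
  (forall z, Cmod z < 1 -> Cexp (L z) =
     Cmult (Cinv (Cminus (RtoC 1) (Cmult (Cconj zeta) z))) (Cinv (Cminus (RtoC 1) (u z)))) ->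
  forall N, Rsum (fun n => Cmod (l n) ^ 2) N <= Li2 1 + 2 * Li2 k + Li2 (k ^ 2).
Proof.
  intros HL L0 Hu Hk Hz Huk HE N.
  assert (Hzc : Cmod (Cconj zeta) <= 1) by now rewrite Cmod_conj.
  assert (H1 : Cmod (RtoC 1) <= 1) by (rewrite Cmod_1; lra).
  destruct (neglog_ex (Cconj zeta) Hzc) as [F1 [HF1 PF1]].
  destruct (neglog_ex (RtoC 1) H1) as [F2 [HF2 PF2]].
  assert (Bu : forall z, Cmod z < 1 -> Cmod (u z) < 1).
  { intros z Hz1. pose proof (Huk z Hz1). pose proof (Cmod_ge_0 z). nra. }
  set (v := fun n => Cminus (l n) (neglogc (Cconj zeta) n)).
  set (V := fun z => Cminus (L z) (F1 z)).
  assert (HV : disk_series v V) by (apply disk_series_minus; trivial).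
  destruct (disk_series_derive _ _ HV) as [DV [_ HDV]].
  destruct (disk_series_derive _ _ Hu) as [Du [_ HDu]].
  assert (V0 : v O = RtoC 0) by (unfold v; rewrite L0; simpl; ring).
  (* Both sides have exponential 1 / (1 - u) and vanish at 0, so they are the same branch. *)
  assert (EV : forall z, Cmod z < 1 -> V z = F2 (u z)).
  { intros z Hz1. apply Ceq_minus.
    replace (Cminus (V z) (F2 (u z))) with (Cplus (V z) (Cmult (RtoC (-1)) (F2 (u z)))) by ring.
    apply (Cexp_eq_1_disk (fun z => Cplus (V z) (Cmult (RtoC (-1)) (F2 (u z))))
      (fun z => Cplus (DV z) (Cmult (RtoC (-1)) (Cmult
         (Cmult (RtoC 1) (Cinv (Cminus (RtoC 1) (Cmult (RtoC 1) (u z))))) (Du z))))); trivial.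
    - intros w Hw. apply cderiv_plus; [now apply HDV|]. apply cderiv_scal.
      apply (cderiv_comp F2); [now apply HDu|]. apply (PF2 (u w)). now apply Bu.
    - intros w Hw. unfold V.
      replace (Cplus _ _) with (Cplus (L w) (Cplus (Copp (F1 w)) (Copp (F2 (u w))))) by ring.
      rewrite !Cexp_plus, !Cexp_opp, HE by trivial.
      rewrite (proj2 (PF1 w Hw)), (proj2 (PF2 (u w) (Bu w Hw))).
      pose proof (one_minus_neq_0 _ w Hzc Hw) as N1.
      pose proof (one_minus_neq_0 _ (u w) H1 (Bu w Hw)) as N2. rewrite Cmult_1_l in *.
      field. split; trivial.
    - assert (U0 : u (RtoC 0) = RtoC 0).
      { apply Cmod_eq_0, Rle_antisym; [|apply Cmod_ge_0].
        eapply Rle_trans; [apply Huk|]; rewrite Cmod_0; lra. }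
      rewrite U0, (disk_series_at_0 _ _ HV), V0, (disk_series_at_0 _ _ HF2). simpl. ring. }
  assert (SV : forall z, Cmod z < 1 ->
    Cseries (fun n => Cmult (neglogc (RtoC 1) n) (Cpow (u z) n)) (V z)).
  { intros z Hz1. rewrite EV by trivial. apply HF2. now apply Bu. }
  (* Rogosinski's theorem with outer function - log (1 - w), whose coefficients 1 / n are at most
     1. *)
  assert (RB : forall M, Rsum (fun n => Cmod (v n) ^ 2) M <= Li2 (k ^ 2)).
  { apply (rogosinski c v (neglogc (RtoC 1)) u V k); trivial.
    - intros n. now apply Cmod_neglogc_le.
    - now apply neglogc_sqr_series. }
  assert (Bk : Cmod (RtoC k) = k) by (rewrite Cmod_R, Rabs_pos_eq; lra).
  destruct (disk_series_ex (divc v)) as [W HW].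
  { apply disk_bounded_divc. exact (disk_series_bounded _ _ HV). }
  destruct (disk_series_ex (divc (neglogc (RtoC k)))) as [G HG].
  { apply disk_bounded_divc, disk_bounded_le_1. intros n. apply Cmod_neglogc_le. lra. }
  assert (RW : forall r, 0 < r < 1 -> Re (W (Cmult (RtoC r) zeta)) <= Li2 k).
  { intros r Hr. eapply Rle_trans; [apply (ray_integral_le v V W G k zeta); trivial|].
    (* |V(z)| is at most the sum of |u|^n / n, and |u| <= k |z| <= k t. *)
    - intros z t b Hzt Ht Hb. apply (Cseries_le _ _ _ _ (SV z ltac:(lra)) Hb).
      intros [|n]; [simpl; rewrite Cmult_0_l, Cmod_0; lra|].
      rewrite Cmod_mult, !Cmod_neglogc_S, Cmod_1, Bk, pow1, Cmod_pow.
      pose proof (Rinv_INR_le_1 n). unfold Rdiv.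
      replace (k ^ S n * / INR (S n) * t ^ S n) with (1 * / INR (S n) * (k * t) ^ S n)
        by (rewrite Rpow_mult_distr; ring).
      apply Rmult_le_compat_l; [lra|]. apply pow_incr. split; [apply Cmod_ge_0|].
      eapply Rle_trans; [apply Huk; lra|]. apply Rmult_le_compat_l; lra.
    - assert (Br : Cmod (RtoC r) = r) by (rewrite Cmod_R, Rabs_pos_eq; lra).
      eapply Rle_trans; [apply Rle_abs|]. eapply Rle_trans; [apply re_le_Cmod|].
      (* The coefficients of G are k^n / n^2, so |G(r)| is at most their sum. *)
      assert (SG : is_series (fun n => Cmod (divc (neglogc (RtoC k)) n)) (Li2 k)).
      { apply is_series_decr_0; [simpl; apply Cmod_0|].
        apply (is_series_ext_R _ _ _ (Li2_is_series k Hk)).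
        intros n. rewrite Cmod_divc_S, Cmod_neglogc_S, Bk. cbv beta. field.
        apply not_0_INR; lia. }
      apply (Cseries_le _ _ _ _ (HG (RtoC r) ltac:(lra)) SG). intros n.
      rewrite Cmod_mult, Cmod_pow, Br. rewrite <- (Rmult_1_r (Cmod (divc _ n))) at 2.
      apply Rmult_le_compat_l; [apply Cmod_ge_0|]. rewrite <- (pow1 n). apply pow_incr; lra. }
  (* The weight r^n moves the cross term to the point r zeta of the open disk, where the series of W
     converges even if |zeta| = 1. *)
  apply Rsum_le_of_dilates; [intros n; apply pow2_ge_0|]. intros r Hr.
  set (a := neglogc (Cconj zeta)).
  assert (Pr : forall n, 0 <= r ^ n <= 1).
  { intros n. split; [apply pow_le; lra|]. rewrite <- (pow1 n). apply pow_incr; lra. }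
  assert (S1 : forall M, Rsum (fun n => Cmod (a n) ^ 2 * r ^ n) M <= Li2 1).
  { intros M. assert (S1 := neglogc_sqr_series 1 ltac:(lra)). rewrite pow1 in S1.
    eapply Rle_trans; [|apply (Rsum_le_series _ _ M) with (2 := S1)].
    - apply Rsum_le. intros n _. rewrite pow1.
      apply Rmult_le_compat; [apply pow2_ge_0|apply Pr| |apply Pr].
      apply pow_incr. split; [apply Cmod_ge_0|]. unfold a.
      destruct n as [|n]; [simpl; lra|]. rewrite !Cmod_neglogc_S.
      apply Rmult_le_compat_r; [pose proof (Rinv_INR_le_1 n); lra|].
      apply pow_incr. rewrite Cmod_1. split; [apply Cmod_ge_0|trivial].
    - intros n. rewrite pow1, Rmult_1_r. apply pow2_ge_0. }
  assert (S3 : forall M, Rsum (fun n => Cmod (v n) ^ 2 * r ^ n) M <= Li2 (k ^ 2)).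
  { intros M. eapply Rle_trans; [|apply (RB M)]. apply Rsum_le. intros n _.
    pose proof (pow2_ge_0 (Cmod (v n))). specialize (Pr n). nra. }
  assert (P1 : forall n, 0 <= Cmod (a n) ^ 2 * r ^ n)
    by (intros n; apply Rmult_le_pos; [apply pow2_ge_0|apply Pr]).
  assert (P3 : forall n, 0 <= Cmod (v n) ^ 2 * r ^ n)
    by (intros n; apply Rmult_le_pos; [apply pow2_ge_0|apply Pr]).
  destruct (ex_series_bounded _ _ P1 S1) as [A1 HA1].
  destruct (ex_series_bounded _ _ P3 S3) as [A3 HA3].
  assert (Brz : Cmod (Cmult (RtoC r) zeta) < 1).
  { rewrite Cmod_mult, Cmod_R, Rabs_pos_eq by lra. pose proof (Cmod_ge_0 zeta). nra. }
  destruct (HW _ Brz) as [S2 _].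
  assert (ST := is_series_plus _ _ _ _ (is_series_plus _ _ _ _ HA1
    (is_series_scal 2 _ _ S2)) HA3).
  assert (T : Rsum (fun n => Cmod (l n) ^ 2 * r ^ n) N <=
    A1 + 2 * Re (W (Cmult (RtoC r) zeta)) + A3).
  { apply Rsum_le_series.
    - intros n. apply Rmult_le_pos; [apply pow2_ge_0|apply Pr].
    - apply (is_series_ext_R _ _ _ ST). intros n.
      match goal with |- ?x = _ => change x with (Cmod (a n) ^ 2 * r ^ n +
        2 * Re (Cmult (divc v n) (Cpow (Cmult (RtoC r) zeta) n)) + Cmod (v n) ^ 2 * r ^ n) end.
      replace (l n) with (Cplus (a n) (v n)) by (unfold v, a; ring).
      rewrite Cmod_plus_sqr.
      (* The conjugate of [a n] is zeta^n / n for n >= 1, so the mixed product is the n-th term of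
         W(r zeta). *)
      replace (Re (Cmult (divc v n) (Cpow (Cmult (RtoC r) zeta) n))) with
        (Re (Cmult (Cconj (a n)) (v n)) * r ^ n); [ring|].
      rewrite <- re_scal_r. f_equal. unfold a. destruct n as [|n].
      + simpl. apply C_ext; simpl; ring.
      + unfold divc, neglogc.
        rewrite Cmult_conj, Cpow_conj, Cconj_conj, Cpow_mult_l, RtoC_pow.
        replace (Cconj (RtoC (/ INR (S n)))) with (RtoC (/ INR (S n)))
          by (apply C_ext; simpl; ring). ring. }
  specialize (RW r Hr).
  pose proof (series_le_bound _ _ _ HA1 S1). pose proof (series_le_bound _ _ _ HA3 S3). lra.
Qed.

(** * Reduction of the class U to a factored function *)

Lemma Cmod_Rmult_lt_1 (s : R) (z : C) : 0 < s < 1 -> Cmod z <= 1 -> Cmod (Cmult (RtoC s) z) < 1.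
Proof.
  intros Hs Hz. rewrite Cmod_mult, Cmod_R, Rabs_pos_eq by lra.
  pose proof (Cmod_ge_0 z). nra.
Qed.

Lemma Cmod_segment (x y : C) (r t : R) : 0 <= t <= 1 -> Cmod x < r -> Cmod y < r ->
  Cmod (Cplus x (Cmult (RtoC t) (Cminus y x))) < r.
Proof.
  intros Ht Hx Hy.
  replace (Cplus x _) with (Cplus (Cmult (RtoC (1 - t)) x) (Cmult (RtoC t) y))
    by (rewrite RtoC_minus; ring).
  eapply Rle_lt_trans; [apply Cmod_triangle|].
  rewrite !Cmod_mult, !Cmod_R, !Rabs_pos_eq by lra.
  destruct (Rle_lt_dec t (1 / 2)).
  - assert ((1 - t) * Cmod x < (1 - t) * r) by (apply Rmult_lt_compat_l; lra).
    assert (t * Cmod y <= t * r) by (apply Rmult_le_compat_l; lra). lra.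
  - assert ((1 - t) * Cmod x <= (1 - t) * r) by (apply Rmult_le_compat_l; lra).
    assert (t * Cmod y < t * r) by (apply Rmult_lt_compat_l; lra). lra.
Qed.

(* For [p = z / f] the expression [(z / f)^2 f' - 1] equals [p - z p' - 1 = - z^2 h'(z)]. *)
Lemma U_reciprocal_form (l : nat -> C) (L DL : C -> C) (lam : R) :
  disk_series l L -> l O = RtoC 0 -> disk_series (derivc l) DL -> 0 < lam ->
  (forall z, Cmod z < 1 -> Cmod (Cminus (Cmult (Cexp (Copp (L z)))
     (Cplus (RtoC 1) (Cmult z (DL z)))) (RtoC 1)) < lam) ->
  exists (a : C) (c : nat -> C) (h : C -> C), disk_series c h /\
    (forall x y, Cmod x < 1 -> Cmod y < 1 ->
       Cmod (Cminus (h x) (h y)) <= lam * Cmod (Cminus x y)) /\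
    (forall z, Cmod z < 1 ->
       Cexp (Copp (L z)) = Cplus (Cminus (RtoC 1) (Cmult a z)) (Cmult z (h z))).
Proof.
  intros HL L0 HDL Hlam HU.
  assert (HN : disk_series (fun n => Cmult (RtoC (-1)) (l n)) (fun z => Copp (L z))).
  { eapply disk_series_ext; [reflexivity| |exact (disk_series_scal (RtoC (-1)) _ _ HL)].
    intros z _; cbv beta; ring. }
  assert (Hp := disk_series_exp _ _ HN ltac:(cbv beta; rewrite L0; ring)).
  set (e := expc (fun n => Cmult (RtoC (-1)) (l n))) in *.
  (* Splitting off two terms gives p = 1 + (e 1) z + z^2 p2(z), hence h = z p2 and a = - e 1. *)
  destruct (disk_series_tail _ _ Hp) as [p1 [Hp1 E1]].
  destruct (disk_series_tail _ _ Hp1) as [p2 [Hp2 E2]].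
  assert (Hh := disk_series_shift _ _ Hp2).
  set (h := fun z => Cmult z (p2 z)) in *.
  set (c := shiftc (fun n => e (S (S n)))) in *.
  destruct (disk_series_derive _ _ Hh) as [Dh [HDh HDh']].
  assert (Ep : forall z, Cmod z < 1 ->
    Cexp (Copp (L z)) = Cplus (Cplus (RtoC 1) (Cmult (e 1%nat) z)) (Cmult z (h z))).
  { intros z Hz. rewrite E1, E2 by trivial. unfold h.
    replace (e O) with (RtoC 1) by reflexivity. ring. }
  (* The derivative of p, computed once from the exponential and once from the expansion. *)
  assert (Ed : forall z, Cmod z < 1 -> Cmult (Copp (DL z)) (Cexp (Copp (L z))) =
    Cplus (Cplus (e 1%nat) (h z)) (Cmult z (Dh z))).
  { intros z Hz. apply (cderiv_unique (fun z => Cexp (Copp (L z))) z).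
    - rewrite Cmult_comm. apply cderiv_comp; [|apply cderiv_Cexp].
      apply (cderiv_ext (fun z => Cmult (RtoC (-1)) (L z))); [intros; ring|].
      eapply cderiv_eq; [apply cderiv_scal, (disk_series_cderiv _ _ _ z HL HDL Hz)|ring].
    - apply (cderiv_ext_disk
        (fun z => Cplus (Cplus (RtoC 1) (Cmult (e 1%nat) z)) (Cmult z (h z)))); trivial.
      { intros w Hw. now rewrite Ep. }
      eapply cderiv_eq.
      + apply cderiv_plus; [apply cderiv_plus; [apply cderiv_const|apply cderiv_scal, cderiv_id]|].
        apply cderiv_mult; [apply cderiv_id|now apply HDh'].
      + cbv beta. ring. }
  assert (BDh : forall z, Cmod z < 1 -> Cmod (Dh z) <= lam).
  { apply (schwarz_order_2 _ _ lam HDh); [lra|]. intros z Hz.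
    specialize (HU z Hz). specialize (Ed z Hz). specialize (Ep z Hz).
    left. rewrite <- Cmod_opp.
    replace (Copp (Cmult (Cmult z z) (Dh z))) with
      (Cminus (Cmult (Cexp (Copp (L z))) (Cplus (RtoC 1) (Cmult z (DL z)))) (RtoC 1)); trivial.
    replace (Cmult (Cexp (Copp (L z))) (Cplus (RtoC 1) (Cmult z (DL z)))) with
      (Cminus (Cexp (Copp (L z))) (Cmult z (Cmult (Copp (DL z)) (Cexp (Copp (L z)))))) by ring.
    rewrite Ed, Ep. ring. }
  exists (Copp (e 1%nat)), c, h. split; [exact Hh|split].
  - intros x y Hx Hy. apply (cderiv_lipschitz h Dh). intros t Ht w.
    assert (Hw : Cmod w < 1) by (apply Cmod_segment; trivial). split; auto.
  - intros z Hz. rewrite Ep by trivial. ring.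
Qed.

(** Works with L(s z), s = sqrt r. The squared moduli of its coefficients carry the weight r^n of
    [Rsum_le_of_dilates], and k has Lipschitz constant s^2 lam = r lam < 1 on the closed disk even
    for lam = 1. *)
Lemma U_log_bound (l : nat -> C) (L DL : C -> C) (lam : R) :
  disk_series l L -> l O = RtoC 0 -> disk_series (derivc l) DL -> 0 < lam <= 1 ->
  (forall z, Cmod z < 1 -> Cmod (Cminus (Cmult (Cexp (Copp (L z)))
     (Cplus (RtoC 1) (Cmult z (DL z)))) (RtoC 1)) < lam) ->
  forall N, Rsum (fun n => Cmod (l n) ^ 2) N <= Li2 1 + 2 * Li2 lam + Li2 (lam ^ 2).
Proof.
  intros HL L0 HDL Hlam HU N.
  destruct (U_reciprocal_form l L DL lam HL L0 HDL (proj1 Hlam) HU) as [a [c [h [Hh [Lip Ep]]]]].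
  apply Rsum_le_of_dilates; [intros n; apply pow2_ge_0|]. intros r Hr.
  set (s := sqrt r). assert (Er : r = s ^ 2) by (unfold s; rewrite pow2_sqrt; lra).
  assert (Hs : 0 < s < 1).
  { split; [apply sqrt_lt_R0; lra|]. rewrite <- sqrt_1. apply sqrt_lt_1; lra. }
  set (k := fun z => Cmult (RtoC s) (h (Cmult (RtoC s) z))).
  set (kap := r * lam).
  assert (Hkap : 0 < kap < 1) by (unfold kap; nra).
  assert (Lk : forall x y, Cmod x <= 1 -> Cmod y <= 1 ->
    Cmod (Cminus (k x) (k y)) <= kap * Cmod (Cminus x y)).
  { intros x y Hx Hy. unfold k.
    replace (Cminus _ _) with (Cmult (RtoC s)
      (Cminus (h (Cmult (RtoC s) x)) (h (Cmult (RtoC s) y)))) by ring.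
    rewrite Cmod_mult, Cmod_R, Rabs_pos_eq by lra.
    pose proof (Lip _ _ (Cmod_Rmult_lt_1 s x Hs Hx) (Cmod_Rmult_lt_1 s y Hs Hy)) as B.
    replace (Cminus (Cmult (RtoC s) x) (Cmult (RtoC s) y)) with (Cmult (RtoC s) (Cminus x y))
      in B by ring.
    rewrite (Cmod_mult (RtoC s)), Cmod_R, Rabs_pos_eq in B by lra.
    unfold kap. rewrite Er.
    replace (s ^ 2 * lam * Cmod (Cminus x y)) with (s * (lam * (s * Cmod (Cminus x y)))) by ring.
    apply Rmult_le_compat_l; lra. }
  assert (Eq : forall z, Cmod z < 1 -> Cexp (Copp (L (Cmult (RtoC s) z))) =
    Cplus (Cminus (RtoC 1) (Cmult (Cmult (RtoC s) a) z)) (Cmult z (k z))).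
  { intros z Hz. rewrite Ep by (apply Cmod_Rmult_lt_1; lra). unfold k. ring. }
  destruct (reflected_equation k kap (Cmult (RtoC s) a)) as [zeta [Hz Ea]]; trivial; [lra| |].
  { intros z Hz. rewrite <- Eq by trivial. apply Cexp_neq_0. }
  assert (Hzc : Cmod (Cconj zeta) <= 1) by now rewrite Cmod_conj.
  (* 1 - (conj zeta + k zeta) z + z k(z) = (1 - conj zeta z) - z (k zeta - k z), and u is the last
     product divided by 1 - conj zeta z. *)
  set (u := fun z => Cmult z (Cmult (Cminus (k zeta) (k z))
    (Cinv (Cminus (RtoC 1) (Cmult (Cconj zeta) z))))).
  assert (Bs : Cmod (RtoC s) <= 1) by (rewrite Cmod_R, Rabs_pos_eq; lra).
  assert (Hu := disk_series_shift _ _ (disk_series_mult _ _ _ _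
    (disk_series_minus _ _ _ _ (disk_series_const (k zeta))
      (disk_series_scal (RtoC s) _ _ (disk_series_dilate _ _ _ Bs Hh)))
    (disk_series_geom _ Hzc))).
  fold u in Hu.
  (* The Lipschitz bound supplies kap |zeta - z|, and |zeta - z| <= |1 - conj zeta z| cancels the
     denominator. *)
  assert (Bu : forall z, Cmod z < 1 -> Cmod (u z) <= kap * Cmod z).
  { intros z Hz1. unfold u.
    pose proof (one_minus_neq_0 _ z Hzc Hz1) as N1.
    assert (P1 : 0 < Cmod (Cminus (RtoC 1) (Cmult (Cconj zeta) z))) by now apply Cmod_gt_0.
    rewrite !Cmod_mult, Cmod_inv by trivial. rewrite Rmult_comm.
    apply Rmult_le_compat_r; [apply Cmod_ge_0|].
    apply Rmult_le_reg_r with (Cmod (Cminus (RtoC 1) (Cmult (Cconj zeta) z))); trivial.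
    rewrite Rmult_assoc, Rinv_l, Rmult_1_r by lra.
    eapply Rle_trans; [apply Lk; lra|].
    apply Rmult_le_compat_l; [lra|]. apply Cmod_minus_le_blaschke; lra. }
  apply Rle_trans with (Li2 1 + 2 * Li2 kap + Li2 (kap ^ 2)).
  - rewrite (Rsum_ext _ (fun n => Cmod (Cmult (l n) (Cpow (RtoC s) n)) ^ 2)).
    + apply (factored_log_bound _ _ (fun z => L (Cmult (RtoC s) z)) u kap zeta
        (disk_series_dilate _ _ _ Bs HL) ltac:(cbv beta; rewrite L0; ring) Hu); trivial; [lra|].
      intros z Hz1.
      replace (L (Cmult (RtoC s) z)) with (Copp (Copp (L (Cmult (RtoC s) z)))) by ring.
      rewrite Cexp_opp, Eq, Ea by trivial.
      pose proof (one_minus_neq_0 _ z Hzc Hz1) as N1.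
      assert (N2 : Cminus (RtoC 1) (u z) <> RtoC 0).
      { intros E. specialize (Bu z Hz1). pose proof (Cmod_ge_0 z).
        assert (Eu : u z = RtoC 1).
        { replace (u z) with (Cminus (RtoC 1) (Cminus (RtoC 1) (u z))) by ring. rewrite E. ring. }
        rewrite Eu, Cmod_1 in Bu. nra. }
      replace (Cplus (Cminus (RtoC 1) (Cmult (Cplus (Cconj zeta) (k zeta)) z)) (Cmult z (k z)))
        with (Cmult (Cminus (RtoC 1) (Cmult (Cconj zeta) z)) (Cminus (RtoC 1) (u z)))
        by (unfold u; field; trivial).
      field. split; trivial.
    + intros n _. rewrite Cmod_mult, Cmod_pow, Cmod_R, (Rabs_pos_eq s) by lra.
      rewrite Er, Rpow_mult_distr, <- !pow_mult. now rewrite Nat.mul_comm.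
  - assert (kap <= lam) by (unfold kap; nra).
    pose proof (Li2_le kap lam ltac:(lra) ltac:(lra)).
    pose proof (Li2_le (kap ^ 2) (lam ^ 2) ltac:(simpl; nra) ltac:(simpl; nra)). lra.
Qed.

(** * The value of Li2 at 1 *)

Lemma Rsum_app (a : nat -> R) (n m : nat) :
  Rsum a (n + m) = Rsum a n + Rsum (fun k => a (n + k)%nat) m.
Proof.
  induction m as [|m IH]; [rewrite Nat.add_0_r; simpl; ring|].
  rewrite Nat.add_succ_r. cbn [Rsum]. rewrite IH. ring.
Qed.

Lemma Rsum_rev (a : nat -> R) (n : nat) : Rsum a n = Rsum (fun k => a (n - 1 - k)%nat) n.
Proof.
  induction n as [|n IH]; [reflexivity|].
  rewrite (Rsum_shift (fun k => a (S n - 1 - k)%nat)). cbn [Rsum]. rewrite IH, Rplus_comm. f_equal.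
  - f_equal. lia.
  - apply Rsum_ext. intros k Hk. f_equal. lia.
Qed.

Lemma Rsum_mono (a : nat -> R) (n m : nat) : (forall k, 0 <= a k) -> (n <= m)%nat ->
  Rsum a n <= Rsum a m.
Proof.
  intros Ha H. replace m with (n + (m - n))%nat by lia. rewrite Rsum_app.
  pose proof (Rsum_pos (fun k => a (n + k)%nat) (m - n) (fun k _ => Ha _)). lra.
Qed.

(** The angles are the multiples of PI / 2^(n+1) inside (0, PI / 2). Cauchy's evaluation of the sum
    of 1 / n^2 needs the exact value of such a sum, and dyadic angles provide it by a linear
    recursion. *)
Definition csc_sum (n : nat) : R :=
  Rsum (fun k => / sin (INR (S k) * (PI / 2 ^ S n)) ^ 2) (2 ^ n - 1).

Lemma csc_sqr_half (x : R) : sin x <> 0 ->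
  4 * / sin x ^ 2 = / sin (x / 2) ^ 2 + / cos (x / 2) ^ 2.
Proof.
  intros H. replace x with (2 * (x / 2)) in H at 1 by field.
  replace x with (2 * (x / 2)) at 1 by field. set (y := x / 2) in *.
  rewrite sin_2a in *.
  assert (N1 : sin y <> 0) by (intros E; rewrite E in H; apply H; ring).
  assert (N2 : cos y <> 0) by (intros E; rewrite E in H; apply H; ring).
  pose proof (sin2_cos2 y) as E. unfold Rsqr in E.
  apply Rmult_eq_reg_r with (sin y ^ 2 * cos y ^ 2).
  - transitivity 1; [field; auto|]. rewrite <- E. field; auto.
  - apply Rmult_integral_contrapositive_currified; apply pow_nonzero; trivial.
Qed.

Lemma dyadic_angle_bounds (n k : nat) : (k < 2 ^ n - 1)%nat ->
  0 < INR (S k) * (PI / 2 ^ S n) < PI / 2.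
Proof.
  intros Hk. pose proof PI_RGT_0. pose proof (pow_lt 2 n ltac:(lra)) as P2n.
  assert (P : 0 < PI / 2 ^ S n) by (apply Rdiv_lt_0_compat; [lra|apply pow_lt; lra]).
  assert (I : INR (S k) < 2 ^ n).
  { replace (2 ^ n) with (INR (2 ^ n)) by (now rewrite pow_INR). apply lt_INR. lia. }
  split; [apply Rmult_lt_0_compat; trivial; apply lt_0_INR; lia|].
  apply Rlt_le_trans with (2 ^ n * (PI / 2 ^ S n)); [now apply Rmult_lt_compat_r|].
  right. simpl. field. lra.
Qed.

(* By the half-angle identity each term of [csc_sum n] splits into two terms of [csc_sum (S n)],
   at complementary angles; only the angle [PI / 4] is left over. *)
Lemma csc_sum_S (n : nat) : csc_sum (S n) = 4 * csc_sum n + 2.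
Proof.
  pose proof (pow_lt 2 n ltac:(lra)) as P2n.
  assert (HN : (1 <= 2 ^ n)%nat) by (apply Nat.neq_0_lt_0, Nat.pow_nonzero; lia).
  unfold csc_sum. set (N := (2 ^ n)%nat) in *.
  (* The angles below, at and above PI / 4. *)
  replace (2 ^ S n - 1)%nat with ((N - 1) + (1 + (N - 1)))%nat by (unfold N; simpl; lia).
  set (a := fun k => / sin (INR (S k) * (PI / 2 ^ S (S n))) ^ 2).
  rewrite (Rsum_app a), (Rsum_app (fun k => a (N - 1 + k)%nat)).
  assert (EN : INR N = 2 ^ n) by (unfold N; now rewrite pow_INR).
  assert (M : Rsum (fun k => a (N - 1 + k)%nat) 1 = 2).
  { cbn [Rsum]. unfold a. replace (S (N - 1 + 0)) with N by lia. rewrite EN.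
    replace (2 ^ n * (PI / 2 ^ S (S n))) with (PI / 4) by (simpl; field; lra).
    rewrite sin_PI4. rewrite Rplus_0_l.
    replace ((1 / sqrt 2) ^ 2) with (1 / 2); [lra|].
    unfold Rdiv. rewrite Rpow_mult_distr, pow1, pow_inv, pow2_sqrt; lra. }
  rewrite M, (Rsum_rev (fun k => a (N - 1 + (1 + k))%nat)).
  rewrite <- Rsum_scal.
  rewrite (Rsum_ext (fun k => 4 * _) (fun k => a k + a (N - 1 + (1 + (N - 1 - 1 - k)))%nat)).
  { rewrite Rsum_plus. ring. }
  intros k Hk. pose proof (dyadic_angle_bounds n k Hk) as B.
  set (x := INR (S k) * (PI / 2 ^ S n)) in *. pose proof PI_RGT_0.
  rewrite csc_sqr_half by (apply Rgt_not_eq, sin_gt_0; lra).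
  unfold a. f_equal.
  - do 3 f_equal. unfold x. simpl pow. field. lra.
  (* The reversed index gives the angle PI / 2 - x / 2, whose sine is cos (x / 2). *)
  - rewrite <- sin_shift. do 3 f_equal.
    replace (S (N - 1 + (1 + (N - 1 - 1 - k)))) with (N + N - S k)%nat by lia.
    rewrite minus_INR by lia. rewrite plus_INR, EN. unfold x. simpl pow. field. lra.
Qed.

Lemma csc_sum_eq (n : nat) : csc_sum n = 2 / 3 * (4 ^ n - 1).
Proof.
  induction n as [|n IH]; [unfold csc_sum; simpl; ring|].
  rewrite csc_sum_S, IH. simpl. field.
Qed.

(** This is x <= tan x: sin t - t cos t vanishes at 0 and has derivative t sin t. *)
Lemma x_cos_le_sin (x : R) : 0 < x < PI / 2 -> x * cos x <= sin x.
Proof.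
  intros Hx.
  destruct (MVT_cor2 (fun t => sin t - t * cos t) (fun t => t * sin t) 0 x)
    as [c [E Hc]]; [lra| |].
  - intros t _. apply is_derive_Reals. auto_derive; trivial. ring.
  - rewrite sin_0, Rmult_0_l in E. pose proof PI_RGT_0.
    assert (0 <= sin c) by (apply sin_ge_0; lra).
    assert (0 <= c * sin c * (x - 0)) by (apply Rmult_le_pos; [apply Rmult_le_pos|]; lra). lra.
Qed.

(** The lower bound is sin x < x; the upper one is 1 + cot^2 x with cot x <= 1 / x. *)
Lemma csc_sqr_bounds (x : R) : 0 < x < PI / 2 -> / x ^ 2 <= / sin x ^ 2 <= 1 + / x ^ 2.
Proof.
  intros Hx. pose proof PI_RGT_0.
  assert (S : 0 < sin x) by (apply sin_gt_0; lra).
  assert (L : sin x < x) by (apply sin_lt_x; lra).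
  pose proof (x_cos_le_sin x Hx) as T.
  assert (C0 : 0 <= cos x) by (apply cos_ge_0; lra).
  pose proof (sin2_cos2 x) as E. unfold Rsqr in E. split.
  - apply Rinv_le_contravar; nra.
  - apply Rmult_le_reg_r with (sin x ^ 2 * x ^ 2); [apply Rmult_lt_0_compat; nra|].
    replace (/ sin x ^ 2 * (sin x ^ 2 * x ^ 2)) with (x ^ 2) by (field; lra).
    replace ((1 + / x ^ 2) * (sin x ^ 2 * x ^ 2)) with (sin x ^ 2 * x ^ 2 + sin x ^ 2) by (field; lra).
    assert ((x * cos x) * (x * cos x) <= sin x * sin x) by (apply Rmult_le_compat; nra).
    nra.
Qed.

(** Replacing 1 / sin^2 x by 1 / x^2 costs at most 1 per angle, less than 2^n in total, while the
    sums are of order 4^n; after rescaling the error is of order 2^(-n). *)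
Lemma inv_sqr_partial_sum_bounds (n : nat) :
  PI ^ 2 / 6 - PI ^ 2 * (1 / 2) ^ n <= Rsum (fun k => / INR (S k) ^ 2) (2 ^ n - 1) <= PI ^ 2 / 6.
Proof.
  set (U := Rsum _ _). pose proof PI_RGT_0 as PP.
  assert (P4 : 0 < 4 ^ n) by (apply pow_lt; lra).
  assert (P2 : 0 < 2 ^ n) by (apply pow_lt; lra).
  assert (E4 : 4 ^ n = 2 ^ n * 2 ^ n) by (rewrite <- Rpow_mult_distr; f_equal; lra).
  (* A = (2^(n+1) / PI)^2, so that 1 / x^2 = A / j^2 at the angle x = j PI / 2^(n+1). *)
  set (A := 4 * 4 ^ n / PI ^ 2).
  assert (PA : 0 < A) by (apply Rdiv_lt_0_compat; [lra|apply pow_lt; lra]).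
  assert (B : A * U <= csc_sum n <= (INR (2 ^ n - 1) * 1 + A * U)).
  { unfold U, csc_sum. rewrite <- Rsum_const, <- Rsum_scal, <- Rsum_plus.
    assert (K : forall k, (k < 2 ^ n - 1)%nat -> A * / INR (S k) ^ 2 <=
      / sin (INR (S k) * (PI / 2 ^ S n)) ^ 2 <= 1 + A * / INR (S k) ^ 2).
    { intros k Hk. assert (Pk : 0 < INR (S k)) by (apply lt_0_INR; lia).
      replace (A * / INR (S k) ^ 2) with (/ (INR (S k) * (PI / 2 ^ S n)) ^ 2).
      - apply csc_sqr_bounds. now apply dyadic_angle_bounds.
      - unfold A. rewrite E4. simpl (2 ^ S n). field. repeat split; lra. }
    split; apply Rsum_le; intros k Hk; apply K; trivial. }
  rewrite csc_sum_eq in B.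
  assert (HN : INR (2 ^ n - 1) <= 2 ^ n).
  { replace (2 ^ n) with (INR (2 ^ n)) by (now rewrite pow_INR). apply le_INR. lia. }
  assert (I : (1 / 2) ^ n * 2 ^ n = 1) by (rewrite pow_div by lra; apply pow1).
  split; apply Rmult_le_reg_l with A; trivial.
  - apply Rle_trans with (2 / 3 * (4 ^ n - 1) - 2 ^ n); [|lra].
    replace (A * (PI ^ 2 / 6 - PI ^ 2 * (1 / 2) ^ n)) with
      (2 / 3 * 4 ^ n - 4 * (4 ^ n * (1 / 2) ^ n)) by (unfold A; field; lra).
    replace (4 ^ n * (1 / 2) ^ n) with (2 ^ n) by (rewrite E4; nra).
    assert (1 <= 2 ^ n) by (apply pow_R1_Rle; lra). lra.
  - replace (A * (PI ^ 2 / 6)) with (2 / 3 * 4 ^ n) by (unfold A; field; lra). lra.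
Qed.

Lemma Li2_1 : Li2 1 = PI ^ 2 / 6.
Proof.
  assert (H := Li2_is_series 1 ltac:(lra)).
  assert (H' : is_series (fun n => / INR (S n) ^ 2) (Li2 1)).
  { apply (is_series_ext_R _ _ _ H). intros n. rewrite pow1. unfold Rdiv. ring. }
  assert (P : forall n, 0 <= / INR (S n) ^ 2).
  { intros n. left. apply Rinv_0_lt_compat, pow_lt, lt_0_INR. lia. }
  apply Rle_antisym.
  - apply (series_le_bound _ _ _ H'). intros n.
    eapply Rle_trans; [|apply (inv_sqr_partial_sum_bounds n)]. apply Rsum_mono; trivial.
    assert (n < 2 ^ n)%nat by (apply Nat.pow_gt_lin_r; lia). lia.
  - replace (PI ^ 2 / 6) with (PI ^ 2 / 6 - PI ^ 2 * 0) by ring.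
    refine (is_lim_seq_le (fun n => PI ^ 2 / 6 - PI ^ 2 * (1 / 2) ^ n) (fun _ => Li2 1)
      (Finite _) (Finite _) _ _ (is_lim_seq_const _)).
    + intros n. eapply Rle_trans; [apply (inv_sqr_partial_sum_bounds n)|].
      now apply Rsum_le_series.
    + apply is_lim_seq_minus'; [apply is_lim_seq_const|].
      apply is_lim_seq_mult'; [apply is_lim_seq_const|]. apply is_lim_seq_geom.
      rewrite Rabs_pos_eq; lra.
Qed.

(** * Logarithmic coefficients *)

Lemma cderiv_z_exp (f L : C -> C) (DL z : C) :
  (forall w, Cmod w < 1 -> f w = Cmult w (Cexp (L w))) -> Cmod z < 1 -> cderiv L z DL ->
  cderiv f z (Cmult (Cexp (L z)) (Cplus (RtoC 1) (Cmult z DL))).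
Proof.
  intros Hf Hz HL.
  apply (cderiv_ext_disk (fun w => Cmult w (Cexp (L w)))); trivial.
  { intros w Hw. now rewrite Hf. }
  eapply cderiv_eq.
  - apply cderiv_mult; [apply cderiv_id|]. apply cderiv_comp; [exact HL|apply cderiv_Cexp].
  - cbv beta. ring.
Qed.

Lemma z_over_f_exp (f L : C -> C) (z : C) : f z = Cmult z (Cexp (L z)) -> L (RtoC 0) = RtoC 0 ->
  z_over_f f z = Cexp (Copp (L z)).
Proof.
  intros Hf L0. unfold z_over_f. destruct (Ceq_dec z (RtoC 0)) as [->|N].
  - rewrite L0. replace (Copp (RtoC 0)) with (RtoC 0) by ring. now rewrite Cexp_0.
  - rewrite Hf, Cexp_opp. pose proof (Cexp_neq_0 (L z)). field. split; trivial.
Qed.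

(** (z / f)^2 = exp (- 2 L) and f' = exp (L) (1 + z L'). *)
Lemma U_expression (f L : C -> C) (DL z : C) :
  (forall w, Cmod w < 1 -> f w = Cmult w (Cexp (L w))) -> L (RtoC 0) = RtoC 0 ->
  Cmod z < 1 -> cderiv L z DL ->
  Cmult (Cpow (z_over_f f z) 2) (C_derive f z) =
  Cmult (Cexp (Copp (L z))) (Cplus (RtoC 1) (Cmult z DL)).
Proof.
  intros Hf L0 Hz HL.
  rewrite (is_C_derive_unique _ _ _ (cderiv_is_derive _ _ _ (cderiv_z_exp f L DL z Hf Hz HL))).
  rewrite (z_over_f_exp f L) by auto. rewrite Cexp_opp.
  pose proof (Cexp_neq_0 (L z)). simpl Cpow. field. trivial.
Qed.

Lemma f_over_z_exp (f L : C -> C) (z : C) : f (RtoC 0) = RtoC 0 ->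
  Cexp (L z) = f_over_z f z -> f z = Cmult z (Cexp (L z)).
Proof.
  intros F0 H. rewrite H. unfold f_over_z. destruct (Ceq_dec z (RtoC 0)) as [->|N].
  - rewrite F0. ring.
  - field. trivial.
Qed.

Lemma log_coefficients_bound (lam : R) (f : C -> C) (g : nat -> C) : 0 < lam <= 1 ->
  class_U lam f -> log_coefficients f g -> forall N,
  Rsum (fun n => Cmod (g (S n)) ^ 2) N <= 1 / 4 * (PI ^ 2 / 6 + 2 * Li2 lam + Li2 (lam ^ 2)).
Proof.
  intros Hlam [[_ [F0 _]] HU] [L [[_ [L0 HL]] Hg]] N.
  (* The Taylor coefficients of L; the constant term is set to 0 because [g 0] is arbitrary. *)
  set (l := fun n => match n with O => RtoC 0 | S _ => Cmult (RtoC 2) (g n) end).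
  assert (Hl : disk_series l L).
  { intros z Hz. specialize (Hg z Hz). apply is_series_Cseries in Hg.
    assert (K := Cseries_decr (fun n => Cmult (l n) (Cpow z n)) (L z)).
    cbv beta in K. replace (Cplus (L z) (Cmult (l O) (Cpow z 0))) with (L z) in K by (simpl; ring).
    apply K. replace (L z) with (Cmult (RtoC 2) (Cdiv (L z) (RtoC 2))) by field.
    eapply Cseries_ext; [|exact (Cseries_scal (RtoC 2) _ _ Hg)].
    intros n. unfold l. cbv beta. ring. }
  destruct (disk_series_derive _ _ Hl) as [DL [HDL HDL']].
  assert (Hf : forall z, Cmod z < 1 -> f z = Cmult z (Cexp (L z))).
  { intros z Hz. apply f_over_z_exp; trivial. now apply HL. }
  assert (B := U_log_bound l L DL lam Hl eq_refl HDL Hlam).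
  (* The shift skips l 0 = 0; the factor 4 = 2^2 is the origin of 1 / 4 in the bound. *)
  assert (E : Rsum (fun n => Cmod (l n) ^ 2) (S N) = 4 * Rsum (fun n => Cmod (g (S n)) ^ 2) N).
  { rewrite Rsum_shift, <- Rsum_scal. simpl (l O). rewrite Cmod_0.
    rewrite pow_i, Rplus_0_l by lia. apply Rsum_ext. intros n _. unfold l.
    rewrite Cmod_mult, Cmod_R, Rabs_pos_eq by lra. ring. }
  rewrite <- Li2_1.
  assert (B' : Rsum (fun n => Cmod (l n) ^ 2) (S N) <= Li2 1 + 2 * Li2 lam + Li2 (lam ^ 2)); [|lra].
  apply B. intros z Hz. rewrite <- (U_expression f L (DL z) z); auto.
Qed.

(* [f z = z / ((1 - al z) (1 - be z) (1 - ga z))]; here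
   [z / f] has [p - z p' - 1 = - e2 z^2 + 2 e3 z^3] in the elementary symmetric functions. *)
Lemma product_example (lam al be ga : R) :
  Rabs al <= 1 -> Rabs be <= 1 -> Rabs ga <= 1 ->
  (forall z, Cmod z < 1 -> Cmod (Cplus
     (Cmult (Copp (RtoC (al * be + al * ga + be * ga))) (Cpow z 2))
     (Cmult (RtoC (2 * (al * be * ga))) (Cpow z 3))) < lam) ->
  exists (f : C -> C) (g : nat -> C), class_U lam f /\ log_coefficients f g /\
    forall n, g (S n) = RtoC ((al ^ S n + be ^ S n + ga ^ S n) / (2 * INR (S n))).
Proof.
  intros Ha Hb Hc HU. rewrite <- Cmod_R in Ha, Hb, Hc.
  destruct (neglog_ex _ Ha) as [A [HA PA]]. destruct (neglog_ex _ Hb) as [B [HB PB]].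
  destruct (neglog_ex _ Hc) as [D [HD PD]].
  assert (HL := disk_series_plus _ _ _ _ (disk_series_plus _ _ _ _ HA HB) HD).
  set (L := fun z => Cplus (Cplus (A z) (B z)) (D z)) in *.
  set (l := fun n => Cplus (Cplus (neglogc (RtoC al) n) (neglogc (RtoC be) n))
     (neglogc (RtoC ga) n)).
  assert (HL' : disk_series l L) by exact HL. clear HL.
  set (f := fun z => Cmult z (Cexp (L z))).
  assert (L0 : L (RtoC 0) = RtoC 0) by (rewrite (disk_series_at_0 _ _ HL'); unfold l; simpl; ring).
  set (q := fun a z => Cmult a (Cinv (Cminus (RtoC 1) (Cmult a z)))).
  assert (DL : forall z, Cmod z < 1 ->
    cderiv L z (Cplus (Cplus (q (RtoC al) z) (q (RtoC be) z)) (q (RtoC ga) z))).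
  { intros z Hz. apply cderiv_plus; [apply cderiv_plus|]; [apply PA|apply PB|apply PD]; trivial. }
  assert (Df := fun z Hz => cderiv_z_exp f L _ z (fun w _ => eq_refl) Hz (DL z Hz)).
  assert (H0 : Cmod (RtoC 0) < 1) by (rewrite Cmod_0; lra).
  exists f, (fun n => Cmult (RtoC (/ 2)) (l n)). split; [|split].
  - split; [split; [|split]|].
    + intros z Hz. eexists. apply cderiv_is_derive. apply (Df z Hz).
    + unfold f. ring.
    + rewrite (is_C_derive_unique _ _ _ (cderiv_is_derive _ _ _ (Df _ H0))).
      rewrite L0, Cexp_0. ring.
    + intros z Hz.
      rewrite (U_expression f L _ z (fun w _ => eq_refl) L0 Hz (DL z Hz)).
      specialize (HU z Hz). eapply Rle_lt_trans; [right|exact HU]. f_equal.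
      unfold L. rewrite Cexp_opp, !Cexp_plus.
      rewrite (proj2 (PA z Hz)), (proj2 (PB z Hz)), (proj2 (PD z Hz)).
      pose proof (one_minus_neq_0 _ z Ha Hz) as N1. pose proof (one_minus_neq_0 _ z Hb Hz) as N2.
      pose proof (one_minus_neq_0 _ z Hc Hz) as N3.
      unfold q. rewrite !RtoC_mult, !RtoC_plus, !RtoC_mult. field. auto.
  - exists L. split; [split; [|split]|]; trivial.
    + intros z Hz. exact (cderiv_continuous _ _ _ (DL z Hz)).
    + intros z Hz. unfold f_over_z. destruct (Ceq_dec z (RtoC 0)) as [->|N].
      * rewrite L0. apply Cexp_0.
      * unfold f. field. trivial.
    + intros z Hz. apply is_series_Cseries.
      apply (Cseries_incr (fun n => Cmult (Cmult (RtoC (/ 2)) (l n)) (Cpow z n))).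
      replace (Cplus _ _) with (Cmult (RtoC (/ 2)) (L z)).
      * eapply Cseries_ext; [|exact (Cseries_scal (RtoC (/ 2)) _ _ (HL' z Hz))].
        intros n; cbv beta; ring.
      * unfold l; simpl. rewrite RtoC_inv by lra. field.
  - intros n. unfold l, neglogc. rewrite <- !RtoC_pow, <- !RtoC_mult, <- !RtoC_plus, <- !RtoC_mult.
    f_equal. field. apply not_0_INR; lia.
Qed.

(** For z / ((1 - z) (1 - lam z)), e2 = lam and e3 = 0 give the expression - lam z^2, and 2 gamma_n
    = (1 + lam^n) / n. *)
Lemma extremal_example (lam : R) : 0 < lam <= 1 ->
  exists (f : C -> C) (g : nat -> C), class_U lam f /\ log_coefficients f g /\
    is_series (fun n => Cmod (g (S n)) ^ 2)
      (1 / 4 * (PI ^ 2 / 6 + 2 * Li2 lam + Li2 (lam ^ 2))).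
Proof.
  intros Hlam.
  destruct (product_example lam 1 lam 0) as [f [g [HU [Hg E]]]].
  - rewrite Rabs_pos_eq; lra.
  - rewrite Rabs_pos_eq; lra.
  - rewrite Rabs_pos_eq; lra.
  - intros z Hz. replace (Cplus _ _) with (Cmult (Copp (RtoC lam)) (Cpow z 2)).
    + rewrite Cmod_mult, Cmod_opp, Cmod_R, Cmod_pow, Rabs_pos_eq by lra.
      pose proof (Cmod_ge_0 z). assert (Cmod z ^ 2 < 1) by (simpl; nra). nra.
    + replace (1 * lam + 1 * 0 + lam * 0) with lam by ring.
      replace (2 * (1 * lam * 0)) with 0 by ring. ring.
  - exists f, g. split; [|split]; trivial. rewrite <- Li2_1.
    assert (S1 := is_series_scal (1 / 4) _ _ (is_series_plus _ _ _ _ (is_series_plus _ _ _ _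
      (Li2_is_series 1 ltac:(lra)) (is_series_scal 2 _ _ (Li2_is_series lam ltac:(lra))))
      (Li2_is_series (lam ^ 2) ltac:(nra)))).
    apply (is_series_ext_R _ _ _ S1). intros n.
    match goal with |- ?x = _ => change x with (1 / 4 * (1 ^ S n / INR (S n) ^ 2 +
      2 * (lam ^ S n / INR (S n) ^ 2) + (lam ^ 2) ^ S n / INR (S n) ^ 2)) end.
    rewrite E, Cmod_R, pow2_abs, pow1, pow_i by lia.
    rewrite <- pow_mult, Nat.mul_comm, pow_mult. field. apply not_0_INR; lia.
Qed.

(* [al] and [be] are the roots of [t^2 - c t - c] with [c = lam / 2], so that
   [z / f = (1 - z) (1 - c z - c z^2) = 1 - (1 + c) z + c z^3]. *)
Lemma large_coefficient_example (lam : R) : 0 < lam <= 1 ->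
  exists (f : C -> C) (g : nat -> C), class_U lam f /\ log_coefficients f g /\
    exists n, (1 <= n)%nat /\ Cmod (g n) > (1 + lam ^ n) / (2 * INR n).
Proof.
  intros Hlam. set (c := lam / 2). set (s := sqrt (c ^ 2 + 4 * c)).
  assert (Hc : 0 < c <= 1 / 2) by (unfold c; lra).
  assert (Es : s * s = c ^ 2 + 4 * c) by (apply sqrt_sqrt; nra).
  assert (Ps : 0 <= s) by apply sqrt_pos.
  set (al := (c + s) / 2). set (be := (c - s) / 2).
  assert (E1 : al + be = c) by (unfold al, be; field).
  assert (E2 : al * be = - c).
  { unfold al, be. replace ((c + s) / 2 * ((c - s) / 2)) with ((c ^ 2 - s * s) / 4) by field.
    rewrite Es. field. }
  destruct (product_example lam 1 al be) as [f [g [HU [Hg E]]]].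
  - rewrite Rabs_pos_eq; lra.
  (* As c <= 1 / 2, s^2 = c^2 + 4 c <= 9 / 4, so s <= 3 / 2 and both roots lie in [-1, 1]. *)
  - unfold al. apply Rabs_le. split; nra.
  - unfold be. apply Rabs_le. split; nra.
  - intros z Hz. replace (Cplus _ _) with (Cmult (RtoC (- lam)) (Cpow z 3)).
    + rewrite Cmod_mult, Cmod_R, Cmod_pow, Rabs_Ropp, Rabs_pos_eq by lra.
      pose proof (Cmod_ge_0 z). assert (Cmod z ^ 3 < 1); [|nra].
      apply Rle_lt_trans with (Cmod z); [|trivial]. simpl.
      assert (Cmod z * Cmod z <= 1) by nra. nra.
    (* e2 = (al + be) + al be = c - c = 0 removes the quadratic term, and 2 e3 = - 2 c = - lam; this
       is why c = lam / 2. *)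
    + replace (1 * al + 1 * be + al * be) with 0 by (rewrite E2; lra).
      replace (2 * (1 * al * be)) with (- lam) by (rewrite Rmult_1_l, E2; unfold c; field). ring.
  (* For n = 1 the power sum 1 + c stays below 1 + lam; for n = 2 it is 1 + lam + lam^2 / 4, which
     exceeds 1 + lam^2. *)
  - exists f, g. split; [|split]; trivial. exists 2%nat. split; [lia|].
    rewrite E, Cmod_R.
    replace (al ^ 2) with (c * al + c) by (unfold al; nra).
    replace (be ^ 2) with (c * be + c) by (unfold be; nra).
    replace (1 ^ 2 + (c * al + c) + (c * be + c)) with (1 + c * (al + be) + 2 * c) by ring.
    rewrite E1. simpl INR.
    apply Rlt_gt. eapply Rlt_le_trans; [|apply Rle_abs].
    unfold Rdiv. apply Rmult_lt_compat_r; [apply Rinv_0_lt_compat; lra|].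
    unfold c. nra.
Qed.

Theorem theorem1 :
  forall lam : R, 0 < lam <= 1 ->
    (forall (f : C -> C) (g : nat -> C),
        class_U lam f -> log_coefficients f g ->
        ex_series (fun n : nat => Cmod (g (S n)) ^ 2) /\
        Series (fun n : nat => Cmod (g (S n)) ^ 2)
          <= 1 / 4 * (PI ^ 2 / 6 + 2 * Li2 lam + Li2 (lam ^ 2))) /\
    (exists (f : C -> C) (g : nat -> C),
        class_U lam f /\ log_coefficients f g /\
        is_series (fun n : nat => Cmod (g (S n)) ^ 2)
          (1 / 4 * (PI ^ 2 / 6 + 2 * Li2 lam + Li2 (lam ^ 2)))) /\
    (exists (f : C -> C) (g : nat -> C),
        class_U lam f /\ log_coefficients f g /\
        exists n : nat, (1 <= n)%nat /\
          Cmod (g n) > (1 + lam ^ n) / (2 * INR n)).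
Proof.
  intros lam Hlam. split; [|split; [now apply extremal_example|now apply large_coefficient_example]].
  intros f g HU Hg. assert (B := log_coefficients_bound lam f g Hlam HU Hg).
  assert (S1 : ex_series (fun n => Cmod (g (S n)) ^ 2)).
  { apply (ex_series_bounded _ _ (fun n => pow2_ge_0 _) B). }
  split; trivial. apply (series_le_bound _ _ _ (Series_correct _ S1) B).
Qed.
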